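(* Let $t>0$ and $\rho\in\mathbb{R}^d$ with $|\rho|=1$ be fixed, and suppose that the spatial mesh sizes $\lambda=\lambda_n>0$ satisfy $\lambda_n=o(n^{-1/4})$. Then the method-of-moments estimator $$\hat\vartheta_{\mathrm{sp},n}=\frac{t\,C_{\mathrm{sp},\mathbb{E}}}{n^{-1}\lambda^{\beta-2}\mathbf{V}_{\mathrm{sp}}}$$ satisfies, as $n\to\infty$, $$\sqrt{n}\,(\hat\vartheta_{\mathrm{sp},n}-\vartheta)\xrightarrow{d}N\left(0,\vartheta^2\frac{C_{\mathrm{sp},\mathbb{V}}}{(C_{\mathrm{sp},\mathbb{E}})^2}\right).$$
   Context: Let $d\in\mathbb{N}$, $\beta\in(0,\min(2,d))$ and $\vartheta>0$. $u=(u(t,x))_{t\ge0,x\in\mathbb{R}^d}$ denotes the solution of the stochastic wave equation $\partial_{tt}^2u=\vartheta\Delta u+\dot W_\beta$ on $\mathbb{R}^d$ with $u(0,\cdot)=\partial_tu(0,\cdot)\equiv0$, driven by centred Gaussian noise that is white in time and has Riesz-kernel spatial covariance (proportional to $|x-y|^{-\beta}$) with spectral density $|\xi|^{\beta-d}$. That is, $u$ is the centred Gaussian process with covariance $$\mathbb{E}[u(t,x)u(s,y)]=\frac{1}{(2\pi)^d}\int_0^{t\wedge s}\int_{\mathbb{R}^d}e^{\mathrm{i}(x-y)\cdot\xi}\,\frac{\sin((t-r)\sqrt\vartheta|\xi|)}{\sqrt\vartheta|\xi|}\,\frac{\sin((s-r)\sqrt\vartheta|\xi|)}{\sqrt\vartheta|\xi|}\,|\xi|^{\beta-d}\,d\xi\,dr.$$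 Observation points: $x_k=\lambda k\rho$, $k=0,\dots,n+1$. Define $\mathbf{I}_{\mathrm{sp},k}=u(t,x_{k+1})+u(t,x_{k-1})-2u(t,x_k)$ for $k=1,\dots,n$ and $\mathbf{V}_{\mathrm{sp}}=\sum_{k=1}^n\mathbf{I}_{\mathrm{sp},k}^2$. Constants: with $g_{\mathrm{sp}}(\omega)=\sin^4(\rho\cdot\omega/2)|\omega|^{\beta-d-2}$ and $\mathcal{F}_c(f)(\xi)=\int_{\mathbb{R}^d}\cos(\xi\cdot\omega)f(\omega)\,d\omega$, $$C_{\mathrm{sp},\mathbb{E}}=\frac{8}{(2\pi)^d}\|g_{\mathrm{sp}}\|_{L^1(\mathbb{R}^d)},\qquad C_{\mathrm{sp},\mathbb{V}}=\frac{128}{(2\pi)^{2d}}\sum_{k\in\mathbb{Z}}\big(\mathcal{F}_c(g_{\mathrm{sp}})(k\rho)\big)^2.$$ *)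

(* Defs.v *)
From HB Require Import structures.
From mathcomp Require Import all_boot all_order all_algebra.
From mathcomp Require Import all_classical all_reals all_analysis.
From mathcomp Require Import measurable_realfun.
From mathcomp Require Import complex.

Set Implicit Arguments.
Unset Strict Implicit.
Unset Printing Implicit Defensive.

Import Order.TTheory GRing.Theory Num.Theory.
Import numFieldNormedType.Exports.

Local Open Scope classical_set_scope.
Local Open Scope ring_scope.

(* 'rV[T]_n carries the product sigma-algebra; for T = R this is the Borel
   sigma-algebra of R^n. *)
Section measurable_rV.
Context {d} {T : measurableType d} (n : nat).

Let coord : 'I_n -> 'rV[T]_n -> T := fun i x => x ord0 i.

Let rV_set0 : g_sigma_preimage coord set0.
Proof. exact: sigma_algebra0. Qed.

Let rV_setC A : g_sigma_preimage coord A -> g_sigma_preimage coord (~` A).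
Proof. exact: sigma_algebraC. Qed.

Let rV_bigcup (F : _^nat) : (forall i, g_sigma_preimage coord (F i)) ->
  g_sigma_preimage coord (\bigcup_i (F i)).
Proof. exact: sigma_algebra_bigcup. Qed.

HB.instance Definition _ := @isMeasurable.Build (measure_tuple_display d)
  'rV[T]_n (g_sigma_preimage coord) rV_set0 rV_setC rV_bigcup.

End measurable_rV.

Lemma measurable_coord_rV d (T : measurableType d) n (i : 'I_n) :
  measurable_fun [set: 'rV[T]_n] (fun x => x ord0 i).
Proof.
move=> _ Y mY; rewrite setTI; apply: sub_sigma_algebra => /=.
rewrite -bigcup_seq/=; exists i => /=; first by rewrite mem_index_enum.
by exists Y => //; rewrite setTI.
Qed.

Lemma measurable_fun_rV d d' (T : measurableType d) (T' : measurableType d') n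
    (f : T' -> 'rV[T]_n) :
  (forall i, measurable_fun [set: T'] (fun x => f x ord0 i)) ->
  measurable_fun [set: T'] f.
Proof.
move=> mf.
have prefS : g_sigma_preimage (fun i x => f x ord0 i) `<=`
    (measurable : set (set T')).
  apply: smallest_sub; first exact: sigma_algebra_measurable.
  rewrite -bigcup_seq; apply: bigcup_sub => i _ A [B mB <-].
  exact: mf.
move=> _ A mA; apply: prefS.
rewrite (@g_sigma_preimage_comp _ _ _ _
  (fun i (x : 'rV[T]_n) => x ord0 i) _ f).
by exists A.
Qed.

Section cons_rV.
Context (R : realType) (n : nat).

Definition cons_rV (p : measurableTypeR R * 'rV[R]_n) : 'rV[R]_n.+1 :=
  \row_(i < n.+1) oapp (p.2 ord0) p.1 (unlift ord0 i).

Definition uncons_rV (x : 'rV[R]_n.+1) : measurableTypeR R * 'rV[R]_n :=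
  (x ord0 ord0, \row_(i < n) x ord0 (lift ord0 i)).

Lemma cons_rV0 p : cons_rV p ord0 ord0 = p.1.
Proof. by rewrite mxE unlift_none. Qed.

Lemma cons_rVS p i : cons_rV p ord0 (lift ord0 i) = p.2 ord0 i.
Proof. by rewrite mxE liftK. Qed.

Lemma cons_rVK : cancel cons_rV uncons_rV.
Proof.
move=> [a x]; rewrite /uncons_rV cons_rV0; congr pair.
by apply/rowP => i; rewrite mxE cons_rVS.
Qed.

Lemma measurable_cons_rV :
  measurable_fun [set: measurableTypeR R * 'rV[R]_n] cons_rV.
Proof.
apply: measurable_fun_rV => i; have [j|] := unliftP ord0 i => ->.
  rewrite (_ : (fun _ => _) = (fun x : 'rV[R]_n => x ord0 j) \o snd).
    by apply: measurableT_comp => //; exact: measurable_coord_rV.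
  by apply/funext => p; rewrite cons_rVS.
by rewrite (_ : (fun _ => _) = fst)//; apply/funext => p; rewrite cons_rV0.
Qed.

Lemma measurable_uncons_rV : measurable_fun [set: 'rV[R]_n.+1] uncons_rV.
Proof.
apply/measurable_fun_pairP; split => /=.
  exact: (@measurable_coord_rV _ _ n.+1 ord0).
apply: measurable_fun_rV => i.
rewrite (_ : (fun _ => _) = fun x : 'rV[R]_n.+1 => x ord0 (lift ord0 i)).
  exact: (@measurable_coord_rV _ _ n.+1).
by apply/funext => x /=; rewrite mxE.
Qed.

Variable mu : {sigma_finite_measure set 'rV[R]_n -> \bar R}.

Definition cons_measure : set 'rV[R]_n.+1 -> \bar R :=
  pushforward (lebesgue_measure \x mu)%E cons_rV.

Let mcons (A : set 'rV[R]_n.+1) : measurable A -> measurable (cons_rV @^-1` A).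
Proof.
by move=> mA; rewrite -[X in measurable X]setTI; exact: measurable_cons_rV.
Qed.

Let cons_measure0 : cons_measure set0 = 0%E.
Proof. by rewrite /cons_measure /pushforward preimage_set0 measure0. Qed.

Let cons_measure_ge0 A : (0 <= cons_measure A)%E.
Proof. by rewrite /cons_measure /pushforward measure_ge0. Qed.

Let cons_measure_sigma_additive : semi_sigma_additive cons_measure.
Proof.
move=> F mF tF mUF; rewrite /cons_measure /pushforward preimage_bigcup.
apply: measure_semi_sigma_additive.
- by move=> k; exact: mcons.
- apply/trivIsetP => /= i j _ _ ij; rewrite -preimage_setI.
  by move/trivIsetP : tF => /(_ _ _ _ _ ij) ->//; rewrite preimage_set0.
- by rewrite -preimage_bigcup; exact: mcons.
Qed.

HB.instance Definition _ := isMeasure.Build _ _ _ cons_measure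
  cons_measure0 cons_measure_ge0 cons_measure_sigma_additive.

Let cons_measure_sigma_finite : sigma_finite setT cons_measure.
Proof.
have /sigma_finiteP[F [TF ndF Foo]] := sigma_finiteT (@lebesgue_measure R).
have /sigma_finiteP[G [TG ndG Goo]] := sigma_finiteT mu.
exists (fun k => uncons_rV @^-1` (F k `*` G k)).
  rewrite -preimage_bigcup -[LHS](preimage_setT uncons_rV); congr (_ @^-1` _).
  rewrite -setXTT TF TG predeqE => -[x y]; split.
    move=> [/= [k _ Fkx] [l _ Gly]]; exists (maxn k l) => //; split.
    - by move: x Fkx; exact/subsetPset/ndF/leq_maxl.
    - by move: y Gly; exact/subsetPset/ndG/leq_maxr.
  by move=> [k _ []/= ? ?]; split; exists k.
move=> k; have [mF Fk] := Foo k; have [mG Gk] := Goo k.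
have mFG : measurable (F k `*` G k) by exact: measurableX.
split.
  by rewrite -[X in measurable X]setTI; exact: measurable_uncons_rV.
rewrite /cons_measure /pushforward -comp_preimage.
rewrite (_ : uncons_rV \o cons_rV = id); last first.
  by apply/funext => p; exact: cons_rVK.
by rewrite preimage_id product_measure1E// lte_mul_pinfty// ge0_fin_numE.
Qed.

HB.instance Definition _ := Measure_isSigmaFinite.Build _ _ _ cons_measure
  cons_measure_sigma_finite.

End cons_rV.

(* Lebesgue measure on R^n as an iterated product; it is pinned down by its
   value on boxes, see [lebesgue_rV_box]. *)
Fixpoint lebesgue_rV (R : realType) (n : nat) :
    {sigma_finite_measure set 'rV[R]_n -> \bar R} :=
  match n with
  | 0 => \d_(0 : 'rV[R]_0)
  | m.+1 => cons_measure (lebesgue_rV R m)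
  end.

Lemma lebesgue_rV_box (R : realType) n (A : 'I_n -> set R) :
  (forall i, measurable (A i)) ->
  lebesgue_rV R n [set x | forall i, A i (x ord0 i)] =
  (\prod_(i < n) lebesgue_measure (A i))%E.
Proof.
elim: n A => [|n IH] A mA.
  by rewrite big_ord0 /= diracE mem_set// => -[].
have mbox m (B : 'I_m -> set R) : (forall i, measurable (B i)) ->
    measurable [set x : 'rV[R]_m | forall i, B i (x ord0 i)].
  move=> mB; rewrite (_ : [set x | _] =
      \bigcap_(i in [set: 'I_m]) ((fun x : 'rV[R]_m => x ord0 i) @^-1` B i)).
    apply: fin_bigcap_measurable => // i _; rewrite -[X in measurable X]setTI.
    exact: measurable_coord_rV.
  by apply/seteqP; split=> [x Bx i _|x Bx i]; exact: Bx.
rewrite big_ord_recl -IH// /= /cons_measure /pushforward.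
rewrite -product_measure1E//; last by
  apply: (mbox n (fun i => A (lift ord0 i))) => i; exact: mA.
congr (_ _); apply/seteqP; split => [p Ap|p [Ap1 Ap2] i] /=.
  split=> [|i]; first by have := Ap ord0; rewrite cons_rV0.
  by have := Ap (lift ord0 i); rewrite cons_rVS.
by have [j ->|->] := unliftP ord0 i; rewrite ?cons_rVS ?cons_rV0.
exact: mA.
Qed.

Definition dot (R : realType) (d : nat) (x y : 'rV[R]_d) : R :=
  \sum_(i < d) x ord0 i * y ord0 i.

(* The norm [`|x|] that the library puts on row vectors is the sup norm. *)
Definition enorm (R : realType) (d : nat) (x : 'rV[R]_d) : R :=
  Num.sqrt (dot x x).

Definition expi (R : realType) (x : R) : R[i] := Complex (cos x) (sin x).

Definition Cintegral d (T : measurableType d) (R : realType)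
    (mu : {measure set T -> \bar R}) (D : set T) (f : T -> R[i]) : R[i] :=
  Complex (\int[mu]_(x in D) complex.Re (f x))
    (\int[mu]_(x in D) complex.Im (f x)).

Lemma measurable_invr (R : realType) : measurable_fun [set: R] (@GRing.inv R).
Proof.
rewrite -(setvU [set 0]).
apply/measurable_funU => //; first exact: measurableC.
split; last exact: measurable_fun_set1.
apply: open_continuous_measurable_fun.
  by apply: closed_openC; exact: closed_eq.
by move=> x; rewrite inE/= => /eqP x0; exact: inv_continuous.
Qed.

Section law.
Context (R : realType).

(* The library's [normal_prob m 0] is the uniform law on [0, 1], not the Dirac
   mass at [m]. *)
Definition gaussian_law (m v : R) : probability (measurableTypeR R) R :=
  if v == 0 then (\d_(m : measurableTypeR R) : probability _ _)
  else (normal_prob m (Num.sqrt v) : probability _ _).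

(* Convergence of the distribution functions at every continuity point of the
   limiting one. *)
Definition cvg_in_law d (Omega : measurableType d) (P : probability Omega R)
    (X : nat -> {RV P >-> R}) (nu : probability (measurableTypeR R) R) :=
  forall x : R, {for x, continuous (fun r : R => nu `]-oo, r]%classic)} ->
    cdf (X n) x @[n --> \oo] --> nu `]-oo, x]%classic.

End law.
Arguments cvg_in_law {R d Omega} P X nu.

Section wave.
Context (R : realType) (dim : nat) (beta theta : R).
Local Notation vec := 'rV[R]_dim.
Local Notation leb := (lebesgue_rV R dim).
Local Open Scope complex_scope.

Definition wave_kernel (t : R) (xi : vec) : R :=
  sin (t * Num.sqrt theta * enorm xi) / (Num.sqrt theta * enorm xi).

(* Division by 0 and 0 `^ a only occur at xi = 0, a null set. *)
Definition wave_covariance (t : R) (x : vec) (s : R) (y : vec) : R[i] :=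
  ((2 * pi) ^- dim)%:C *
  Cintegral (@lebesgue_measure R) `[0, Num.min t s] (fun r =>
    Cintegral leb setT (fun xi =>
      expi (dot (x - y) xi) *
      (wave_kernel (t - r) xi * wave_kernel (s - r) xi *
       enorm xi `^ (beta - dim%:R))%:C)).

Context d (Omega : measurableType d) (P : probability Omega R).
Variable u : R -> vec -> {RV P >-> R}.

(* The two laws are compared on measurable sets because a measure is
   unspecified outside the sigma-algebra. *)
Definition centred_gaussian_field :=
  forall (m : nat) (t : 'I_m -> R) (x : 'I_m -> vec) (a : 'I_m -> R),
    (forall i, 0 <= t i) ->
    exists2 v : R, 0 <= v & forall A : set R, measurable A ->
      pushforward P (fun w => \sum_(i < m) a i * u (t i) (x i) w) A
      = gaussian_law 0 v A.

(* The mild solution of u_tt = theta * Laplacian u + W with zero initial data is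
   the centred Gaussian process with this covariance. *)
Definition wave_solution :=
  centred_gaussian_field /\
  forall (t s : R) (x y : vec), 0 <= t -> 0 <= s ->
    (fine 'E_P[(u t x : Omega -> R) \* u s y])%:C = wave_covariance t x s y.

End wave.

Section estimator.
Context (R : realType) (dim : nat) (beta : R).
Local Notation vec := 'rV[R]_dim.
Local Notation leb := (lebesgue_rV R dim).

Definition cosine_transform (f : vec -> R) (xi : vec) : R :=
  \int[leb]_omega (cos (dot xi omega) * f omega).

Definition g_sp (rho omega : vec) : R :=
  sin (dot rho omega / 2) ^+ 4 * enorm omega `^ (beta - dim%:R - 2).

Definition C_sp_E (rho : vec) : R :=
  8 / (2 * pi) ^+ dim * fine ('N[leb]_1[EFin \o g_sp rho])%E.

Definition C_sp_V (rho : vec) : R :=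
  128 / (2 * pi) ^+ (2 * dim) *
  fine (\esum_(k in [set: int])
    ((cosine_transform (g_sp rho) (k%:~R *: rho)) ^+ 2)%:E)%E.

Context d (Omega : measurableType d) (P : probability Omega R).
Variables (u : R -> vec -> {RV P >-> R}) (t : R) (rho : vec).

Definition x_sp (lambda : R) (k : nat) : vec := (lambda * k%:R) *: rho.

Definition I_sp (lambda : R) (k : nat) : Omega -> R := fun w =>
  u t (x_sp lambda k.+1) w + u t (x_sp lambda k.-1) w
  - 2 * u t (x_sp lambda k) w.

Definition V_sp (n : nat) (lambda : R) : Omega -> R := fun w =>
  \sum_(1 <= k < n.+1) I_sp lambda k w ^+ 2.

Definition theta_hat_sp (n : nat) (lambda : R) : Omega -> R := fun w =>
  t * C_sp_E rho / (n%:R^-1 * lambda `^ (beta - 2) * V_sp n lambda w).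

Lemma measurable_V_sp n lambda : measurable_fun setT (V_sp n lambda).
Proof.
apply: measurable_sum => k.
apply: measurable_funX.
apply: measurable_funB; first exact: measurable_funD.
exact: measurable_funM.
Qed.

Lemma measurable_theta_hat_sp n lambda :
  measurable_fun setT (theta_hat_sp n lambda).
Proof.
apply: measurable_funM => //.
apply: (measurableT_comp (@measurable_invr R)).
by apply: measurable_funM => //; exact: measurable_V_sp.
Qed.

HB.instance Definition _ n lambda := isMeasurableFun.Build _ _ _ _
  (theta_hat_sp n lambda) (measurable_theta_hat_sp n lambda).

Definition error_sp (theta : R) (n : nat) (lambda : R) : Omega -> R := fun w =>
  Num.sqrt n%:R * (theta_hat_sp n lambda w - theta).

Lemma measurable_error_sp theta n lambda :
  measurable_fun setT (error_sp theta n lambda).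
Proof.
by apply: measurable_funM => //; exact: measurable_funB.
Qed.

HB.instance Definition _ theta n lambda := isMeasurableFun.Build _ _ _ _
  (error_sp theta n lambda) (measurable_error_sp theta n lambda).

End estimator.

(* Main.v *)
From HB Require Import structures.
Require Import Defs.
From mathcomp Require Import all_boot all_order all_algebra.
From mathcomp Require Import all_classical all_reals all_analysis.
From mathcomp Require Import measurable_realfun complex ring lra.
Set Implicit Arguments.
Unset Strict Implicit.
Unset Printing Implicit Defensive.
Import Order.TTheory GRing.Theory Num.Theory numFieldNormedType.Exports.
Local Open Scope classical_set_scope.
Local Open Scope ring_scope.

(** Second differences of [u], scaled by [lambda `^ ((beta - 2) / 2)], are jointly centred Gaussian, so
    the law of the mean square [n^-1 * lambda `^ (beta - 2) * V_sp] is determined by their covariance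
    matrix [S_n]. Integrating the squared wave kernel over time and substituting [lambda *: xi] for the
    frequency shows that [S_n] is a Toeplitz matrix with entries [c0 * (F (j - k) - e (j - k))]. Here
    [F k] is the cosine transform of [g_sp] at [k *: rho], and [e k] is the same transform after
    multiplication of [g_sp] by the function [sinc_w], sin (L |w|) / (L |w|) with L of order 1 / lambda.
    The constants of the theorem are [t * C_sp_E = theta * c0 * F 0], and [C_sp_V], which is
    proportional to the sum of [F k ^+ 2] over the integers.

    Three estimates on [S_n] are needed. Its operator norm is bounded uniformly in [n] and [lambda]
    ([incr_covmx_opnorm]): up to a factor 2 the quadratic form is the integral of the squared modulus of
    a trigonometric polynomial in [dot rho w] against [g_sp], and slicing along a coordinate where [rho]
    does not vanish reduces it to a periodic function on the line against a decaying weight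
    ([trig_sq_gsp_bound]). Its trace is [n * c0 * F 0] up to [O(n * lambda ^+ 2)] ([bias_bound]): the
    sine in [sinc_w] oscillates, and averaging over dilations, under which the integrand is homogeneous,
    makes this visible in one variable ([sinc_bias]). Finally the sum of its squared entries, divided
    by [n], tends to [c0 ^+ 2] times the sum of [F k ^+ 2] ([incr_covmx_energy]): a Bessel inequality
    dual to the first estimate ([bessel_gsp]) bounds the contribution of [e], and a Cesaro mean remains.

    The moment generating function of a sum of squares of Gaussian variables is computed without
    diagonalisation ([mgf_sumsq]). Writing each exponential of a square as a Gaussian mixture of
    exponentials, or of cosines when the exponent is negative, removes one square at a time and changes
    the covariance matrix by a rank one tilt. The result is a product over the pivots of
    [1 - 2 * s * S_n], whose logarithm is [s * \tr S_n] plus [s ^+ 2] times the sum of the squared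
    entries, up to [O(n * `|s| ^+ 3)] as the operator norm is bounded ([tilt_prod_log]). At
    [s = a / sqrt n] the remainder vanishes in the limit, and so does the bias, of order
    [sqrt n * lambda ^+ 2], because [lambda = o(n^(-1/4))]. Hence the moment generating functions of the
    centred mean square, multiplied by [sqrt n], converge to that of a normal law
    ([mgf_centred_mean_sq]), and Curtiss' theorem gives convergence in law ([cdf_cvg_mgf]).

    The estimator is a constant divided by the mean square, hence decreasing in it, so the event that
    its error is at most [x] is the event that the linearised error is at most a level that tends to [x]
    ([ratio_error_le]). This transfers the limit to the estimator ([asymptotic_normality]). *)

(** * Integration preliminaries *)

Lemma integrable_bound d (T : measurableType d) (R : realType)
    (mu : {measure set T -> \bar R}) (D : set T) (f g : T -> R) :
  measurable D -> measurable_fun D f -> (forall x, D x -> `|f x| <= g x) ->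
  mu.-integrable D (EFin \o g) -> mu.-integrable D (EFin \o f).
Proof.
move=> mD mf fg; apply: le_integrable => //; first exact/measurable_EFinP.
move=> x Dx; rewrite /= lee_fin (le_trans (fg _ Dx))//.
exact: ler_norm.
Qed.

Lemma integrable_ge0 d (T : measurableType d) (R : realType)
    (mu : {measure set T -> \bar R}) (D : set T) (f : T -> R) :
  measurable D -> measurable_fun D f -> (forall x, D x -> 0 <= f x) ->
  (\int[mu]_(x in D) (f x)%:E < +oo)%E -> mu.-integrable D (EFin \o f).
Proof.
move=> mD mf f0 foo; apply/integrableP; split; first exact/measurable_EFinP.
apply: le_lt_trans foo; rewrite le_eqVlt; apply/orP; left; apply/eqP.
by apply: eq_integral => x /set_mem Dx /=; rewrite ger0_norm// f0.
Qed.

Lemma integral_EFinE d (T : measurableType d) (R : realType)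
    (mu : {measure set T -> \bar R}) (D : set T) (f : T -> R) :
  measurable D -> mu.-integrable D (EFin \o f) ->
  (\int[mu]_(x in D) (f x)%:E = (\int[mu]_(x in D) f x)%:E)%E.
Proof.
move=> mD fi; rewrite /Rintegral fineK//.
exact: (@integrable_fin_num _ _ _ mu D mD _ fi).
Qed.

Lemma Rintegral_dominated_cvg d (T : measurableType d) (R : realType)
    (mu : {measure set T -> \bar R}) (D : set T)
    (f_ : nat -> T -> R) (f g : T -> R) :
  measurable D -> (forall n, measurable_fun D (f_ n)) -> measurable_fun D f ->
  (forall x, D x -> f_ n x @[n --> \oo] --> f x) ->
  mu.-integrable D (EFin \o g) ->
  (forall n x, D x -> `|f_ n x| <= g x) ->
  \int[mu]_(x in D) f_ n x @[n --> \oo] --> \int[mu]_(x in D) f x.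
Proof.
move=> mD mf_ mf ff ig fg.
have [fi _ H] : [/\ mu.-integrable D (EFin \o f),
    [sequence (\int[mu]_(x in D) `|(f_ n x)%:E - (f x)%:E|)%E]_n @ \oo --> 0%E
    & [sequence (\int[mu]_(x in D) (f_ n x)%:E)%E]_n @ \oo -->
      (\int[mu]_(x in D) (f x)%:E)%E].
  apply: (@dominated_convergence _ _ _ mu D mD (fun n x => (f_ n x)%:E)
    (EFin \o f) (EFin \o g)) => //.
  - by move=> n; apply/measurable_EFinP; exact: mf_.
  - exact/measurable_EFinP.
  - apply/aeW => x Dx; apply: cvg_EFin; last exact: ff.
    exact: nearW.
  - by apply/aeW => x n Dx; rewrite /= lee_fin; exact: fg.
by apply: fine_cvg; rewrite -integral_EFinE.
Qed.

Section density.
Import HBNNSimple.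

(** Both sides are monotone limits along the same simple functions, and on an indicator the identity
    is the formula for [nu]. *)
Lemma ge0_integral_density d (T : measurableType d) (R : realType)
    (mu nu : {measure set T -> \bar R}) (p : T -> R) (f : T -> \bar R) :
  measurable_fun setT p -> (forall x, 0 <= p x) ->
  (forall A, measurable A -> nu A = \int[mu]_(x in A) (p x)%:E)%E ->
  measurable_fun setT f -> (forall x, 0 <= f x)%E ->
  (\int[nu]_x f x = \int[mu]_x (f x * (p x)%:E))%E.
Proof.
move=> mp p0 nuE mf f0.
have mpE : measurable_fun setT (EFin \o p) by exact/measurable_EFinP.
pose g := nnsfun_approx measurableT mf.
have gf x : (g n x)%:E @[n --> \oo] --> f x by exact: cvg_nnsfun_approx.
have nd x : {homo (fun n => (g n x)%:E) : a b / (a <= b)%N >-> (a <= b)%E}.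
  by move=> a b ab; rewrite lee_fin; exact/lefP/nd_nnsfun_approx.
have -> : (\int[nu]_x f x = limn (fun n => \int[nu]_x (g n x)%:E))%E.
  rewrite -monotone_convergence//.
  - by apply: eq_integral => x _; apply/esym/cvg_lim.
  - by move=> n; exact/measurable_EFinP.
  - by move=> n x _; rewrite lee_fin.
have -> : (\int[mu]_x (f x * (p x)%:E) =
    limn (fun n => \int[mu]_x ((g n x)%:E * (p x)%:E)))%E.
  rewrite -monotone_convergence//.
  - apply: eq_integral => x _; apply/esym/cvg_lim => //.
    exact: cvgeZr.
  - by move=> n; apply: emeasurable_funM => //; exact/measurable_EFinP.
  - by move=> n x _; rewrite mule_ge0// lee_fin.
  - by move=> x _ a b ab; rewrite lee_wpmul2r ?lee_fin//; exact: nd.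
congr (limn _); apply/funext => n.
under eq_integral do rewrite fimfunE -fsumEFin//.
have E x : ((g n x)%:E * (p x)%:E =
    \sum_(r \in range (g n)) ((r * \1_(g n @^-1` [set r]) x)%:E * (p x)%:E))%E.
  rewrite -ge0_mule_fsuml; first by rewrite fimfunE -fsumEFin.
  by move=> r; rewrite EFinM nnfun_muleindic_ge0.
under [RHS]eq_integral do rewrite E.
rewrite ge0_integral_fsum//; last 2 first.
- by move=> r; apply/measurable_EFinP; apply: measurable_funM => //; exact: measurable_indic.
- by move=> r x _; rewrite EFinM nnfun_muleindic_ge0.
rewrite ge0_integral_fsum//; last 2 first.
- move=> r; apply: emeasurable_funM => //; apply/measurable_EFinP.
  by apply: measurable_funM => //; exact: measurable_indic.
- by move=> r x _; rewrite EFinM mule_ge0 ?nnfun_muleindic_ge0// lee_fin.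
apply: eq_fsbigr => r; rewrite inE => -[x0 _ <-].
under eq_integral do rewrite EFinM.
under [RHS]eq_integral do rewrite EFinM -muleA.
rewrite ge0_integralZl//; last 2 first.
- exact/measurable_EFinP/measurable_indic.
- by rewrite lee_fin.
rewrite ge0_integralZl//; last 3 first.
- by apply: emeasurable_funM => //; exact/measurable_EFinP/measurable_indic.
- by move=> x _; rewrite -EFinM lee_fin mulr_ge0.
- by rewrite lee_fin.
rewrite integral_indic// setIT nuE//; congr (_ * _)%E.
rewrite integral_mkcond; apply: eq_integral => x _.
by rewrite patchE indicE; case: ifPn; rewrite ?mul1e ?mul0e.
Qed.

End density.

(** Domination by a product of integrable functions justifies all the later exchanges of
    integrals. *)
Lemma integrable_prod_bound d1 d2 (T1 : measurableType d1) (T2 : measurableType d2)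
    (R : realType) (m1 : {sigma_finite_measure set T1 -> \bar R})
    (m2 : {sigma_finite_measure set T2 -> \bar R})
    (f : T1 * T2 -> R) (G : T1 -> R) (H : T2 -> R) :
  measurable_fun setT f -> (forall x y, `|f (x, y)| <= G x * H y) ->
  (forall x, 0 <= G x) -> (forall y, 0 <= H y) ->
  m1.-integrable setT (EFin \o G) -> m2.-integrable setT (EFin \o H) ->
  (m1 \x m2)%E.-integrable setT (EFin \o f).
Proof.
move=> mf fGH G0 H0 iG iH.
apply/integrable12ltyP; first exact/measurable_EFinP.
have mG : measurable_fun setT G by apply/measurable_EFinP; exact: (measurable_int _ iG).
have mH : measurable_fun setT H by apply/measurable_EFinP; exact: (measurable_int _ iH).
apply: (@le_lt_trans _ _ (\int[m1]_x ((G x)%:E * (\int[m2]_y H y)%:E))%E).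
  apply: ge0_le_integral => //.
  - by move=> x _; apply: integral_ge0.
  - apply: (@measurable_fun_fubini_tonelli_F _ _ _ _ _ m2 (fun z => `|(f z)%:E|%E)) => //.
    by apply/measurableT_comp => //; exact/measurable_EFinP.
  - by apply: emeasurable_funM => //; exact/measurable_EFinP.
  - move=> x _; rewrite -integral_EFinE// -integralZl//.
    apply: ge0_le_integral => //.
    + apply/measurable_EFinP/measurableT_comp => //; exact: measurableT_comp.
    + by apply: emeasurable_funM => //; exact/measurable_EFinP.
    + by move=> y _; rewrite /= -EFinM lee_fin.
rewrite integralZr//; rewrite integral_EFinE// -EFinM ltry//.
Qed.

Lemma Rintegral_Fubini d1 d2 (T1 : measurableType d1) (T2 : measurableType d2)
    (R : realType) (m1 : {sigma_finite_measure set T1 -> \bar R})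
    (m2 : {sigma_finite_measure set T2 -> \bar R})
    (f : T1 * T2 -> R) (G : T1 -> R) (H : T2 -> R) :
  measurable_fun setT f -> (forall x y, `|f (x, y)| <= G x * H y) ->
  (forall x, 0 <= G x) -> (forall y, 0 <= H y) ->
  m1.-integrable setT (EFin \o G) -> m2.-integrable setT (EFin \o H) ->
  \int[m1]_x (\int[m2]_y f (x, y)) = \int[m2]_y (\int[m1]_x f (x, y)).
Proof.
move=> mf fGH G0 H0 iG iH.
have iF := integrable_prod_bound mf fGH G0 H0 iG iH.
have i2 x : m2.-integrable setT (EFin \o (fun y => f (x, y))).
  apply: (@integrable_bound _ _ _ m2 setT _ (fun y => G x * H y)) => //.
    exact: measurableT_comp.
  by have := integrableZl measurableT (G x) iH; exact: eq_integrable.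
have i1 y : m1.-integrable setT (EFin \o (fun x => f (x, y))).
  apply: (@integrable_bound _ _ _ m1 setT _ (fun x => H y * G x)) => //.
    exact: measurableT_comp.
    by move=> x _; rewrite mulrC.
  by have := integrableZl measurableT (H y) iG; exact: eq_integrable.
have := Fubini iF.
under eq_integral do rewrite integral_EFinE//.
under [RHS]eq_integral do rewrite integral_EFinE//.
by rewrite /Rintegral => ->.
Qed.

Lemma integrable_Rfubini d1 d2 (T1 : measurableType d1) (T2 : measurableType d2)
    (R : realType) (m1 : {sigma_finite_measure set T1 -> \bar R})
    (m2 : {sigma_finite_measure set T2 -> \bar R})
    (f : T1 * T2 -> R) (G : T1 -> R) (H : T2 -> R) :
  measurable_fun setT f -> (forall x y, `|f (x, y)| <= G x * H y) ->
  (forall x, 0 <= G x) -> (forall y, 0 <= H y) ->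
  m1.-integrable setT (EFin \o G) -> m2.-integrable setT (EFin \o H) ->
  m1.-integrable setT (EFin \o (fun x => \int[m2]_y f (x, y))).
Proof.
move=> mf fGH G0 H0 iG iH.
have := integrable_fubini_F (integrable_prod_bound mf fGH G0 H0 iG iH).
apply: eq_integrable => // x _; rewrite /fubini_F/= integral_EFinE//.
apply: (@integrable_bound _ _ _ m2 setT _ (fun y => G x * H y)) => //.
  exact: measurableT_comp.
by have := integrableZl measurableT (G x) iH; exact: eq_integrable.
Qed.

Lemma Rintegral_indicM d (T : measurableType d) (R : realType)
    (m : {measure set T -> \bar R}) (D : set T) (h : T -> R) :
  \int[m]_x (\1_D x * h x) = \int[m]_(x in D) h x.
Proof.
rewrite [RHS]Rintegral_mkcond; apply: eq_Rintegral => x _.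
by rewrite patchE indicE; case: ifP => _; rewrite ?mul1r ?mul0r.
Qed.

Section Rintegral_sum.
Context d (T : measurableType d) (R : realType) (mu : {measure set T -> \bar R}) (D : set T).
Hypothesis mD : measurable D.

Lemma integrable_Rsum (I : Type) (s : seq I) (f : I -> T -> R) :
  (forall i, mu.-integrable D (EFin \o f i)) ->
  mu.-integrable D (EFin \o (fun x => \sum_(i <- s) f i x)).
Proof.
move=> fi; have := @integrable_sum _ _ _ mu D mD _ s predT (fun i => EFin \o f i) (fun i _ => fi i).
by apply: eq_integrable => // x _ /=; rewrite -sumEFin.
Qed.

Lemma Rintegral_sum (I : Type) (s : seq I) (f : I -> T -> R) :
  (forall i, mu.-integrable D (EFin \o f i)) ->
  \int[mu]_(x in D) (\sum_(i <- s) f i x) = \sum_(i <- s) \int[mu]_(x in D) f i x.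
Proof.
move=> fi; rewrite /Rintegral; under eq_integral do rewrite -sumEFin.
rewrite integral_sum//; under eq_bigr do rewrite integral_EFinE//.
by rewrite sumEFin.
Qed.

End Rintegral_sum.

(** * Gaussian integrals on the line *)

Lemma cvg_invn (R : realType) : (n%:R : R)^-1 @[n --> \oo] --> 0.
Proof.
apply/gtr0_cvgV0; last exact: cvgr_idn.
near=> n; rewrite ltr0n; near: n; exact: nbhs_infty_gt.
Unshelve. all: by end_near. Qed.

Lemma cvg_Rintegral_itvcc (R : realType) (f : R -> R) :
  (@lebesgue_measure R).-integrable setT (EFin \o f) ->
  \int[@lebesgue_measure R]_(x in `[- n%:R, n%:R]) f x @[n --> \oo] -->
  \int[@lebesgue_measure R]_x f x.
Proof.
move=> fi.
have mf : measurable_fun setT f.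
  by apply/measurable_EFinP; exact: (measurable_int _ fi).
rewrite (_ : (fun n => _) = (fun n =>
   \int[@lebesgue_measure R]_x (f \_ `[- (n%:R : R), n%:R]) x)); last first.
  by apply/funext => n; rewrite Rintegral_mkcond.
apply: (@Rintegral_dominated_cvg _ _ _ (@lebesgue_measure R) setT _ _ (fun x => `|f x|)) => //.
- move=> n; apply/(measurable_restrictT f) => //.
  exact: measurable_funTS.
- move=> x _; apply: (@cvg_near_cst).
  near=> n; rewrite patchE ifT// inE/= in_itv/= -ler_norml.
  near: n; exact: nbhs_infty_ger.
- exact: integrable_norm.
- by move=> n x _; rewrite patchE; case: ifPn => //; rewrite normr0.
Unshelve. all: by end_near. Qed.

Section gauss.
Context (R : realType).
Local Notation leb := (@lebesgue_measure R).
Local Notation phi := (@normal_pdf R 0 1).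

Lemma phiE x : phi x = @normal_peak R 1 * expR (- x ^+ 2 / 2).
Proof.
rewrite normal_pdfE ?oner_neq0// /normal_fun subr0 expr1n; congr (_ * expR (_ / _)).
Qed.

Lemma measurable_phi : measurable_fun setT phi.
Proof. exact: measurable_normal_pdf. Qed.

Lemma phi_ge0 x : 0 <= phi x. Proof. exact: normal_pdf_ge0. Qed.

(** Completing the square turns the integrand into a multiple of a normal density. *)
Lemma integral_expR_quad (b w : R) : w < 1 ->
  (\int[leb]_x (expR (b * x + w * x ^+ 2 / 2) * phi x)%:E =
   ((Num.sqrt (1 - w))^-1 * expR (b ^+ 2 / (2 * (1 - w))))%:E)%E.
Proof.
move=> w1; have w10 : 0 < 1 - w by rewrite subr_gt0.
pose s := (Num.sqrt (1 - w))^-1; pose m := b / (1 - w).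
have s0 : s != 0 by rewrite invr_eq0 gt_eqF// sqrtr_gt0.
have s2 : s ^+ 2 = (1 - w)^-1 by rewrite exprVn sqr_sqrtr// ltW.
have sp : 0 < s by rewrite invr_gt0 sqrtr_gt0.
transitivity (\int[leb]_x ((s * expR (b ^+ 2 / (2 * (1 - w))))%:E * (normal_pdf m s x)%:E))%E.
  apply: eq_integral => x _; rewrite -EFinM; congr (_%:E).
  rewrite phiE normal_pdfE// /normal_fun mulrCA -expRD.
  have -> : @normal_peak R 1 = s * normal_peak s.
    rewrite /normal_peak expr1n mul1r -mulrnAr sqrtrM ?sqr_ge0// sqrtr_sqr gtr0_norm//.
    by rewrite invfM mulrA divff// mul1r.
  rewrite [RHS]mulrACA -expRD; congr (_ * expR _).
  by rewrite s2 /m; field; rewrite gt_eqF.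
rewrite integralZl//; last exact: integrable_normal_pdf.
by rewrite integral_normal_pdf mule1.
Qed.

Lemma integrable_expR_phi (b : R) : leb.-integrable setT (EFin \o (fun x => expR (b * x) * phi x)).
Proof.
apply: integrable_ge0 => //.
- apply: measurable_funM; last exact: measurable_phi.
  by apply: measurableT_comp => //; exact: measurable_funM.
- by move=> x _; rewrite mulr_ge0 ?expR_ge0 ?phi_ge0.
- rewrite (_ : (fun x => _) = fun x => (expR (b * x + 0 * x ^+ 2 / 2) * phi x)%:E).
    by rewrite integral_expR_quad ?ltr01// ltry.
  by apply/funext => x; rewrite !mul0r addr0.
Qed.

Lemma integrable_phiM (h : R -> R) (C b : R) : measurable_fun setT h ->
  (forall x, `|h x| <= C * expR (b * `|x|)) ->
  leb.-integrable setT (EFin \o (fun x => h x * phi x)).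
Proof.
move=> mh hb.
have C0 : 0 <= C.
  have := le_trans (normr_ge0 _) (hb 0); rewrite normr0 mulr0 expR0 mulr1; exact.
apply: (@integrable_bound _ _ _ leb setT _
  (fun x => C * (expR (b * x) * phi x + expR ((- b) * x) * phi x))) => //.
- by apply: measurable_funM => //; exact: measurable_phi.
- move=> x _; rewrite normrM (ger0_norm (phi_ge0 _)) -mulrDl mulrA ler_wpM2r ?phi_ge0//.
  apply: (le_trans (hb x)); rewrite ler_wpM2l//.
  have [x0|x0] := leP 0 x.
    by rewrite ger0_norm// lerDl expR_ge0.
  by rewrite ltr0_norm// mulrN mulNr lerDr expR_ge0.
- have := integrableD measurableT (integrable_expR_phi b) (integrable_expR_phi (- b)).
  move/(integrableZl measurableT C); exact: eq_integrable.
Qed.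

Lemma le_normr_expR (x : R) : `|x| <= expR (`|x|).
Proof. by apply: le_trans (expR_ge1Dx _); rewrite lerDr. Qed.

(** Stein's identity. The derivative of [phi] is [- x * phi x], so the difference of the two sides
    is the integral of a derivative, whose boundary terms vanish because [h] grows at most
    linearly. *)
Lemma Rintegral_stein (h h' : R -> R) (C : R) :
  (forall x : R, is_derive x 1 h (h' x)) -> continuous h' ->
  (forall x, `|h x| <= C * (1 + `|x|)) -> (forall x, `|h' x| <= C) ->
  \int[leb]_x (x * h x * phi x) = \int[leb]_x (h' x * phi x).
Proof.
move=> dh ch' hC h'C.
have C0 : 0 <= C by exact: le_trans (h'C 0).
have ch : continuous h.
  by move=> x; apply: differentiable_continuous; apply/derivable1_diffP.
have mh : measurable_fun setT h by exact: continuous_measurable_fun.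
have mh' : measurable_fun setT h' by exact: continuous_measurable_fun.
have i1 : leb.-integrable setT (EFin \o (fun x => x * h x * phi x)).
  apply: (@integrable_phiM _ (C * 2) 2).
    exact: measurable_funM.
  move=> x; rewrite normrM mulrC -mulrA.
  apply: (le_trans (ler_wpM2r (normr_ge0 x) (hC x))); rewrite -mulrA ler_wpM2l//.
  rewrite [X in expR X](_ : _ = `|x| + `|x|); last by ring.
  rewrite expRD.
  have e1 : 1 + `|x| <= expR `|x| by exact: expR_ge1Dx.
  have := le_normr_expR x; have := expR_ge0 `|x|; have := normr_ge0 x; nra.
have i2 : leb.-integrable setT (EFin \o (fun x => h' x * phi x)).
  apply: (@integrable_phiM _ C 0) => // x.
  by rewrite mul0r expR0 mulr1.
apply/eqP; rewrite -subr_eq0 -RintegralB//; apply/eqP.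
set F := fun x : R => x * h x * phi x - h' x * phi x.
have iF : leb.-integrable setT (EFin \o F).
  exact: (integrableB measurableT i1 i2).
have H1 := cvg_Rintegral_itvcc iF.
pose G x := - (h x * phi x).
have dphi (x : R) : is_derive x 1 phi (- x * phi x).
  rewrite (_ : phi = fun x => @normal_peak R 1 * expR (- x ^+ 2 / 2)); last first.
    by apply/funext => y; rewrite phiE.
  apply: is_derive_eq.
  by rewrite /GRing.scale/=; field.
have dG (x : R) : is_derive x 1 G (F x).
  rewrite /G; apply: is_derive_eq.
  by rewrite /F /GRing.scale/=; ring.
have cphi : continuous phi by apply: continuous_normal_pdf; exact: oner_neq0.
have cF : continuous F.
  move=> x; apply: cvgB; apply: cvgM; [apply: cvgM|..]; try exact: cphi; try exact: ch'; try exact: ch; exact: cvg_id.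
have cG : continuous G.
  by move=> x; apply: differentiable_continuous; apply/derivable1_diffP.
have FTC n : (0 < n)%N -> \int[leb]_(x in `[- n%:R, n%:R]) F x = G n%:R - G (- n%:R).
  move=> n0; rewrite /Rintegral (@continuous_FTC2 _ F G)//.
  - by rewrite gtrN// ltr0n.
  - by apply: continuous_subspaceT.
  - split.
    + by move=> x _.
    + by apply: cvg_at_right_filter; exact: cG.
    + by apply: cvg_at_left_filter; exact: cG.
  - by move=> x _; rewrite derive1E; apply: derive_val.
have H2 : \int[leb]_(x in `[- n%:R, n%:R]) F x @[n --> \oo] --> (0 : R).
  apply/norm_cvg0P; apply: (@squeeze_cvgr _ _ _ _ (cst 0) (fun n : nat => 8 * C * @normal_peak R 1 * (n%:R)^-1)).
  - near=> n; rewrite normr_ge0/= FTC//; last by near: n; exact: nbhs_infty_gt.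
    have n0 : 0 < n%:R :> R by rewrite ltr0n; near: n; exact: nbhs_infty_gt.
    rewrite /G opprK; apply: (le_trans (ler_normD _ _)); rewrite normrN.
    have Hb (x : R) : `|x| = n%:R -> `|h x * phi x| <= 4 * C * normal_peak 1 * n%:R^-1.
      move=> xn; rewrite normrM (ger0_norm (phi_ge0 _)) phiE.
      have p0 := @normal_peak_ge0 R 1.
      rewrite -[x ^+ 2]real_normK ?num_real// xn mulNr expRN.
      have e1 := expR_ge1Dx (n%:R ^+ 2 / 2 : R).
      have e2 : (expR (n%:R ^+ 2 / 2 : R))^-1 <= (1 + n%:R ^+ 2 / 2)^-1.
        by rewrite lef_pV2// posrE ?expR_gt0// addr_gt0// divr_gt0// exprn_gt0.
      have hx := hC x; rewrite xn in hx.
      apply: (le_trans (ler_pM _ _ hx (ler_wpM2l p0 e2))) => //.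
        by rewrite mulr_ge0// invr_ge0 expR_ge0.
      have n1 : 1 <= n%:R :> R by rewrite ler1n -(ltr0n R).
      rewrite [leLHS](_ : _ = C * normal_peak 1 * ((1 + n%:R) / (1 + n%:R ^+ 2 / 2))); last by ring.
      rewrite [leRHS](_ : _ = C * normal_peak 1 * (4 / n%:R)); last by ring.
      rewrite ler_wpM2l ?mulr_ge0// ler_pdivrMr; last by rewrite addr_gt0// divr_gt0// exprn_gt0.
      rewrite mulrAC ler_pdivlMr//; nra.
    rewrite [leRHS](_ : _ = 4 * C * normal_peak 1 / n%:R + 4 * C * normal_peak 1 / n%:R); last by ring.
    by apply: lerD; apply: Hb; rewrite ?normrN normr_nat.
  - exact: cvg_cst.
  - rewrite -[X in _ --> X](mulr0 (8 * C * normal_peak 1)); apply: cvgMr; exact: cvg_invn.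
by have := cvg_unique _ H1 H2; apply.
Unshelve. all: by end_near. Qed.

Lemma Rintegral_phi : \int[leb]_x phi x = 1.
Proof. by rewrite /Rintegral integral_normal_pdf. Qed.

Lemma integrable_phi : leb.-integrable setT (EFin \o phi).
Proof. exact: integrable_normal_pdf. Qed.

Lemma Rintegral_sqr_phi : \int[leb]_x (x ^+ 2 * phi x) = 1.
Proof.
rewrite -[RHS]Rintegral_phi.
transitivity (\int[leb]_x (x * id x * phi x)); first by apply: eq_Rintegral => x _; rewrite expr2.
rewrite (@Rintegral_stein id (fun=> 1) 1).
- by apply: eq_Rintegral => x _; rewrite mul1r.
- exact: cst_continuous.
- by move=> x; rewrite mul1r lerDr.
- by move=> x; rewrite normr1.
Qed.

Lemma integrable_sqr_phi : leb.-integrable setT (EFin \o (fun x => x ^+ 2 * phi x)).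
Proof.
apply: (@integrable_phiM _ 1 2) => [|x]; first exact: measurable_funX.
rewrite mul1r normrX expr2 [X in expR X](_ : _ = `|x| + `|x|); last by ring.
by rewrite expRD ler_pM// le_normr_expR.
Qed.

Lemma measurable_cosM (a : R) : measurable_fun setT (fun x : R => cos (a * x)).
Proof.
by apply: measurableT_comp; [apply: continuous_measurable_fun; exact: continuous_cos|exact: measurable_funM].
Qed.

Lemma measurable_sinM (a : R) : measurable_fun setT (fun x : R => sin (a * x)).
Proof.
by apply: measurableT_comp; [apply: continuous_measurable_fun; exact: continuous_sin|exact: measurable_funM].
Qed.

Lemma integrable_cos_phi a : leb.-integrable setT (EFin \o (fun x => cos (a * x) * phi x)).
Proof.
apply: (@integrable_phiM _ 1 0) => [|x]; first exact: measurable_cosM.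
by rewrite mul0r expR0 mulr1 cos_max.
Qed.

(** Differentiating under the integral sign and applying Stein's identity shows that the integral
    solves the equation [J' = - a * J]. *)
Lemma Rintegral_cos_phi (a : R) : \int[leb]_x (cos (a * x) * phi x) = expR (- a ^+ 2 / 2).
Proof.
pose f (b x : R) := cos (b * x) * phi x.
pose J b := \int[leb]_x f b x.
have df (b x : R) : is_derive b 1 (f ^~ x) (- (x * sin (b * x) * phi x)).
  rewrite /f; apply: is_derive_eq; rewrite /GRing.scale/=; ring.
have pf b x : partial1of2 f b x = - (x * sin (b * x) * phi x).
  by rewrite /partial1of2 derive1E; apply: derive_val.
have iG : leb.-integrable setT (EFin \o (fun x => `|x| * phi x)).
  apply: (@integrable_phiM _ 1 1) => [|x]; first by apply: continuous_measurable_fun; exact: norm_continuous.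
  by rewrite !mul1r normr_id le_normr_expR.
have I1 (b : R) : `]b - 1, b + 1[%classic b.
  by rewrite /= in_itv/= ltrBlDr ltrDl ltr01.
have hyp1 (b x : R) : `]b - 1, b + 1[%classic x -> leb.-integrable setT (EFin \o f x).
  by move=> _; exact: integrable_cos_phi.
have hyp2 (b x y : R) : `]b - 1, b + 1[%classic x -> setT y -> derivable (f^~ y) x 1.
  by move=> _ _.
have hyp3 y : 0 <= `|y| * phi y by rewrite mulr_ge0// phi_ge0.
have hyp4 (b x y : R) : `]b - 1, b + 1[%classic x -> setT y -> `|partial1of2 f x y| <= `|y| * phi y.
  move=> _ _; rewrite pf normrN !normrM (ger0_norm (phi_ge0 _)) ler_wpM2r ?phi_ge0//.
  by rewrite ler_piMr// sin_max.
have dJ (b : R) : is_derive b 1 J (- b * J b).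
  apply: DeriveDef.
    exact: (@derivable_under_integral _ _ _ leb f setT measurableT b _ _ (I1 b) (@hyp1 b) (@hyp2 b) _ hyp3 iG (@hyp4 b)).
  rewrite -derive1E.
  have -> := (@differentiation_under_integral _ _ _ leb f setT measurableT b _ _ (I1 b) (@hyp1 b) (@hyp2 b) _ hyp3 iG (@hyp4 b)).
  under eq_Rintegral do rewrite pf.
  transitivity (- \int[leb]_x (x * sin (b * x) * phi x)).
    rewrite -[RHS]mulN1r -RintegralZl//.
      by apply: eq_Rintegral => x _; rewrite mulN1r.
    apply: (integrable_bound _ _ _ iG) => //.
      by do 2 (apply: measurable_funM => //; try exact: measurable_phi); exact: measurable_sinM.
    move=> x _; rewrite !normrM (ger0_norm (phi_ge0 _)) ler_wpM2r ?phi_ge0//.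
    by rewrite ler_piMr// sin_max.
  rewrite mulNr; congr (- _).
  have dsin (x : R) : is_derive x 1 (fun x => sin (b * x)) (b * cos (b * x)).
    by apply: is_derive_eq; rewrite /GRing.scale/=; ring.
  rewrite (@Rintegral_stein _ _ (1 + `|b|) dsin).
  - rewrite /J -RintegralZl//; last exact: integrable_cos_phi.
    by apply: eq_Rintegral => x _; rewrite mulrA.
  - move=> x; apply: cvgM; first exact: cvg_cst.
    apply: continuous_comp; last exact: continuous_cos.
    by apply: cvgM; [exact: cvg_cst|exact: cvg_id].
  - move=> x; apply: (le_trans (sin_max _)).
    by have := normr_ge0 x; have := normr_ge0 b; nra.
  - move=> x; rewrite normrM; apply: (@le_trans _ _ (`|b| * 1)).
      by rewrite ler_wpM2l// cos_max.
    by rewrite mulr1 lerDr.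
pose K b := J b * expR (b ^+ 2 / 2).
have dK (b : R) : is_derive b 1 K 0.
  by rewrite /K; apply: is_derive_eq; rewrite /GRing.scale/=; field.
have : K a = K 0 by exact: is_derive_0_is_cst.
rewrite /K expr0n/= mul0r expR0 mulr1.
have -> : J 0 = 1.
  rewrite -Rintegral_phi; apply: eq_Rintegral => x _.
  by rewrite /f mul0r cos0 mul1r.
move=> H; change (J a = expR (- a ^+ 2 / 2)).
have e0 : expR (a ^+ 2 / 2) != 0 by rewrite gt_eqF// expR_gt0.
by apply: (mulIf e0); rewrite H mulNr expRN mulVf.
Qed.

End gauss.

Section gaussian_law.
Context (R : realType).
Local Notation leb := (@lebesgue_measure R).
Local Notation phi := (@normal_pdf R 0 1).

(** The standardised form covers the Dirac mass at variance 0 together with the normal laws, so that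
    degenerate covariance matrices need no separate treatment later. *)
Lemma ge0_integral_gaussian_law (v : R) (f : R -> R) : 0 <= v -> continuous f ->
  (forall x, 0 <= f x) ->
  (\int[gaussian_law 0 v]_x (f x)%:E = \int[leb]_x (f (Num.sqrt v * x) * phi x)%:E)%E.
Proof.
move=> v0 cf f0.
have mf : measurable_fun setT f by exact: continuous_measurable_fun.
rewrite /gaussian_law; have [->|vneq0] := eqVneq v 0.
  rewrite integral_dirac//; last exact/measurable_EFinP.
  rewrite diracT mul1e sqrtr0.
  under eq_integral do rewrite mul0r EFinM.
  rewrite ge0_integralZl//.
  - by rewrite integral_normal_pdf mule1.
  - by apply/measurable_EFinP; exact: measurable_normal_pdf.
  - by move=> x _; rewrite lee_fin normal_pdf_ge0.
  - by rewrite lee_fin.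
have vp : 0 < v by rewrite lt_neqAle eq_sym vneq0.
pose s := Num.sqrt v.
have sp : 0 < s by rewrite sqrtr_gt0.
have s0 : s != 0 by rewrite gt_eqF.
transitivity (\int[leb]_x ((f x)%:E * (normal_pdf 0 s x)%:E))%E.
  apply: ge0_integral_density.
  - exact: measurable_normal_pdf.
  - by move=> x; exact: normal_pdf_ge0.
  - by [].
  - exact/measurable_EFinP.
  - by move=> x; rewrite lee_fin.
under eq_integral do rewrite -EFinM.
have F'E : (fun x : R => s * x)^`()%classic = cst s.
  apply/funext => x; rewrite derive1E.
  have d : is_derive x 1 (fun x : R => s * x) s.
    by apply: is_derive_eq; rewrite /GRing.scale/= mulr1.
  exact: derive_val.
rewrite (@increasing_ge0_integration_by_substitutionT _ (fun x => s * x) (fun x => f x * normal_pdf 0 s x)).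
- apply: eq_integral => x _; congr EFin; rewrite F'E /=/cst !fctE -mulrA; congr (_ * _).
  rewrite !normal_pdfE ?oner_neq0// /normal_peak /normal_fun expr1n mul1r !subr0.
  rewrite mulrAC; congr (_ * expR _).
    by rewrite -mulrnAr sqrtrM ?sqr_ge0// sqrtr_sqr gtr0_norm// invfM mulrAC mulVf// mul1r.
  by rewrite exprMn; field.
- by move=> x y xy; rewrite ltr_pM2l.
- by rewrite F'E => x; exact: cvg_cst.
- by rewrite F'E; exact: is_cvg_cst.
- by rewrite F'E; exact: is_cvg_cst.
- by [].
- exact/gt0_cvgMrNy.
- exact/gt0_cvgMry.
- move=> x; apply: cvgM; first exact: cf.
  exact: continuous_normal_pdf.
- by move=> x; rewrite mulr_ge0// normal_pdf_ge0.
Qed.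

Lemma integral_expR_gaussian_law (v s : R) : 0 <= v ->
  (\int[gaussian_law 0 v]_x (expR (s * x))%:E = (expR (s ^+ 2 * v / 2))%:E)%E.
Proof.
move=> v0; rewrite (@ge0_integral_gaussian_law v (fun x => expR (s * x)))//; last first.
  move=> x; apply: continuous_comp; last exact: continuous_expR.
  by apply: cvgM; [exact: cvg_cst|exact: cvg_id].
rewrite (_ : (fun x => _) = (fun x => (expR (s * Num.sqrt v * x + 0 * x ^+ 2 / 2) * phi x)%:E)).
  rewrite integral_expR_quad ?ltr01// subr0 sqrtr1 invr1 mul1r mulr1.
  by rewrite exprMn sqr_sqrtr.
by apply/funext => x; rewrite !mul0r addr0 mulrA.
Qed.

Lemma integral_sqr_gaussian_law (v : R) : 0 <= v ->
  (\int[gaussian_law 0 v]_x (x ^+ 2)%:E = v%:E)%E.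
Proof.
move=> v0; rewrite (@ge0_integral_gaussian_law v (fun x => x ^+ 2))//; last 2 first.
- exact: sqr_continuous.
- by move=> x; exact: sqr_ge0.
under eq_integral do rewrite exprMn sqr_sqrtr// -mulrA EFinM.
rewrite integralZl//; last exact: integrable_sqr_phi.
rewrite integral_EFinE//; last exact: integrable_sqr_phi.
by rewrite Rintegral_sqr_phi mule1.
Qed.

Lemma integral_cos_gaussian_law (v : R) : 0 <= v ->
  (\int[gaussian_law 0 v]_x (1 + cos x)%:E = (1 + expR (- v / 2))%:E)%E.
Proof.
move=> v0; rewrite (@ge0_integral_gaussian_law v (fun x => 1 + cos x)); last first.
- by move=> x; rewrite -lerBlDl sub0r cos_geN1.
- by move=> x; apply: cvgD; [exact: cvg_cst|exact: continuous_cos].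
- by [].
under eq_integral do rewrite mulrDl mul1r EFinD.
rewrite integralD//; last 2 first.
- exact: integrable_phi.
- exact: integrable_cos_phi.
rewrite integral_EFinE//; last exact: integrable_phi.
rewrite integral_EFinE//; last exact: integrable_cos_phi.
by rewrite Rintegral_phi Rintegral_cos_phi sqr_sqrtr.
Qed.

End gaussian_law.

(** * Exponentially tilted covariance matrices *)

Section vector_norm.
Context (R : realType) (n : nat).
Implicit Types (u v : 'rV[R]_n) (S : 'M[R]_n).

Lemma dotC u v : dot u v = dot v u.
Proof. by apply: eq_bigr => i _; rewrite mulrC. Qed.

Lemma dotE u v : dot u v = (u *m v^T) 0 0.
Proof. by rewrite mxE; apply: eq_bigr => i _; rewrite mxE. Qed.

Lemma dotDl u v w : dot (u + v) w = dot u w + dot v w.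
Proof. by rewrite /dot -big_split; apply: eq_bigr => i _; rewrite mxE mulrDl. Qed.

Lemma dotZl a u v : dot (a *: u) v = a * dot u v.
Proof. by rewrite /dot mulr_sumr; apply: eq_bigr => i _; rewrite mxE mulrA. Qed.

Lemma dotDr u v w : dot u (v + w) = dot u v + dot u w.
Proof. by rewrite dotC dotDl !(dotC _ u). Qed.

Lemma dotZr a u v : dot u (a *: v) = a * dot u v.
Proof. by rewrite dotC dotZl dotC. Qed.

Lemma dotvv_ge0 u : 0 <= dot u u.
Proof. by apply: sumr_ge0 => i _; rewrite -expr2 sqr_ge0. Qed.

Lemma enorm_ge0 u : 0 <= enorm u. Proof. exact: sqrtr_ge0. Qed.

Lemma sqr_enorm u : enorm u ^+ 2 = dot u u.
Proof. by rewrite sqr_sqrtr// dotvv_ge0. Qed.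

Lemma enormZ a u : enorm (a *: u) = `|a| * enorm u.
Proof. by rewrite /enorm dotZl dotZr mulrA -expr2 sqrtrM ?sqr_ge0// sqrtr_sqr. Qed.

Lemma dot_sqr_le u v : dot u v ^+ 2 <= dot u u * dot v v.
Proof.
have [u0|u0] := eqVneq (dot u u) 0.
  have ui i : u 0 i = 0.
    have H0 j : true -> 0 <= u 0 j * u 0 j by rewrite -expr2 sqr_ge0.
    have := psumr_eq0P H0 u0 isT => /(_ i)/eqP.
    by rewrite -expr2 sqrf_eq0 => /eqP.
  by rewrite u0 mul0r /dot big1 ?expr0n// => i _; rewrite ui mul0r.
have up : 0 < dot u u by rewrite lt_neqAle eq_sym u0 dotvv_ge0.
have := dotvv_ge0 ((- dot u v / dot u u) *: u + v).
rewrite dotDl !dotDr !dotZl !dotZr (dotC v u) => H.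
rewrite -(ler_pM2l up) in H; rewrite mulr0 in H.
have E : dot u u * (- dot u v / dot u u * (- dot u v / dot u u * dot u u) +
    - dot u v / dot u u * dot u v + (- dot u v / dot u u * dot u v + dot v v)) =
   dot u u * dot v v - dot u v ^+ 2 by field.
by rewrite E subr_ge0 in H.
Qed.

Lemma dot_le_enorm u v : `|dot u v| <= enorm u * enorm v.
Proof.
rewrite -(@ler_pXn2r _ 2)// ?nnegrE ?mulr_ge0 ?enorm_ge0//.
by rewrite real_normK ?num_real// exprMn !sqr_enorm dot_sqr_le.
Qed.

Lemma enormD u v : enorm (u + v) <= enorm u + enorm v.
Proof.
rewrite -(@ler_pXn2r _ 2)// ?nnegrE ?addr_ge0 ?enorm_ge0//.
rewrite sqr_enorm dotDl !dotDr (dotC v u) sqrrD !sqr_enorm.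
have := le_trans (ler_norm _) (dot_le_enorm u v); lra.
Qed.

Lemma normr_coord_le_enorm u i : `|u 0 i| <= enorm u.
Proof.
rewrite -(@ler_pXn2r _ 2)// ?nnegrE ?enorm_ge0//.
rewrite real_normK ?num_real// sqr_enorm /dot (bigD1 i)//= -expr2 lerDl.
by apply: sumr_ge0 => j _; rewrite -expr2 sqr_ge0.
Qed.

Lemma enorm_delta (i : 'I_n) : enorm (delta_mx 0 i : 'rV[R]_n) = 1.
Proof.
rewrite /enorm (_ : dot _ _ = 1) ?sqrtr1//.
rewrite /dot (bigD1 i)//= big1 => [|j ji]; first by rewrite !mxE !eqxx mulr1 addr0.
by rewrite !mxE eqxx (negbTE ji) mul0r.
Qed.

Definition quad S u : R := (u *m S *m u^T) 0 0.

Lemma quadE S u : quad S u = dot (u *m S) u.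
Proof. by rewrite dotE. Qed.

(** Cauchy-Schwarz for the semi-inner product given by [S], applied to [u] and [u *m S]. *)
Lemma psd_opnorm S (C : R) : S^T = S -> 0 <= C -> (forall u, 0 <= quad S u) ->
  (forall u, quad S u <= C * dot u u) ->
  forall u, enorm (u *m S) <= C * enorm u.
Proof.
move=> Ssym C0 S0 SC u; set v := u *m S.
have vS : dot (v *m S) u = dot v v.
  rewrite !dotE; congr (fun_of_matrix _ 0 0).
  by rewrite -mulmxA; congr (_ *m _); rewrite /v trmx_mul Ssym.
have H (t : R) : 0 <= quad S v + t * (2 * dot v v) + t ^+ 2 * quad S u.
  have := S0 (v + t *: u); rewrite !quadE mulmxDl -scalemxAl dotDl !dotDr !dotZl !dotZr vS.
  rewrite -/v => X; lra.
have [C00|Cp] := eqVneq C 0.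
  have qv : quad S v = 0.
    by apply/eqP; rewrite eq_le S0 andbT; have := SC v; rewrite C00 mul0r.
  have qu : quad S u = 0.
    by apply/eqP; rewrite eq_le S0 andbT; have := SC u; rewrite C00 mul0r.
  have := H (-1); rewrite qv qu C00 => H1.
  have := dotvv_ge0 v => H2.
  have : dot v v = 0 by lra.
  by rewrite /enorm => ->; rewrite sqrtr0 mul0r.
have {}Cp : 0 < C by rewrite lt_neqAle eq_sym Cp.
rewrite -(@ler_pXn2r _ 2)// ?nnegrE ?mulr_ge0 ?enorm_ge0//.
rewrite exprMn !sqr_enorm.
(* The discriminant argument at the single value [t = - C]. *)
have := H (- C^-1 * C ^+ 2) => {}H.
have := SC v; have := SC u => H1 H2.
have E : - C^-1 * C ^+ 2 = - C by field; rewrite gt_eqF.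
rewrite E in H.
have : C * (dot v v) <= C * (C ^+ 2 * dot u u) by nra.
by rewrite ler_pM2l.
Qed.

End vector_norm.

Section tilted_covariance.
Context (R : realType) (n : nat) (Sg : 'M[R]_n) (C s : R).
Hypothesis Ssym : Sg^T = Sg.
Hypothesis C0 : 0 <= C.
Hypothesis opC : forall u : 'rV[R]_n, enorm (u *m Sg) <= C * enorm u.
Hypothesis sC : `|s| * C <= 8^-1.

(** The Sherman-Morrison formula for the inverse of [S^-1 - 2 * s * delta_mx i i]: the covariance of
    a centred Gaussian vector of covariance [S] once its law has been weighted by the exponential of
    [s] times the square of the [i]-th coordinate. *)
Definition tilt_step (S : 'M[R]_n) (i : 'I_n) : 'M[R]_n :=
  S + (2 * s / (1 - 2 * s * S i i)) *: (col i S *m row i S).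

Fixpoint tilt (k : nat) : 'M[R]_n :=
  if k is j.+1 then (if insub j is Some i then tilt_step (tilt j) i else tilt j)
  else Sg.

Definition tilt_diag (i : 'I_n) : R := tilt i i i.

Lemma tiltS (i : 'I_n) : tilt i.+1 = tilt_step (tilt i) i.
Proof. by rewrite /= valK. Qed.

Definition proj_lt (k : nat) : 'M[R]_n := diag_mx (\row_j (j < k)%N%:R).

Lemma mul_proj_lt k (u : 'rV[R]_n) j : (u *m proj_lt k) 0 j = u 0 j * (j < k)%N%:R.
Proof. by rewrite mul_mx_diag !mxE. Qed.

Lemma enorm_proj_lt k (u : 'rV[R]_n) : enorm (u *m proj_lt k) <= enorm u.
Proof.
rewrite /enorm ler_wsqrtr//; apply: ler_sum => j _.
rewrite !mul_proj_lt; case: (j < k)%N; rewrite ?mulr1// mulr0 mul0r.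
by rewrite -expr2 sqr_ge0.
Qed.

Lemma proj_ltS (i : 'I_n) : proj_lt i.+1 = proj_lt i + delta_mx i i.
Proof.
apply/matrixP => j k; rewrite !mxE ltnS leq_eqVlt.
have [->|jk] := eqVneq j k.
  have [->|ki] := eqVneq k i; first by rewrite eqxx ltnn !mulr1n add0r.
  by rewrite -(inj_eq val_inj) in ki; rewrite (negbTE ki) addr0.
rewrite !mulr0n add0r; case: (eqVneq j i) jk => [->|//] /=.
by rewrite eq_sym => /negbTE ->.
Qed.

(** The fixed point equation bounds the norm of the row by [C] plus a quarter of itself. *)
Lemma enorm_tilt_row (S : 'M[R]_n) k i :
  S = Sg + (2 * s) *: (S *m proj_lt k *m Sg) -> enorm (row i S) <= 2 * C.
Proof.
move=> HS.
have Hr : row i S = row i Sg + (2 * s) *: (row i S *m proj_lt k *m Sg).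
  by rewrite {1}HS linearD linearZ/= !row_mul.
have h1 : enorm (row i Sg) <= C.
  by rewrite rowE (le_trans (opC _))// enorm_delta mulr1.
have h2 : enorm ((2 * s) *: (row i S *m proj_lt k *m Sg)) <= 2 * `|s| * (C * enorm (row i S)).
  rewrite enormZ normrM ger0_norm// ler_wpM2l ?mulr_ge0//.
  by apply: (le_trans (opC _)); rewrite ler_wpM2l// enorm_proj_lt.
have h3 : enorm (row i S) <= C + 2 * `|s| * (C * enorm (row i S)).
  by rewrite {1}Hr (le_trans (enormD _ _))// lerD.
have := enorm_ge0 (row i S) => h4.
have : 2 * `|s| * (C * enorm (row i S)) <= 2 * 8^-1 * enorm (row i S).
  by rewrite mulrA ler_wpM2r// -mulrA ler_wpM2l.
lra.
Qed.

Lemma tilt_diag_small (S : 'M[R]_n) k i :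
  S = Sg + (2 * s) *: (S *m proj_lt k *m Sg) -> `|2 * s * S i i| <= 2^-1.
Proof.
move=> HS; have := enorm_tilt_row i HS => h1.
have : `|S i i| <= 2 * C.
  by apply: le_trans h1; have := normr_coord_le_enorm (row i S) i; rewrite mxE.
rewrite !normrM ger0_norm// => h2.
apply: (@le_trans _ _ (2 * `|s| * (2 * C))); first by rewrite ler_wpM2l ?mulr_ge0.
have := sC; lra.
Qed.

(** The matrix [tilt k] is the inverse of [Sg^-1 - 2 * s * proj_lt k]. Written as a fixed point,
    this makes sense for singular [Sg] and gives the entries of [tilt k] as a power series in
    [s]. *)
Lemma tilt_resolvent k : (k <= n)%N ->
  (tilt k)^T = tilt k /\ tilt k = Sg + (2 * s) *: (tilt k *m proj_lt k *m Sg).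
Proof.
elim: k => [_|k IH kn].
  split => //=; have -> : proj_lt 0 = 0.
    by apply/matrixP => i j; rewrite !mxE mul0rn.
  by rewrite mulmx0 mul0mx scaler0 addr0.
have {IH} [sym res] := IH (ltnW kn).
pose i := Ordinal kn; have -> : k = i by [].
rewrite -/(nat_of_ord i).+1 tiltS /tilt_step.
have := tilt_diag_small i res; set S := tilt i in sym res *.
move: sym res; rewrite -/S => sym res small.
set D := 1 - 2 * s * S i i; have D0 : D != 0.
  by rewrite /D subr_eq0 eq_sym; apply/eqP => E; move: small; rewrite E normr1; lra.
have cr : (col i S)^T = row i S by rewrite tr_col sym.
split.
  rewrite linearD linearZ/= trmx_mul sym cr -[in RHS](trmxK (col i S)) cr.
  by rewrite -cr trmxK.
rewrite proj_ltS.
set d := 2 * s / D; set c := col i S; set r := row i S.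
have SE : S *m (delta_mx i i *m Sg) = c *m row i Sg.
  rewrite -(mul_delta_mx (0 : 'I_1)) -mulmxA mulmxA -colE; congr (_ *m _).
  by rewrite -rowE.
have rE : r *m (delta_mx i i *m Sg) = S i i *: row i Sg.
  rewrite -(mul_delta_mx (0 : 'I_1)) -mulmxA mulmxA -colE -rowE.
  by apply/matrixP => a b; rewrite !mxE big_ord1 !mxE.
have Hr : r = row i Sg + (2 * s) *: (r *m (proj_lt i *m Sg)).
  by rewrite /r {1}res linearD linearZ/= !row_mul mulmxA.
have rP : (2 * s) *: (r *m (proj_lt i *m Sg)) = r - row i Sg.
  by rewrite {2}Hr [X in _ = X - _]addrC addrK.
have SP : (2 * s) *: (S *m (proj_lt i *m Sg)) = S - Sg.
  by rewrite {2}res [X in _ = X - _]addrC addrK mulmxA.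
rewrite mulmxDr !mulmxDl -!scalemxAl -!mulmxA SE rE !scalerDr SP.
have dE : 2 * s + 2 * s * d * S i i = d by rewrite /d /D; field.
have -> : (2 * s) *: (d *: (c *m (r *m (proj_lt i *m Sg)))) = d *: (c *m (r - row i Sg)).
  by rewrite scalerA mulrC -scalerA scalemxAr rP.
rewrite mulmxBr scalerBr -scalemxAr.
move: (c *m r) (c *m row i Sg) => M N; apply/matrixP => a b; rewrite !mxE.
have := congr1 (fun z => z * N a b) dE.
by rewrite mulrDl /=; lra.
Qed.

Definition low_sqr (i : 'I_n) : R := \sum_(j < n | (j < i)%N) Sg i j ^+ 2.

Lemma tilt_diag_half i : `|2 * s * tilt_diag i| <= 2^-1.
Proof.
by have [_ res] := tilt_resolvent (ltnW (ltn_ord i)); exact: tilt_diag_small res.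
Qed.

(** The fixed point equation is substituted into itself until the remainder is cubic in [Sg]. *)
Lemma tilt_diag_expansion (i : 'I_n) : exists2 r : R, `|r| <= 2 * C ^+ 3 &
  [/\ tilt_diag i = Sg i i + 2 * s * (low_sqr i + 2 * s * r),
     `|Sg i i| <= C, `|tilt_diag i| <= 2 * C & `|low_sqr i + 2 * s * r| <= 2 * C ^+ 2].
Proof.
have [_ res] := tilt_resolvent (ltnW (ltn_ord i)).
pose u := row i (tilt i).
have uC : enorm u <= 2 * C by exact: enorm_tilt_row res.
have Hu : u = row i Sg + (2 * s) *: (u *m proj_lt i *m Sg).
  by rewrite /u {1}res linearD linearZ/= !row_mul.
have rC : enorm (row i Sg) <= C by rewrite rowE (le_trans (opC _))// enorm_delta mulr1.
pose t := (u *m proj_lt i *m Sg) 0 i.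
pose r := (u *m proj_lt i *m Sg *m proj_lt i *m Sg) 0 i.
have tC : `|t| <= 2 * C ^+ 2.
  apply: (le_trans (normr_coord_le_enorm _ _)); apply: (le_trans (opC _)).
  rewrite [leRHS](_ : _ = C * (2 * C)); last by ring.
  by rewrite ler_wpM2l// (le_trans (enorm_proj_lt i u) uC).
exists r.
  apply: (le_trans (normr_coord_le_enorm _ _)); apply: (le_trans (opC _)).
  have h1 := le_trans (enorm_proj_lt i u) uC.
  have h2 := enorm_proj_lt i (u *m proj_lt i *m Sg).
  have h3 := opC (u *m proj_lt i).
  have h4 : enorm (u *m proj_lt i *m Sg) <= C * (2 * C) by rewrite (le_trans h3)// ler_wpM2l.
  have h5 := le_trans h2 h4.
  by rewrite (le_trans (ler_wpM2l C0 h5))// le_eqVlt; apply/orP; left; apply/eqP; ring.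
have tE : t = low_sqr i + 2 * s * r.
  rewrite /t {1}Hu mulmxDl mulmxDl mxE -!scalemxAl; congr (_ + _); last by rewrite mxE.
  rewrite mxE /low_sqr [RHS]big_mkcond/=; apply: eq_bigr => j _.
  rewrite mul_proj_lt mxE; case: ifP => _; rewrite ?mulr1 ?mulr0 ?mul0r//.
  by rewrite expr2; congr (_ * _); rewrite -[in LHS]Ssym mxE.
split.
- rewrite -tE /tilt_diag.
  have -> : tilt i i i = u 0 i by rewrite mxE.
  by rewrite {1}Hu mxE !mxE /t mxE.
- by apply: le_trans rC; have := normr_coord_le_enorm (row i Sg) i; rewrite mxE.
- by apply: le_trans uC; have := normr_coord_le_enorm u i; rewrite mxE.
- by rewrite -tE.
Qed.

Lemma ln_expansion (x : R) : `|x| <= 2^-1 -> `|ln (1 - x) + x + x ^+ 2 / 2| <= 2 * `|x| ^+ 3.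
Proof.
move=> x12.
pose f (y : R) := ln (1 - y) + y + y ^+ 2 / 2.
pose f' (y : R) := - y ^+ 2 / (1 - y).
have df (y : R) : y < 1 -> is_derive y 1 f (f' y).
  move=> y1; have y0 : 0 < 1 - y by rewrite subr_gt0.
  have dln : is_derive (1 - y) 1 (@ln R) (1 - y)^-1 by exact: is_derive1_ln.
  have d1 : is_derive y 1 (fun y => 1 - y) (-1).
    by apply: is_derive_eq; rewrite /GRing.scale/=; ring.
  have d2 : is_derive y 1 (fun y => ln (1 - y)) (- (1 - y)^-1).
    have := @is_derive1_comp _ (@ln R) (fun y => 1 - y) y _ _ dln d1.
    by rewrite mulrN1.
  rewrite /f; apply: is_derive_eq.
  rewrite /GRing.scale/= /f'; field; rewrite gt_eqF//.
have f0 : f 0 = 0 by rewrite /f subr0 ln1 expr0n/= mul0r !addr0.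
have cf (a b : R) : b < 1 -> {within `[a, b], continuous f}.
  move=> b1; apply: derivable_within_continuous => y; rewrite in_itv/= => /andP[_ yb].
  by have /@ex_derive : is_derive y 1 f (f' y) by apply: df; exact: le_lt_trans yb b1.
have fb (y : R) : `|y| <= `|x| -> `|f' y| <= 2 * `|x| ^+ 2.
  move=> yx; have y2 := le_trans yx x12.
  have y1 : 2^-1 <= 1 - y by have := ler_norm y; lra.
  rewrite /f' mulNr normrN normrM normrX normfV mulrC (@ger0_norm _ (1 - y)); last by lra.
  apply: ler_pM => //; rewrite ?invr_ge0; [lra| |by rewrite ler_pXn2r ?nnegrE].
  by rewrite invf_ple ?posrE//; lra.
rewrite -/(f x).
have [x0|x0|->] := ltgtP x 0; last by rewrite f0 normr0 expr0n mulr0.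
  have x1 : (0 : R) < 1 by [].
  have [c cI] : exists2 c, c \in `]x, 0[ & f 0 - f x = f' c * (0 - x).
    apply: MVT => //; last exact: cf.
    by move=> y; rewrite in_itv/= => /andP[_ y0]; apply: df; lra.
  move: cI; rewrite in_itv/= f0 !sub0r => /andP[xc c0] E.
  have -> : `|f x| = `|f' c| * `|x| by rewrite -normrN E normrM normrN.
  rewrite exprSr mulrA ler_wpM2r// fb// !ltr0_norm//; lra.
have [c cI] : exists2 c, c \in `]0, x[ & f x - f 0 = f' c * (x - 0).
  apply: MVT => //.
    by move=> y; rewrite in_itv/= => /andP[_ y0]; apply: df; move: x12; rewrite gtr0_norm//; lra.
  by apply: cf; move: x12; rewrite gtr0_norm//; lra.
move: cI; rewrite in_itv/= f0 !subr0 => /andP[c0 cx] ->.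
rewrite normrM exprSr mulrA ler_wpM2r// fb// !gtr0_norm//; lra.
Qed.

Lemma tilt_log_bound (i : 'I_n) :
  `| - ln (1 - 2 * s * tilt_diag i) / 2 - (s * Sg i i + s ^+ 2 * (2 * low_sqr i + Sg i i ^+ 2)) |
    <= 100 * (`|s| * C) ^+ 3.
Proof.
set q := low_sqr i.
(* The errors are 8 and 12 from the expansion of the diagonal entry, and 64 from that of the
   logarithm. *)
have := ln_expansion (tilt_diag_half i).
have [r rC] := tilt_diag_expansion i; rewrite -/q => -[E aC xC tC].
set x := tilt_diag i in E xC *; set a := Sg i i in E aC *; set t := q + 2 * s * r in E tC.
set L := ln _ => LE.
have -> : - L / 2 - (s * a + s ^+ 2 * (2 * q + a ^+ 2)) =
   (4 * s ^+ 3 * r + 2 * s ^+ 3 * (t * (x + a))) - (L + 2 * s * x + (2 * s * x) ^+ 2 / 2) / 2.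
  by rewrite E /t; field.
have s3 : `|s ^+ 3| = `|s| ^+ 3 by rewrite normrX.
have b1 : `|4 * s ^+ 3 * r| <= 8 * (`|s| * C) ^+ 3.
  rewrite normrM (normrM 4) s3 ger0_norm// exprMn.
  have -> : 8 * (`|s| ^+ 3 * C ^+ 3) = 4 * `|s| ^+ 3 * (2 * C ^+ 3) by ring.
  by rewrite ler_wpM2l// mulr_ge0// exprn_ge0.
have b2 : `|2 * s ^+ 3 * (t * (x + a))| <= 12 * (`|s| * C) ^+ 3.
  rewrite normrM (normrM 2) (normrM t) s3 ger0_norm// exprMn.
  have -> : 12 * (`|s| ^+ 3 * C ^+ 3) = 2 * `|s| ^+ 3 * ((2 * C ^+ 2) * (3 * C)) by ring.
  rewrite ler_wpM2l//.
  rewrite ler_pM//; apply: (le_trans (ler_normD _ _)); lra.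
have b3 : 2 * `|2 * s * x| ^+ 3 <= 128 * (`|s| * C) ^+ 3.
  have -> : 128 * (`|s| * C) ^+ 3 = 2 * (2 * `|s| * (2 * C)) ^+ 3 by ring.
  rewrite ler_wpM2l// ler_pXn2r ?nnegrE ?mulr_ge0//.
  by rewrite !normrM ger0_norm// ler_wpM2l// mulr_ge0.
have b4 := le_trans LE b3.
apply: (le_trans (ler_normB _ _)).
have b5 : `|(L + 2 * s * x + (2 * s * x) ^+ 2 / 2) / 2| <= 64 * (`|s| * C) ^+ 3.
  rewrite normrM (@ger0_norm _ 2^-1)//; lra.
have b6 := ler_normD (4 * s ^+ 3 * r) (2 * s ^+ 3 * (t * (x + a))).
have e0 : 0 <= (`|s| * C) ^+ 3 by rewrite exprn_ge0// mulr_ge0.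
lra.
Qed.

Lemma sum_sqr_sym :
  \sum_(i < n) (2 * low_sqr i + Sg i i ^+ 2) =
  \sum_i \sum_j Sg i j ^+ 2.
Proof.
have sg i j : Sg j i = Sg i j by rewrite -[in LHS]Ssym mxE.
rewrite big_split/= -mulr_sumr /low_sqr.
have E : \sum_(i < n) \sum_(j < n | (j < i)%N) Sg i j ^+ 2 =
    \sum_(i < n) \sum_(j < n | (i < j)%N) Sg i j ^+ 2.
  rewrite (exchange_big_dep xpredT)//=; apply: eq_bigr => i _.
  by apply: eq_bigr => j _; rewrite sg.
rewrite mulr2n mulrDl !mul1r {2}E -!big_split/=; apply: eq_bigr => i _.
rewrite [RHS](bigD1 i)//= addrC; congr (_ + _).
rewrite [RHS](bigID (fun j : 'I_n => (j < i)%N))/=; congr (_ + _).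
  by apply: eq_bigl => j; rewrite neq_ltn andb_orl andbC; case: ltngtP.
by apply: eq_bigl => j; rewrite -leqNgt -val_eqE/=; case: ltngtP.
Qed.

(** The numbers [1 - 2 * s * tilt_diag i] are the pivots of [1 - 2 * s * Sg], so that the product is
    the determinant of this matrix to the power -1/2, and the trace and the sum of the squared
    entries are the first two terms of the logarithm of that determinant. *)
Lemma tilt_prod_log : exists2 L : R,
  \prod_(i < n) (Num.sqrt (1 - 2 * s * tilt_diag i))^-1 = expR L &
  `|L - (s * \tr Sg + s ^+ 2 * \sum_i \sum_j Sg i j ^+ 2)| <= n%:R * (100 * (`|s| * C) ^+ 3).
Proof.
exists (\sum_i (- ln (1 - 2 * s * tilt_diag i) / 2)).
  rewrite expR_sum; apply: eq_bigr => i _.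
  have p : 0 < 1 - 2 * s * tilt_diag i.
    by have := le_trans (ler_norm _) (tilt_diag_half i); lra.
  rewrite mulNr expRN; congr (_^-1).
  apply/eqP; rewrite -(@eqrXn2 _ 2)// ?sqrtr_ge0 ?expR_ge0//.
  rewrite sqr_sqrtr ?ltW// -expRM_natl.
  rewrite [X in expR X](_ : _ = ln (1 - 2 * s * tilt_diag i)); last by field.
  by rewrite lnK ?posrE.
rewrite -sum_sqr_sym /mxtrace !mulr_sumr -big_split/= -sumrB.
apply: (le_trans (ler_norm_sum _ _ _)).
apply: (@le_trans _ _ (\sum_(i < n) (100 * (`|s| * C) ^+ 3))).
  by apply: ler_sum => i _; exact: tilt_log_bound.
by rewrite sumr_const card_ord -[leLHS]mulr_natl.
Qed.

End tilted_covariance.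

(** * Moment generating function of a Gaussian sum of squares *)

Section mgf.
Context (R : realType) (n : nat) d (Omega : measurableType d) (P : probability Omega R).
Variables (X : 'I_n -> Omega -> R) (Sg : 'M[R]_n).
Hypothesis mX : forall i, measurable_fun setT (X i).
Local Notation leb := (@lebesgue_measure R).
Local Notation phi := (@normal_pdf R 0 1).

Definition lin (a : 'rV[R]_n) (w : Omega) : R := \sum_i a 0 i * X i w.

Definition sumsq (k : nat) (w : Omega) : R := \sum_(i < n | (i < k)%N) X i w ^+ 2.

Hypothesis lawX : forall a, 0 <= quad Sg a /\
  forall A, measurable A -> pushforward P (lin a) A = gaussian_law 0 (quad Sg a) A.
Hypothesis Ssym : Sg^T = Sg.

Lemma measurable_lin a : measurable_fun setT (lin a).
Proof. by apply: measurable_sum => i; apply: measurable_funM. Qed.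

Lemma measurable_sumsq k : measurable_fun setT (sumsq k).
Proof.
rewrite /sumsq; under eq_fun do rewrite big_mkcond/=.
have H (i : 'I_n) : measurable_fun setT (fun w => if (i < k)%N then X i w ^+ 2 else 0).
  by case: (i < k)%N; [exact: measurable_funX|exact: measurable_cst].
exact: (measurable_sum _ H).
Qed.

Lemma sumsq_ge0 k w : 0 <= sumsq k w.
Proof. by apply: sumr_ge0 => i _; exact: sqr_ge0. Qed.

Lemma sumsqS (i : 'I_n) w : sumsq i.+1 w = sumsq i w + X i w ^+ 2.
Proof.
rewrite /sumsq (bigD1 i)//= addrC; congr (_ + _); apply: eq_bigl => j.
by rewrite ltnS andbC ltn_neqAle -val_eqE.
Qed.

Lemma lin_delta (i : 'I_n) g a w : lin (a + g *: delta_mx 0 i) w = lin a w + g * X i w.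
Proof.
rewrite /lin; under eq_bigr do rewrite !mxE mulrDl.
rewrite big_split/=; congr (_ + _); rewrite (bigD1 i)//= !eqxx mulr1 big1 ?addr0// => j ji.
by rewrite (negbTE ji) mulr0 mul0r.
Qed.

Lemma integral_lin_law (f : R -> R) a : continuous f -> (forall x, 0 <= f x) ->
  (\int[P]_w (f (lin a w))%:E = \int[gaussian_law 0 (quad Sg a)]_x (f x)%:E)%E.
Proof.
move=> cf f0; have [_ law] := lawX a.
have mf : measurable_fun setT f by exact: continuous_measurable_fun.
have mY : @measurable_fun _ _ Omega (measurableTypeR R) setT (lin a) by exact: measurable_lin.
pose Y : {mfun Omega >-> measurableTypeR R} := HB.pack (lin a)
  (isMeasurableFun.Build _ _ _ (measurableTypeR R) (lin a) mY).
rewrite -[LHS](@ge0_integral_pushforward _ _ _ _ _ Y mY P setT (EFin \o f))//.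
- have := @eq_measure_integral _ (measurableTypeR R) R setT (gaussian_law 0 (quad Sg a))
    (distribution P Y) (EFin \o f).
  by apply=> A mA _; exact: law.
- exact/measurable_EFinP.
- by move=> x _; rewrite lee_fin.
Qed.

Lemma quad_tilt_step (S : 'M[R]_n) s (i : 'I_n) a : S^T = S ->
  quad (tilt_step s S i) a = quad S a + 2 * s / (1 - 2 * s * S i i) * ((a *m S) 0 i) ^+ 2.
Proof.
move=> sym; rewrite /quad /tilt_step mulmxDr mulmxDl mxE; congr (_ + _).
rewrite -scalemxAr -scalemxAl mxE; congr (_ * _).
have -> : a *m (col i S *m row i S) *m a^T = (a *m col i S) *m (row i S *m a^T).
  by rewrite !mulmxA.
rewrite mxE big_ord1 expr2; congr (_ * _); first by rewrite colE mulmxA -colE mxE.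
by rewrite -row_mul -{1}sym -trmx_mul !mxE.
Qed.

Lemma dot_delta (u : 'rV[R]_n) i : dot u (delta_mx 0 i) = u 0 i.
Proof. by rewrite dotE trmx_delta -colE mxE. Qed.

Lemma quad_delta (S : 'M[R]_n) g (i : 'I_n) a : S^T = S ->
  quad S (a + g *: delta_mx 0 i) = quad S a + 2 * g * (a *m S) 0 i + g ^+ 2 * S i i.
Proof.
move=> sym; rewrite !quadE mulmxDl -scalemxAl dotDl !dotDr !dotZl !dotZr !dot_delta.
have -> : dot ((delta_mx 0 i : 'rV_n) *m S) a = (a *m S) 0 i.
  by rewrite dotE -rowE -row_mul -{1}sym -trmx_mul !mxE.
have -> : ((delta_mx 0 i : 'rV_n) *m S) 0 i = S i i by rewrite -rowE mxE.
ring.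
Qed.

Definition tilt_const (s : R) (k : nat) : R :=
  \prod_(i < n | (i < k)%N) (Num.sqrt (1 - 2 * s * tilt_diag Sg s i))^-1.

Lemma tilt_constS s (i : 'I_n) :
  tilt_const s i.+1 = tilt_const s i * (Num.sqrt (1 - 2 * s * tilt_diag Sg s i))^-1.
Proof.
rewrite /tilt_const (bigD1 i)//= mulrC; congr (_ * _); apply: eq_bigl => j.
by rewrite ltnS andbC ltn_neqAle -val_eqE.
Qed.

Lemma tilt_const_ge0 s k : 0 <= tilt_const s k.
Proof. by apply: prodr_ge0 => i _; rewrite invr_ge0 sqrtr_ge0. Qed.

Variables (s C : R).
Hypothesis C0 : 0 <= C.
Hypothesis opC : forall u : 'rV[R]_n, enorm (u *m Sg) <= C * enorm u.
Hypothesis sC : `|s| * C <= 8^-1.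

Lemma tilt_diag_lt1 i : 2 * s * tilt_diag Sg s i < 1.
Proof.
have := le_trans (ler_norm _) (tilt_diag_half Ssym C0 opC sC i); lra.
Qed.

(** Each square is removed by averaging: the exponential of [s * x ^+ 2] is the mean of the
    exponential of [sqrt (2 * s) * g * x] for a standard normal variable [g]. This adds to the
    linear term, and completing the square in [g] performs one step of the tilt. *)
Lemma mgf_pos k a : 0 <= s -> (k <= n)%N ->
  (\int[P]_w (expR (lin a w + s * sumsq k w))%:E =
   (tilt_const s k * expR (quad (tilt Sg s k) a / 2))%:E)%E.
Proof.
move=> s0; elim: k a => [|k IH] a kn.
  rewrite (_ : tilt_const s 0 = 1); last by rewrite /tilt_const big1.
  rewrite mul1r (_ : (fun w => _) = fun w => (expR (1 * lin a w))%:E); last first.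
    by apply/funext => w; rewrite /sumsq big1// mulr0 addr0 mul1r.
  rewrite (@integral_lin_law (fun x => expR (1 * x)))//; last first.
    move=> x; apply: continuous_comp; last exact: continuous_expR.
    by apply: cvgM; [exact: cvg_cst|exact: cvg_id].
  by rewrite integral_expR_gaussian_law ?expr1n ?mul1r//; case: (lawX a).
pose i := Ordinal kn; rewrite (_ : k.+1 = i.+1)//.
have [sym _] := tilt_resolvent Ssym C0 opC sC (ltnW kn).
pose eta := Num.sqrt (2 * s).
have eta2 : eta ^+ 2 = 2 * s by rewrite sqr_sqrtr// mulr_ge0.
pose F (z : Omega * R) := expR (lin a z.1 + s * sumsq k z.1 + eta * z.2 * X i z.1) * phi z.2.
have mF : measurable_fun setT F.
  apply: measurable_funM; last exact: (measurableT_comp (@measurable_phi R)).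
  apply: measurableT_comp => //; apply: measurable_funD; [apply: measurable_funD|].
  - exact: (measurableT_comp (measurable_lin a)).
  - by apply: measurable_funM => //; exact: (measurableT_comp (measurable_sumsq k)).
  - apply: measurable_funM; first exact: measurable_funM.
    exact: (measurableT_comp (mX i)).
have F0 z : 0 <= F z by rewrite mulr_ge0 ?expR_ge0 ?phi_ge0.
transitivity (\int[P]_w \int[leb]_g (F (w, g))%:E)%E.
  apply: eq_integral => w _; rewrite /F/=.
  under eq_integral do rewrite expRD -mulrA EFinM.
  rewrite ge0_integralZl//; last 2 first.
  - apply/measurable_EFinP; apply: measurable_funM; last exact: measurable_phi.
    by apply: measurableT_comp => //; apply: measurable_funM => //; exact: measurable_funM.
  - by move=> g _; rewrite lee_fin mulr_ge0 ?expR_ge0 ?phi_ge0.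
  under eq_integral => g _.
    rewrite (_ : eta * g * X i w = eta * X i w * g + 0 * g ^+ 2 / 2); last by ring.
    over.
  rewrite integral_expR_quad ?ltr01// subr0 sqrtr1 invr1 mul1r mulr1 exprMn eta2.
  rewrite -EFinM -expRD (sumsqS i); congr (expR _)%:E; by field.
rewrite (@fubini_tonelli _ _ _ _ _ P leb (EFin \o F))//; last first.
- exact/measurable_EFinP.
pose b := (a *m tilt Sg s k) 0 i.
transitivity (\int[leb]_g ((tilt_const s k * expR (quad (tilt Sg s k) a / 2))%:E *
   (expR (eta * b * g + 2 * s * tilt_diag Sg s i * g ^+ 2 / 2) * phi g)%:E))%E.
  apply: eq_integral => g _; rewrite /F/=.
  under eq_integral => w _.
    rewrite (_ : lin a w + s * sumsq k w + eta * g * X i w =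
       lin (a + (eta * g) *: delta_mx 0 i) w + s * sumsq k w); last by rewrite lin_delta; ring.
    rewrite EFinM; over.
  rewrite ge0_integralZr//; last 2 first.
  - apply/measurable_EFinP/measurableT_comp => //; apply: measurable_funD.
      exact: measurable_lin.
    by apply: measurable_funM => //; exact: measurable_sumsq.
  - by rewrite lee_fin phi_ge0.
  rewrite IH ?(ltnW kn)// -!EFinM; congr (_%:E).
  rewrite quad_delta// -/b [RHS]mulrA; congr (_ * _); rewrite -[RHS]mulrA; congr (_ * _).
  by rewrite -expRD; congr expR; rewrite exprMn eta2 /tilt_diag/=; field.
have w1 := tilt_diag_lt1 i.
rewrite ge0_integralZl//; last 3 first.
- apply/measurable_EFinP/measurable_funM; last exact: measurable_phi.
  apply: measurableT_comp => //; apply: measurable_funD; first exact: measurable_funM.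
  by apply: measurable_funM => //; apply: measurable_funM => //; exact: measurable_funX.
- by move=> g _; rewrite lee_fin mulr_ge0 ?expR_ge0 ?phi_ge0.
- by rewrite lee_fin mulr_ge0 ?tilt_const_ge0 ?expR_ge0.
rewrite integral_expR_quad// -EFinM; congr (_%:E).
rewrite tilt_constS tiltS quad_tilt_step//.
rewrite mulrACA; congr (_ * _); rewrite -expRD; congr expR.
rewrite exprMn eta2 -/b /tilt_diag/=; field.
by rewrite subr_eq0 gt_eqF.
Qed.

(** For negative [s] the exponential of [s * x ^+ 2] is a mixture of cosines instead, which forces a
    statement about cosines; their boundedness replaces positivity when integrals are exchanged. *)
Lemma mgf_neg k a : s <= 0 -> (k <= n)%N ->
  \int[P]_w (cos (lin a w) * expR (s * sumsq k w)) =
  tilt_const s k * expR (- quad (tilt Sg s k) a / 2).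
Proof.
move=> s0; elim: k a => [|k IH] a kn.
  rewrite (_ : tilt_const s 0 = 1); last by rewrite /tilt_const big1.
  rewrite mul1r.
  have ic : P.-integrable setT (EFin \o (fun w => cos (lin a w))).
    apply: (@integrable_bound _ _ _ P setT _ (cst 1)) => //.
    - apply: measurableT_comp; last exact: measurable_lin.
      by apply: continuous_measurable_fun; exact: continuous_cos.
    - by move=> w _; exact: cos_max.
    - exact: finite_measure_integrable_cst.
  have : (\int[P]_w (1 + cos (lin a w))%:E = (1 + expR (- quad Sg a / 2))%:E)%E.
    rewrite (@integral_lin_law (fun x => 1 + cos x))//.
    - by rewrite integral_cos_gaussian_law//; case: (lawX a).
    - by move=> x; apply: cvgD; [exact: cvg_cst|exact: continuous_cos].
  have E1 : (\int[P]__ 1 = 1)%E.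
    by have := @integral_cst _ _ _ P setT measurableT 1%E; rewrite /= probability_setT mule1.
  under eq_integral do rewrite EFinD.
  rewrite integralD//; last exact: finite_measure_integrable_cst.
  rewrite E1 integral_EFinE// -EFinD => -[] /addrI <-.
  by apply: eq_Rintegral => w _; rewrite /sumsq big1// mulr0 expR0 mulr1.
pose i := Ordinal kn; rewrite (_ : k.+1 = i.+1)//.
have [sym _] := tilt_resolvent Ssym C0 opC sC (ltnW kn).
pose eta := Num.sqrt (2 * - s).
have eta2 : eta ^+ 2 = 2 * - s by rewrite sqr_sqrtr// mulr_ge0// oppr_ge0.
pose F (z : Omega * R) :=
  cos (lin a z.1) * expR (s * sumsq k z.1) * (cos (eta * X i z.1 * z.2) * phi z.2).
have mF : measurable_fun setT F.
  apply: measurable_funM; apply: measurable_funM.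
  - apply: measurableT_comp; first by apply: continuous_measurable_fun; exact: continuous_cos.
    exact: (measurableT_comp (measurable_lin a)).
  - apply: measurableT_comp => //.
    by apply: measurable_funM => //; exact: (measurableT_comp (measurable_sumsq k)).
  - apply: measurableT_comp; first by apply: continuous_measurable_fun; exact: continuous_cos.
    apply: measurable_funM => //; apply: measurable_funM => //.
    exact: (measurableT_comp (mX i)).
  - exact: (measurableT_comp (@measurable_phi R)).
have e1 w : expR (s * sumsq k w) <= 1.
  by rewrite -expR0 ler_expR mulr_le0_ge0// sumsq_ge0.
have Fb w g : `|F (w, g)| <= 1 * phi g.
  rewrite /F/= mulrA normrM (ger0_norm (phi_ge0 _)) ler_wpM2r ?phi_ge0//.
  rewrite !normrM -[leRHS]mulr1 ler_pM// ?cos_max//.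
  by rewrite -[leRHS]mulr1 ler_pM// ?cos_max// ger0_norm ?expR_ge0.
have FF := Rintegral_Fubini (m1 := P) (m2 := leb) mF Fb (fun=> ler01)
  (@phi_ge0 R) (finite_measure_integrable_cst P 1 measurableT) (integrable_phi R).
transitivity (\int[P]_w \int[leb]_g F (w, g)).
  apply: eq_Rintegral => w _; rewrite /F/=.
  rewrite RintegralZl//; last exact: integrable_cos_phi.
  rewrite Rintegral_cos_phi -mulrA -expRD (sumsqS i) exprMn eta2.
  by congr (_ * expR _); field.
rewrite FF.
pose b := (a *m tilt Sg s k) 0 i.
have w1 := tilt_diag_lt1 i.
pose K := tilt_const s k * expR (- quad (tilt Sg s k) a / 2).
pose Q (c : R) g := expR (c * g + 2 * s * tilt_diag Sg s i * g ^+ 2 / 2) * phi g.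
have iQ c : leb.-integrable setT (EFin \o Q c).
  apply: integrable_ge0 => //.
  - apply: measurable_funM; last exact: measurable_phi.
    apply: measurableT_comp => //; apply: measurable_funD; first exact: measurable_funM.
    by apply: measurable_funM => //; apply: measurable_funM => //; exact: measurable_funX.
  - by move=> x _; rewrite mulr_ge0 ?expR_ge0 ?phi_ge0.
  - by rewrite integral_expR_quad// ltry.
have QE c : \int[leb]_g Q c g = (Num.sqrt (1 - 2 * s * tilt_diag Sg s i))^-1 *
    expR (c ^+ 2 / (2 * (1 - 2 * s * tilt_diag Sg s i))).
  by rewrite /Rintegral integral_expR_quad.
have icos c : P.-integrable setT (EFin \o (fun w => cos (lin c w) * expR (s * sumsq k w))).
  apply: (@integrable_bound _ _ _ P setT _ (cst 1)) => //.
  - apply: measurable_funM.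
      apply: measurableT_comp; last exact: measurable_lin.
      by apply: continuous_measurable_fun; exact: continuous_cos.
    apply: measurableT_comp => //.
    by apply: measurable_funM => //; exact: measurable_sumsq.
  - move=> w _; rewrite normrM -[leRHS]mulr1 ler_pM// ?cos_max//.
    by rewrite ger0_norm ?expR_ge0.
  - exact: finite_measure_integrable_cst.
transitivity (\int[leb]_g (K / 2 * (Q (- (eta * b)) g + Q (eta * b) g))).
  apply: eq_Rintegral => g _.
  transitivity (\int[P]_w (phi g / 2 *
      (cos (lin (a + (eta * g) *: delta_mx 0 i) w) * expR (s * sumsq k w) +
       cos (lin (a + (- (eta * g)) *: delta_mx 0 i) w) * expR (s * sumsq k w)))).
    apply: eq_Rintegral => w _; rewrite /F/= !lin_delta mulNr cosD cosB.
    rewrite (_ : eta * X i w * g = eta * g * X i w); last by ring.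
    by field.
  rewrite RintegralZl//; last by have := integrableD measurableT (icos _) (icos _); exact.
  rewrite RintegralD// !IH ?(ltnW kn)// !quad_delta// -/b /Q /K.
  have h (c : R) : c ^+ 2 = eta ^+ 2 * g ^+ 2 ->
     tilt_const s k * expR (- (quad (tilt Sg s k) a + 2 * c * b + c ^+ 2 * tilt Sg s k i i) / 2)
     = tilt_const s k * expR (- quad (tilt Sg s k) a / 2) *
       expR (- (c * b) + 2 * s * tilt_diag Sg s i * g ^+ 2 / 2).
    move=> c2; rewrite -[RHS]mulrA -expRD; congr (_ * expR _).
    by rewrite c2 eta2 /tilt_diag/=; field.
  rewrite h ?exprMn// h ?sqrrN ?exprMn//.
  rewrite (_ : - (eta * g * b) = - (eta * b) * g); last by ring.
  rewrite (_ : - (- (eta * g) * b) = eta * b * g); last by ring.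
  by field.
rewrite RintegralZl//; last by have := integrableD measurableT (iQ _) (iQ _); exact.
rewrite RintegralD// !QE sqrrN exprMn eta2.
rewrite tilt_constS tiltS quad_tilt_step// -/b /K.
rewrite -mulr2n -[X in K / 2 * X]mulr_natl mulrA divfK// mulrACA; congr (_ * _).
rewrite -expRD; congr expR; rewrite /tilt_diag/=; field.
by rewrite subr_eq0 gt_eqF.
Qed.

Lemma mgf_sumsq : (\int[P]_w (expR (s * \sum_i X i w ^+ 2))%:E =
  (\prod_(i < n) (Num.sqrt (1 - 2 * s * tilt_diag Sg s i))^-1)%:E)%E.
Proof.
have V w : sumsq n w = \sum_i X i w ^+ 2.
  by rewrite /sumsq; apply: eq_bigl => i; rewrite ltn_ord.
have T : tilt_const s n = \prod_(i < n) (Num.sqrt (1 - 2 * s * tilt_diag Sg s i))^-1.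
  by rewrite /tilt_const; apply: eq_bigl => i; rewrite ltn_ord.
have L w : lin 0 w = 0 by rewrite /lin big1// => i _; rewrite mxE mul0r.
have Q S : quad S 0 = 0 :> R by rewrite /quad !mul0mx mxE.
have [s0|/ltW s0] := leP 0 s.
  have := mgf_pos 0 s0 (leqnn n); rewrite Q mul0r expR0 mulr1 T => <-.
  by apply: eq_integral => w _; rewrite L add0r V.
have := mgf_neg 0 s0 (leqnn n); rewrite Q oppr0 mul0r expR0 mulr1 T => <-.
rewrite -integral_EFinE//.
  by apply: eq_integral => w _; rewrite L cos0 mul1r V.
apply: (@integrable_bound _ _ _ P setT _ (cst 1)) => //.
- apply: measurable_funM.
    apply: measurableT_comp; last exact: measurable_lin.
    by apply: continuous_measurable_fun; exact: continuous_cos.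
  apply: measurableT_comp => //.
  by apply: measurable_funM => //; exact: measurable_sumsq.
- move=> w _; rewrite L cos0 mul1r ger0_norm ?expR_ge0//.
  by rewrite -expR0 ler_expR mulr_le0_ge0// sumsq_ge0.
- exact: finite_measure_integrable_cst.
Qed.

End mgf.

(** * Convergence in law from moment generating functions *)

Section elementary_bounds.
Context (R : realType).

Lemma expR_second_order (h : R) : `|expR h - 1 - h| <= h ^+ 2 * expR `|h|.
Proof.
have e0 := expR_gt0 h; have e1 := expR_ge1Dx h.
have e2 : expR h - 1 <= h * expR h.
  have := expR_ge1Dx (- h); rewrite expRN => H.
  have := ler_wpM2r (ltW e0) H; rewrite mulVf ?gt_eqF// mulrDl mul1r mulNr; lra.
rewrite ger0_norm; last by lra.
have [h0|h0] := leP 0 h.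
  rewrite ger0_norm//.
  have : h * (expR h - 1) <= h * (h * expR h) by rewrite ler_wpM2l.
  nra.
have E1 : 1 <= expR `|h| by rewrite -expR0 ler_expR.
have : h ^+ 2 * 1 <= h ^+ 2 * expR `|h| by rewrite ler_wpM2l// sqr_ge0.
have : expR h <= 1 by rewrite -expR0 ler_expR ltW.
nra.
Qed.

(** The remainder is compared with the exponential series at [2 * `|x|], which leaves the factor
    [2^-1 ^+ N]. *)
Lemma sin_taylor (x : R) N :
  `|sin x - \sum_(0 <= k < N) sin_coeff x k| <= (2^-1) ^+ N * expR (2 * `|x|).
Proof.
have c1 : series (sin_coeff x) @ \oo --> sin x.
  by rewrite sin.unlock; exact: is_cvg_series_sin_coeff.
have c2 : (fun M => `|series (sin_coeff x) M - \sum_(0 <= k < N) sin_coeff x k|) @ \oo -->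
    `|sin x - \sum_(0 <= k < N) sin_coeff x k|.
  by apply: cvg_norm; apply: cvgB => //; exact: cvg_cst.
have coef k : `|sin_coeff x k| <= exp_coeff `|x| k.
  have -> : sin_coeff x k = (odd k)%:R * (-1) ^+ k.-1./2 / k`!%:R * x ^+ k by rewrite sin_coeffE.
  have -> : exp_coeff `|x| k = k`!%:R^-1 * `|x| ^+ k by rewrite exp_coeffE.
  rewrite normrM normrX ler_wpM2r ?exprn_ge0//.
  rewrite !normrM normfV !normr_nat normrX normrN1 expr1n mulr1.
  by case: odd; rewrite ?mul1r ?mul0r// invr_ge0.
rewrite -(cvg_lim _ c2)//; apply: limr_le; first by apply/cvg_ex; eexists; exact: c2.
near=> M.
have NM : (N <= M)%N by near: M; exact: nbhs_infty_ge.
rewrite /series/= (big_cat_nat (n := N))//= addrAC subrr add0r.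
apply: (le_trans (ler_norm_sum _ _ _)).
apply: (@le_trans _ _ (\sum_(N <= k < M) 2^-1 ^+ N * exp_coeff (2 * `|x|) k)).
  rewrite big_nat_cond [leRHS]big_nat_cond; apply: ler_sum => k /andP[/andP[Nk _] _].
  apply: (le_trans (coef k)); rewrite !exp_coeffE/= exprMn mulrCA !mulrA.
  rewrite [leRHS](_ : _ = k`!%:R^-1 * `|x| ^+ k * (2^-1 ^+ N * 2 ^+ k)); last by ring.
  rewrite ler_peMr ?mulr_ge0 ?invr_ge0 ?exprn_ge0//.
  rewrite -(subnK Nk) exprD mulrCA -exprMn mulVf// expr1n mulr1.
  by rewrite exprn_ege1// ler1n.
rewrite -mulr_sumr ler_wpM2l ?exprn_ge0 ?invr_ge0//.
apply: (@le_trans _ _ (series (exp_coeff (2 * `|x|)) M)).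
  rewrite /series/= [leRHS](big_cat_nat (n := N))//= lerDr sumr_ge0// => k _.
  by rewrite exp_coeff_ge0// mulr_ge0.
rewrite /expR; apply: nondecreasing_cvgn_le; last exact: is_cvg_series_exp_coeff.
by apply/nondecreasing_seqP => k; rewrite /series/= big_nat_recr//= lerDl exp_coeff_ge0// mulr_ge0.
Unshelve. all: by end_near. Qed.

Lemma bernoulli (u : R) m : -1 <= u -> 1 + m%:R * u <= (1 + u) ^+ m.
Proof.
move=> u1; elim: m => [|m IH]; first by rewrite mul0r addr0 expr0.
rewrite exprSr; apply: (@le_trans _ _ ((1 + m%:R * u) * (1 + u))); last first.
  by rewrite ler_wpM2r//; lra.
rewrite -natr1 mulrDl mul1r mulrDl mulrDr mulr1 mul1r.
have : 0 <= m%:R * u * u by rewrite -mulrA mulr_ge0// -expr2 sqr_ge0.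
lra.
Qed.

(** The polynomials [(1 - v ^+ N) ^+ (2 ^ N)] tend to 1 for [v < 1/2] and to 0 for [v > 1/2]. *)
Lemma step_low (v : R) N : 0 <= v <= 1 -> 1 - (2 * v) ^+ N <= (1 - v ^+ N) ^+ (2 ^ N).
Proof.
move=> /andP[v0 v1].
have : -1 <= - v ^+ N by rewrite lerN2 exprn_ile1.
by move/(bernoulli (2 ^ N)); rewrite natrX mulrN -exprMn.
Qed.

Lemma step_high (v : R) N : 0 < v <= 1 -> (1 - v ^+ N) ^+ (2 ^ N) <= (2 * v) ^- N.
Proof.
move=> /andP[v0 v1].
have vN : 0 < v ^+ N by rewrite exprn_gt0.
have vN1 : v ^+ N <= 1 by rewrite exprn_ile1// ltW.
have := @bernoulli (v ^+ N) (2 ^ N); rewrite natrX -exprMn => H.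
have {}H : (2 * v) ^+ N <= (1 + v ^+ N) ^+ (2 ^ N).
  have : 1 + (2 * v) ^+ N <= (1 + v ^+ N) ^+ (2 ^ N) by apply: H; lra.
  lra.
have p : 0 < (2 * v) ^+ N by rewrite exprn_gt0// mulr_gt0.
rewrite -[leRHS]mul1r ler_pdivlMr//.
apply: (le_trans (ler_wpM2l _ H)); first by rewrite exprn_ge0//; lra.
rewrite -exprMn exprn_ile1//; nra.
Qed.

End elementary_bounds.

Section curtiss.
Context (R : realType).
Variables (nu_ : nat -> probability (measurableTypeR R) R) (nu : probability (measurableTypeR R) R).
Variable M : R -> R.
Hypothesis M_cvg : forall s, (\int[nu_ n]_x (expR (s * x))%:E)%E @[n --> \oo] --> (M s)%:E.
Hypothesis M_lim : forall s, (\int[nu]_x (expR (s * x))%:E = (M s)%:E)%E.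

(** Functions of at most exponential growth, whose integrals the moment generating functions
    control. *)
Definition tame (f : R -> R) (K r : R) :=
  [/\ measurable_fun setT f, 0 <= r & forall x, `|f x| <= K * expR (r * `|x|)].

Lemma measurable_expRM (s : R) : measurable_fun setT (fun x : R => expR (s * x)).
Proof. by apply: measurableT_comp => //; exact: measurable_funM. Qed.

Lemma expR_abs_le (r x : R) : 0 <= r -> expR (r * `|x|) <= expR (r * x) + expR (- r * x).
Proof.
move=> r0; have [x0|x0] := leP 0 x.
  by rewrite ger0_norm// lerDl expR_ge0.
by rewrite ltr0_norm// mulrN mulNr lerDr expR_ge0.
Qed.

Lemma integrable_tame (m : probability (measurableTypeR R) R) f K r : tame f K r ->
  (\int[m]_x (expR (r * x))%:E < +oo)%E -> (\int[m]_x (expR (- r * x))%:E < +oo)%E ->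
  m.-integrable setT (EFin \o f).
Proof.
move=> [mf r0 fK] h1 h2.
have K0 : 0 <= K.
  by have := le_trans (normr_ge0 _) (fK 0); rewrite normr0 mulr0 expR0 mulr1.
have i1 : m.-integrable setT (EFin \o (fun x => expR (r * x))).
  by apply: integrable_ge0 => //; exact: measurable_expRM.
have i2 : m.-integrable setT (EFin \o (fun x => expR (- r * x))).
  by apply: integrable_ge0 => //; exact: measurable_expRM.
apply: (@integrable_bound _ _ _ m setT f (fun x => K * (expR (r * x) + expR (- r * x)))) => //.
  by move=> x _; apply: (le_trans (fK x)); rewrite ler_wpM2l// expR_abs_le.
have := integrableZl measurableT K (integrableD measurableT i1 i2).
exact: eq_integrable.
Qed.

Lemma M_near s e : 0 < e -> \forall n \near \oo,
  (\int[nu_ n]_x (expR (s * x))%:E < +oo)%E /\ \int[nu_ n]_x expR (s * x) <= M s + e.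
Proof.
move=> e0; have /fine_cvgP[fin cv] := @M_cvg s.
have cv' := (cvgrPdist_le _ _ ).1 cv e e0.
near=> n; split.
  by rewrite ltey_eq; apply/orP; left; near: n.
have : `|M s - \int[nu_ n]_x expR (s * x)| <= e by near: n; exact: cv'.
by rewrite ler_norml; lra.
Unshelve. all: by end_near. Qed.

Lemma near_integrable_tame f K r : tame f K r ->
  \forall n \near \oo, (nu_ n).-integrable setT (EFin \o f).
Proof.
move=> tf; near=> n; apply: (integrable_tame tf).
  by have [] : (\int[nu_ n]_x (expR (r * x))%:E < +oo)%E /\ \int[nu_ n]_x expR (r * x) <= M r + 1 by near: n; exact: M_near.
by have [] : (\int[nu_ n]_x (expR (- r * x))%:E < +oo)%E /\ \int[nu_ n]_x expR (- r * x) <= M (- r) + 1 by near: n; exact: M_near.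
Unshelve. all: by end_near. Qed.

Lemma lim_integrable_tame f K r : tame f K r -> nu.-integrable setT (EFin \o f).
Proof. by move=> tf; apply: (integrable_tame tf); rewrite M_lim ltry. Qed.

(** Bounds the integrals of [expR (r * `|x|)] against [nu] and eventually against [nu_ n]; the
    summand 2 absorbs the error of the convergence at [r] and at [- r]. *)
Definition wt r : R := M r + M (- r) + 2.

Lemma M_ge0 r : 0 <= M r.
Proof. by rewrite -lee_fin -M_lim integral_ge0// => x _; rewrite lee_fin expR_ge0. Qed.

Lemma wt_gt0 r : 0 < wt r.
Proof. by have := M_ge0 r; have := M_ge0 (- r); rewrite /wt; lra. Qed.

Lemma tame_exp r : 0 <= r -> tame (fun x => expR (r * `|x|)) 1 r.
Proof.
move=> r0; split => //.
  by apply: measurableT_comp => //; apply: measurable_funM => //.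
by move=> x; rewrite mul1r ger0_norm ?expR_ge0.
Qed.

Lemma near_wt r : 0 <= r ->
  \forall n \near \oo, \int[nu_ n]_x expR (r * `|x|) <= wt r.
Proof.
move=> r0; near=> n.
have [h1 h1'] : (\int[nu_ n]_x (expR (r * x))%:E < +oo)%E /\ \int[nu_ n]_x expR (r * x) <= M r + 1 by near: n; exact: M_near.
have [h2 h2'] : (\int[nu_ n]_x (expR (- r * x))%:E < +oo)%E /\ \int[nu_ n]_x expR (- r * x) <= M (- r) + 1 by near: n; exact: M_near.
have i1 : (nu_ n).-integrable setT (EFin \o (fun x => expR (r * x))).
  by apply: integrable_ge0 => //; exact: measurable_expRM.
have i2 : (nu_ n).-integrable setT (EFin \o (fun x => expR (- r * x))).
  by apply: integrable_ge0 => //; exact: measurable_expRM.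
apply: (@le_trans _ _ (\int[nu_ n]_x (expR (r * x) + expR (- r * x)))).
  apply: le_Rintegral => //.
  - exact: (integrable_tame (tame_exp r0)).
  - by have := integrableD measurableT i1 i2; exact.
  - by move=> x _; exact: expR_abs_le.
by rewrite RintegralD// /wt; lra.
Unshelve. all: by end_near. Qed.

Lemma lim_wt r : 0 <= r -> \int[nu]_x expR (r * `|x|) <= wt r.
Proof.
move=> r0.
have i1 s : nu.-integrable setT (EFin \o (fun x => expR (s * x))).
  by apply: integrable_ge0 => //; [exact: measurable_expRM|rewrite M_lim ltry].
apply: (@le_trans _ _ (\int[nu]_x (expR (r * x) + expR (- r * x)))).
  apply: le_Rintegral => //.
  - exact: (lim_integrable_tame (tame_exp r0)).
  - by have := integrableD measurableT (i1 r) (i1 (- r)); exact.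
  - by move=> x _; exact: expR_abs_le.
by rewrite RintegralD// /wt /Rintegral !M_lim/=; lra.
Qed.

Lemma tame_mulexp f K r s : tame f K r -> tame (fun x => f x * expR (s * x)) K (r + `|s|).
Proof.
move=> [mf r0 fK]; split; last 2 first.
- by rewrite addr_ge0.
- move=> x; rewrite normrM mulrDl expRD mulrA ler_pM//.
  rewrite ger0_norm ?expR_ge0// ler_expR.
  by rewrite -normrM ler_norm.
by apply: measurable_funM => //; exact: measurable_expRM.
Qed.

Lemma tame_sub f g K L r q : tame f K r -> tame g L q -> 
  tame (fun x => f x - g x) (K + L) (r + q).
Proof.
move=> [mf r0 fK] [mg q0 gL]; split; [exact: measurable_funB|exact: addr_ge0|move=> x].
have K0 : 0 <= K by have := le_trans (normr_ge0 _) (fK 0); rewrite normr0 mulr0 expR0 mulr1.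
have L0 : 0 <= L by have := le_trans (normr_ge0 _) (gL 0); rewrite normr0 mulr0 expR0 mulr1.
apply: (le_trans (ler_normB _ _)); rewrite mulrDl lerD//.
  by apply: (le_trans (fK x)); rewrite ler_wpM2l// ler_expR mulrDl lerDl mulr_ge0.
by apply: (le_trans (gL x)); rewrite ler_wpM2l// ler_expR mulrDl lerDr mulr_ge0.
Qed.

(** The exponential tilts are part of the definition so that good functions are stable under
    multiplication by exponentials, hence by polynomials. *)
Definition good (f : R -> R) := (exists K r, tame f K r) /\
  forall s, \int[nu_ n]_x (f x * expR (s * x)) @[n --> \oo] --> \int[nu]_x (f x * expR (s * x)).

Lemma good1 : good (fun=> 1).
Proof.
split; first by exists 1, 0; split => // x; rewrite mul0r expR0 mulr1 normr1.
move=> s; have -> : \int[nu]_x (1 * expR (s * x)) = M s.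
  by rewrite /Rintegral; under eq_integral do rewrite mul1r; rewrite M_lim.
have /fine_cvgP[_ cv] := @M_cvg s.
rewrite (_ : (fun n => _) = (fine \o (fun n => (\int[nu_ n]_x (expR (s * x))%:E)%E)))//.
by apply/funext => n/=; congr fine; apply: eq_integral => x _; rewrite mul1r.
Qed.

Lemma goodZ a f : good f -> good (fun x => a * f x).
Proof.
move=> [[K [r tf]] cf]; split.
  exists (`|a| * K), r; case: tf => mf r0 fK; split => //; first exact: measurable_funM.
  by move=> x; rewrite normrM -mulrA ler_wpM2l.
move=> s; have tfs := tame_mulexp s tf.
have -> : \int[nu]_x (a * f x * expR (s * x)) = a * \int[nu]_x (f x * expR (s * x)).
  rewrite -RintegralZl//; last exact: (lim_integrable_tame tfs).
  by apply: eq_Rintegral => x _; rewrite mulrA.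
have h : a * \int[nu_ n]_x (f x * expR (s * x)) @[n --> \oo] -->
    a * \int[nu]_x (f x * expR (s * x)) by apply: cvgM; [exact: cvg_cst|exact: cf].
apply: cvg_trans h.
apply: near_eq_cvg; near=> n => /=.
rewrite -RintegralZl//; last by near: n; exact: (near_integrable_tame tfs).
by apply: eq_Rintegral => x _; rewrite mulrA.
Unshelve. all: by end_near. Qed.

Lemma goodB f g : good f -> good g -> good (fun x => f x - g x).
Proof.
move=> [[K [r tf]] cf] [[L [q tg]] cg]; split.
  by exists (K + L), (r + q); exact: tame_sub.
move=> s; have tfs := tame_mulexp s tf; have tgs := tame_mulexp s tg.
have -> : \int[nu]_x ((f x - g x) * expR (s * x)) =
    \int[nu]_x (f x * expR (s * x)) - \int[nu]_x (g x * expR (s * x)).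
  rewrite -RintegralB//; try exact: (lim_integrable_tame tfs); try exact: (lim_integrable_tame tgs).
  by apply: eq_Rintegral => x _; rewrite mulrBl.
have h : \int[nu_ n]_x (f x * expR (s * x)) - \int[nu_ n]_x (g x * expR (s * x)) @[n --> \oo] -->
    \int[nu]_x (f x * expR (s * x)) - \int[nu]_x (g x * expR (s * x)).
  by apply: cvgB; [exact: cf|exact: cg].
apply: cvg_trans h.
apply: near_eq_cvg; near=> n => /=.
rewrite -RintegralB//.
- by apply: eq_Rintegral => x _; rewrite mulrBl.
- by near: n; exact: (near_integrable_tame tfs).
- by near: n; exact: (near_integrable_tame tgs).
Unshelve. all: by end_near. Qed.

Lemma good_mulexp f a : good f -> good (fun x => f x * expR (a * x)).
Proof.
move=> [[K [r tf]] cf]; split; first by exists K, (r + `|a|); exact: tame_mulexp.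
move=> s; rewrite (_ : (fun x => _) = (fun x => f x * expR ((a + s) * x))); last first.
  by apply/funext => x; rewrite -mulrA -expRD mulrDl.
rewrite (_ : (fun n => _) = (fun n => \int[nu_ n]_x (f x * expR ((a + s) * x))))//.
Qed.

(** The class is closed under uniform approximation relative to an exponential weight. *)
Lemma good_approx f K r : tame f K r ->
  (forall e, 0 < e -> exists2 g, good g & forall x, `|f x - g x| <= e * expR (r * `|x|)) ->
  good f.
Proof.
move=> tf H; split; first by exists K, r.
move=> s; have tfs := tame_mulexp s tf.
have r0 : 0 <= r by case: tf.
set r' := r + `|s|; have r'0 : 0 <= r' by rewrite addr_ge0.
apply/cvgrPdist_le => e e0.
pose e1 := e / 3 / wt r'; have e10 : 0 < e1 by rewrite !divr_gt0// wt_gt0.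
have [g gg fg] := H e1 e10.
case: gg => -[L [q tg]] cg.
have tgs := tame_mulexp s tg.
have e3 : 0 < e / 3 by rewrite divr_gt0.
have D (m : probability (measurableTypeR R) R) :
   m.-integrable setT (EFin \o (fun x => f x * expR (s * x))) ->
   m.-integrable setT (EFin \o (fun x => g x * expR (s * x))) ->
   m.-integrable setT (EFin \o (fun x => expR (r' * `|x|))) ->
   \int[m]_x expR (r' * `|x|) <= wt r' ->
   `|\int[m]_x (f x * expR (s * x)) - \int[m]_x (g x * expR (s * x))| <= e / 3.
  move=> i1 i2 i3 b.
  rewrite -RintegralB//.
  have i4 : m.-integrable setT (EFin \o (fun x => f x * expR (s * x) - g x * expR (s * x))).
    by have := integrableB measurableT i1 i2; exact.
  apply: (le_trans (le_normr_Rintegral measurableT i4)).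
  apply: (@le_trans _ _ (\int[m]_x (e1 * expR (r' * `|x|)))).
    apply: le_Rintegral => //.
    - exact: integrable_norm.
    - by have := integrableZl measurableT e1 i3; exact: eq_integrable.
    - move=> x _; rewrite -mulrBl normrM /r' mulrDl expRD mulrA ler_pM//.
      by rewrite ger0_norm ?expR_ge0// ler_expR -normrM ler_norm.
  rewrite RintegralZl//; apply: (le_trans (ler_wpM2l (ltW e10) b)).
  by rewrite /e1 divfK// gt_eqF// wt_gt0.
have cg' := (cvgrPdist_le _ _).1 (cg s) _ e3.
near=> n.
have h1 : `|\int[nu_ n]_x (f x * expR (s * x)) - \int[nu_ n]_x (g x * expR (s * x))| <= e / 3.
  apply: D.
  - by near: n; exact: (near_integrable_tame tfs).
  - by near: n; exact: (near_integrable_tame tgs).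
  - by near: n; exact: (near_integrable_tame (tame_exp r'0)).
  - by near: n; exact: near_wt.
have h2 : `|\int[nu]_x (f x * expR (s * x)) - \int[nu]_x (g x * expR (s * x))| <= e / 3.
  apply: D.
  - exact: (lim_integrable_tame tfs).
  - exact: (lim_integrable_tame tgs).
  - exact: (lim_integrable_tame (tame_exp r'0)).
  - exact: lim_wt.
have h3 : `|\int[nu]_x (g x * expR (s * x)) - \int[nu_ n]_x (g x * expR (s * x))| <= e / 3.
  by near: n; exact: cg'.
move: h1 h2 h3; rewrite !ler_norml => /andP[a1 a2] /andP[b1 b2] /andP[c1 c2].
by apply/andP; split; clear - a1 a2 b1 b2 c1 c2; lra.
Unshelve. all: by end_near. Qed.

Lemma tame_mul f g K L r q : tame f K r -> tame g L q ->
  tame (fun x => f x * g x) (K * L) (r + q).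
Proof.
move=> [mf r0 fK] [mg q0 gL]; split; [exact: measurable_funM|exact: addr_ge0|move=> x].
by rewrite normrM mulrDl expRD mulrACA ler_pM.
Qed.

Lemma shift_expR_le (q y x : R) : 0 <= q -> expR (q * `|x - y|) <= expR (q * `|y|) * expR (q * `|x|).
Proof.
by move=> q0; rewrite -expRD ler_expR -mulrDr ler_wpM2l// [leRHS]addrC ler_normB.
Qed.

(** The factor [x - y] is the limit of the difference quotients of [expR (h * (x - y))] as [h] tends
    to 0. *)
Lemma good_mulX f y : good f -> good (fun x => f x * (x - y)).
Proof.
move=> gf; have [[K [r tf]] _] := gf.
have K0 : 0 <= K by case: tf => _ _ /(_ 0) fK; have := le_trans (normr_ge0 _) fK; rewrite normr0 mulr0 expR0 mulr1.
have r0 : 0 <= r by case: tf.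
have t1 : tame (fun x => x - y) (expR (3 * `|y|)) 3.
  split => //; first exact: measurable_funB.
  move=> x; apply: (@le_trans _ _ (expR (3 * `|x - y|))); last exact: shift_expR_le.
  apply: (le_trans (le_normr_expR _)); rewrite ler_expR ler_peMl//; lra.
apply: (good_approx (tame_mul tf t1)) => e e0.
pose A := K * expR (3 * `|y|).
have A0 : 0 <= A by rewrite mulr_ge0// expR_ge0.
pose h := Num.min 1 (e / (A + 1)).
have h0 : 0 < h by rewrite lt_min ltr01 divr_gt0//; lra.
have h1 : h <= 1 by rewrite ge_min lexx.
have hA : h * A <= e.
  apply: (@le_trans _ _ (e / (A + 1) * A)).
    by rewrite ler_wpM2r// ge_min lexx orbT.
  by rewrite mulrAC ler_pdivrMr; nra.
exists (fun x => expR (- (h * y)) / h * (f x * expR (h * x)) - h^-1 * f x).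
  by apply: goodB; apply: goodZ => //; exact: good_mulexp.
move=> x.
have -> : f x * (x - y) - (expR (- (h * y)) / h * (f x * expR (h * x)) - h^-1 * f x) =
  - (f x * h^-1) * (expR (h * (x - y)) - 1 - h * (x - y)).
  rewrite (_ : h * (x - y) = - (h * y) + h * x); last by ring.
  by rewrite expRD; field; rewrite gt_eqF.
have b := expR_second_order (h * (x - y)).
rewrite normrM normrN normrM.
have {}b : `|h^-1| * `|expR (h * (x - y)) - 1 - h * (x - y)| <= h * expR (3 * `|x - y|).
  apply: (le_trans (ler_wpM2l _ b)) => //.
  rewrite gtr0_norm ?invr_gt0//.
  have -> : h^-1 * ((h * (x - y)) ^+ 2 * expR `|h * (x - y)|) =
     h * (`|x - y| ^+ 2 * expR `|h * (x - y)|).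
    by rewrite real_normK ?num_real//; field; rewrite gt_eqF.
  rewrite ler_wpM2l//; first exact: ltW.
  rewrite (_ : 3 * `|x - y| = `|x - y| + `|x - y| + `|x - y|); last by ring.
  rewrite !expRD ler_pM ?sqr_ge0 ?expR_ge0//.
    by rewrite expr2 ler_pM// le_normr_expR.
  by rewrite ler_expR normrM gtr0_norm// ler_piMl.
have fK : `|f x| <= K * expR (r * `|x|) by case: tf.
rewrite -mulrA; apply: (le_trans (ler_pM _ _ fK b)); rewrite ?mulr_ge0//.
apply: (@le_trans _ _ (K * expR (r * `|x|) * (h * (expR (3 * `|y|) * expR (3 * `|x|))))).
  apply: ler_wpM2l; first by rewrite mulr_ge0 ?expR_ge0.
  by apply: ler_wpM2l; [exact: ltW|exact: shift_expR_le].
rewrite (mulrDl r 3) expRD.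
rewrite [leLHS](_ : _ = h * A * (expR (r * `|x|) * expR (3 * `|x|))); last by rewrite /A; ring.
by rewrite ler_wpM2r// mulr_ge0// expR_ge0.
Qed.

Lemma good_mulXn f y k : good f -> good (fun x => f x * (x - y) ^+ k).
Proof.
move=> gf; elim: k => [|k IH].
  by rewrite (_ : (fun x => _) = f)//; apply/funext => x; rewrite expr0 mulr1.
rewrite (_ : (fun x => _) = (fun x => f x * (x - y) ^+ k * (x - y))); last first.
  by apply/funext => x; rewrite exprSr mulrA.
exact: good_mulX.
Qed.

Lemma good0 : good (fun=> 0).
Proof.
by have := goodZ 0 good1; rewrite (_ : (fun x : R => _) = (fun=> 0))//; apply/funext => x; rewrite mul0r.
Qed.

Lemma goodD f g : good f -> good g -> good (fun x => f x + g x).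
Proof.
move=> gf gg; have := goodB gf (goodZ (-1) gg).
by rewrite (_ : (fun x : R => _) = (fun x => f x + g x))//; apply/funext => x; rewrite mulN1r opprK.
Qed.

(** The Taylor polynomials of the sine converge to it relative to an exponential weight. *)
Lemma good_mulsin f y c : good f -> good (fun x => f x * sin (c * (x - y))).
Proof.
move=> gf; have [[K [r tf]] _] := gf.
have K0 : 0 <= K by case: tf => _ _ /(_ 0) fK; have := le_trans (normr_ge0 _) fK; rewrite normr0 mulr0 expR0 mulr1.
have r0 : 0 <= r by case: tf.
pose q := 2 * `|c|; have q0 : 0 <= q by rewrite mulr_ge0.
have t1 : tame (fun x => sin (c * (x - y))) 1 q.
  split => //.
    apply: measurableT_comp; first by apply: continuous_measurable_fun; exact: continuous_sin.
    by apply: measurable_funM => //; exact: measurable_funB.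
  move=> x; rewrite mul1r; apply: (le_trans (sin_max _)).
  by rewrite -expR0 ler_expR mulr_ge0.
apply: (good_approx (tame_mul tf t1)) => e e0.
pose A := K * expR (q * `|y|).
have A0 : 0 <= A by rewrite mulr_ge0// expR_ge0.
have [N HN] : exists N, A * 2^-1 ^+ N <= e.
  have : (2^-1 : R) ^+ n @[n --> \oo] --> 0.
    by apply: cvg_expr; rewrite ger0_norm; lra.
  move=> /(cvgM (cvg_cst A)); rewrite mulr0 => /cvgrPdist_le/(_ e e0)[N _ HN].
  exists N; have := HN N (leqnn N); rewrite /= sub0r normrN ger0_norm//.
  by rewrite mulr_ge0// exprn_ge0// invr_ge0.
exists (fun x => f x * \sum_(0 <= k < N) sin_coeff (c * (x - y)) k).
  elim: N {HN} => [|N IH].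
    by rewrite (_ : (fun x => _) = (fun=> 0)); [exact: good0|apply/funext => x; rewrite big_nil mulr0].
  rewrite (_ : (fun x => _) = (fun x => f x * (\sum_(0 <= k < N) sin_coeff (c * (x - y)) k) +
     ((odd N)%:R * (-1) ^+ N.-1./2 / N`!%:R * c ^+ N) * (f x * (x - y) ^+ N))).
    by apply: goodD => //; apply: goodZ; exact: good_mulXn.
  apply/funext => x; rewrite big_nat_recr//= mulrDr; congr (_ + _).
  rewrite sin_coeffE exprMn; ring.
move=> x; rewrite -mulrBr normrM.
have fK : `|f x| <= K * expR (r * `|x|) by case: tf.
apply: (le_trans (ler_pM _ _ fK (sin_taylor _ N))) => //.
have -> : 2 * `|c * (x - y)| = q * `|x - y| by rewrite normrM mulrA.
apply: (@le_trans _ _ (K * expR (r * `|x|) * (2^-1 ^+ N * (expR (q * `|y|) * expR (q * `|x|))))).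
  by rewrite ler_wpM2l ?mulr_ge0 ?expR_ge0// ler_wpM2l ?exprn_ge0 ?invr_ge0// shift_expR_le.
rewrite (mulrDl r q) expRD.
rewrite [leLHS](_ : _ = A * 2^-1 ^+ N * (expR (r * `|x|) * expR (q * `|x|))); last by rewrite /A; ring.
by rewrite ler_wpM2r// mulr_ge0// expR_ge0.
Qed.

Lemma good_mulstep f y c N : good f ->
  good (fun x => f x * (1 - ((1 + sin (c * (x - y))) / 2) ^+ N)).
Proof.
move=> gf; pose v x := (1 + sin (c * (x - y))) / 2.
have gv g : good g -> good (fun x => g x * v x).
  move=> gg; have := goodD (goodZ 2^-1 gg) (goodZ 2^-1 (good_mulsin y c gg)).
  rewrite (_ : (fun x : R => _) = (fun x => g x * v x))//.
  by apply/funext => x; rewrite /v; field.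
have gvN : good (fun x => f x * v x ^+ N).
  elim: N => [|N IH].
    by rewrite (_ : (fun x => _) = f)//; apply/funext => x; rewrite expr0 mulr1.
  rewrite (_ : (fun x => _) = (fun x => f x * v x ^+ N * v x)); last first.
    by apply/funext => x; rewrite exprSr mulrA.
  exact: gv.
have := goodB gf gvN.
by rewrite (_ : (fun x : R => _) = (fun x => f x * (1 - v x ^+ N)))//; apply/funext => x; rewrite mulrBr mulr1.
Qed.

Lemma good_step y c N m : good (fun x => (1 - ((1 + sin (c * (x - y))) / 2) ^+ N) ^+ m).
Proof.
elim: m => [|m IH].
  rewrite (_ : (fun x => _) = (fun=> 1)); first exact: good1.
  by apply/funext => x; rewrite expr0.
rewrite (_ : (fun x => _) = (fun x => (1 - ((1 + sin (c * (x - y))) / 2) ^+ N) ^+ m *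
  (1 - ((1 + sin (c * (x - y))) / 2) ^+ N))); last by apply/funext => x; rewrite exprSr.
exact: good_mulstep.
Qed.

(** The sine rises through 0 at [y], so composing it with a polynomial step gives the desired
    transition. Far from [y] the periodicity of the sine spoils the approximation, but there the
    exponential on the right exceeds 1. *)
Lemma good_indicator y dl e : 0 < dl -> 0 < e -> exists2 q, good q &
  [/\ forall x, 0 <= q x <= 1,
      forall x, x <= y - dl -> 1 - q x <= e * expR `|x - y| &
      forall x, y + dl <= x -> q x <= e * expR `|x - y|].
Proof.
move=> dl0 e0.
pose T := Num.max (2 * dl) (ln e^-1).
have T0 : 0 < T by rewrite lt_max mulr_gt0.
have eT : e^-1 <= expR T by rewrite -[leLHS]lnK ?posrE ?invr_gt0// ler_expR le_max lexx orbT.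
(* The frequency makes the sine monotone where the exponential bound is below 1. *)
pose c := pi / (2 * T).
have c0 : 0 < c by rewrite divr_gt0 ?pi_gt0// mulr_gt0.
have cT : c * T = pi / 2 by rewrite /c; field; rewrite gt_eqF.
have cpi (z : R) : `|z| <= T -> c * z \in `[- (pi / 2), pi / 2].
  by move=> zT; rewrite in_itv/= -ler_norml -cT normrM gtr0_norm// ler_wpM2l// ltW.
pose sg := sin (c * dl).
have dlT : dl < T by rewrite lt_max; apply/orP; left; lra.
have dlpi : c * dl \in `[- (pi / 2), pi / 2] by apply: cpi; rewrite gtr0_norm// ltW.
have pi2 : 0 <= pi / 2 :> R by rewrite divr_ge0// pi_ge0.
have zpi : (0 : R) \in `[- (pi / 2), pi / 2] by rewrite in_itv/= oppr_le0 pi2.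
have sg0 : 0 < sg by rewrite -sin0 ltr_sin// mulr_gt0.
have sg1 : sg < 1.
  rewrite /sg -sin_pihalf ltr_sin//; first by rewrite -cT ltr_pM2l.
  by rewrite in_itv/= lexx (le_trans _ pi2)// oppr_le0.
have lesin (a b : R) : a \in `[- (pi / 2), pi / 2] -> b \in `[- (pi / 2), pi / 2] ->
    a <= b -> sin a <= sin b.
  by move=> aI bI; rewrite le_eqVlt => /orP[/eqP->//|ab]; apply: ltW; rewrite ltr_sin.
pose v x := (1 + sin (c * (x - y))) / 2.
have v01 x : 0 <= v x <= 1.
  rewrite /v; have := sin_le1 (c * (x - y)); have := sin_geN1 (c * (x - y)).
  by move=> ? ?; apply/andP; split; lra.
have [N HN] : exists N, (1 - sg) ^+ N <= e /\ (1 + sg) ^- N <= e.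
  have c1 : (1 - sg) ^+ n @[n --> \oo] --> 0.
    by apply: cvg_expr; rewrite ger0_norm; lra.
  have c2 : (1 + sg)^-1 ^+ n @[n --> \oo] --> 0.
    by apply: cvg_expr; rewrite ger0_norm ?invr_ge0 ?invf_lt1; lra.
  have h1 := (cvgrPdist_le _ _).1 c1 _ e0; have h2 := (cvgrPdist_le _ _).1 c2 _ e0.
  near \oo => N; exists N; split.
    have : `|0 - (1 - sg) ^+ N| <= e by near: N; exact: h1.
    by rewrite sub0r normrN ger0_norm// exprn_ge0//; lra.
  have : `|0 - (1 + sg)^-1 ^+ N| <= e by near: N; exact: h2.
  rewrite sub0r normrN -exprVn ger0_norm// exprn_ge0// invr_ge0; lra.
pose q x := (1 - v x ^+ N) ^+ (2 ^ N).
have q01 x : 0 <= q x <= 1.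
  have /andP[a b] := v01 x.
  have h1 : 0 <= v x ^+ N by rewrite exprn_ge0.
  have h2 : v x ^+ N <= 1 by rewrite exprn_ile1.
  by rewrite /q exprn_ge0 ?exprn_ile1//; lra.
have big x : T <= `|x - y| -> 1 <= e * expR `|x - y|.
  move=> Tx; rewrite -ler_pdivrMl// mulr1; apply: (le_trans eT); by rewrite ler_expR.
have e1 x : e <= e * expR `|x - y|.
  by rewrite ler_peMr ?(ltW e0)// -expR0 ler_expR.
exists q; first exact: good_step.
split => // x xy.
- have [xT|/ltW xT] := leP T `|x - y|.
    by apply: le_trans (big _ xT); have /andP[] := q01 x; lra.
  have vb : 2 * v x <= 1 - sg.
    have : sin (c * (x - y)) <= - sg.
      rewrite /sg -sinN; apply: lesin; [exact: cpi| |].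
        by rewrite in_itv/=; move: dlpi; rewrite in_itv/= lerN2 lerNl andbC.
      by rewrite -mulrN ler_wpM2l ?(ltW c0)//; lra.
    by rewrite /v; lra.
  apply: le_trans (e1 x).
  have := step_low N (v01 x); rewrite -/(q x) => h.
  have h2 : (2 * v x) ^+ N <= (1 - sg) ^+ N.
    by have /andP[a b] := v01 x; rewrite lerXn2r ?nnegrE//; lra.
  by case: HN => h3 _; lra.
- have [xT|/ltW xT] := leP T `|x - y|.
    by apply: le_trans (big _ xT); have /andP[] := q01 x.
  have vb : 1 + sg <= 2 * v x.
    have : sg <= sin (c * (x - y)).
      by apply: lesin; [exact: dlpi|exact: cpi|rewrite ler_wpM2l ?(ltW c0)//; lra].
    by rewrite /v; lra.
  apply: le_trans (e1 x).
  have vp : 0 < v x <= 1 by have /andP[a b] := v01 x; lra.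
  apply: (le_trans (step_high N vp)).
  case: HN => _; apply: le_trans; rewrite lef_pV2 ?posrE ?exprn_gt0//; try lra.
  by rewrite lerXn2r ?nnegrE//; lra.
Unshelve. all: by end_near. Qed.

Lemma Rintegral_cdf (m : probability (measurableTypeR R) R) y :
  \int[m]_x (\1_(`]-oo, y]%classic : set R) x) = fine (m `]-oo, y]%classic).
Proof. by rewrite /Rintegral integral_indic// setIT. Qed.

Lemma integrable_cdf (m : probability (measurableTypeR R) R) y :
  m.-integrable setT (EFin \o (\1_(`]-oo, y]%classic : set R) : R -> R)).
Proof. by apply: integrable_indic => //=; rewrite probability_setT ltry. Qed.

Lemma cdf_sandwich (m : probability (measurableTypeR R) R) y dl e (q : R -> R) D :
  0 < dl -> 0 <= e ->
  measurable_fun setT q ->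
  (forall x, 0 <= q x <= 1) ->
  (forall x, x <= y - dl -> 1 - q x <= e * expR `|x - y|) ->
  (forall x, y + dl <= x -> q x <= e * expR `|x - y|) ->
  m.-integrable setT (EFin \o (fun x => expR `|x - y|)) ->
  \int[m]_x expR `|x - y| <= D ->
  fine (m `]-oo, y - dl]%classic) - e * D <= \int[m]_x q x <= fine (m `]-oo, y + dl]%classic) + e * D.
Proof.
move=> dl0 e0 mq q01 q1 q2 ie bD.
have iq : m.-integrable setT (EFin \o q).
  apply: (@integrable_bound _ _ _ m setT q (cst 1)) => //.
    by move=> x _; have /andP[a b] := q01 x; rewrite ger0_norm.
  exact: finite_measure_integrable_cst.
have iee : m.-integrable setT (EFin \o (fun x => e * expR `|x - y|)).
  by have := integrableZl measurableT e ie; exact: eq_integrable.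
have bb : \int[m]_x (e * expR `|x - y|) <= e * D by rewrite RintegralZl// ler_wpM2l.
have ep x : 0 <= e * expR `|x - y| by rewrite mulr_ge0// expR_ge0.
apply/andP; split.
  rewrite lerBlDr; apply: le_trans (lerD (lexx _) bb); rewrite -RintegralD//.
  rewrite -Rintegral_cdf; apply: le_Rintegral => //.
  - exact: integrable_cdf.
  - by have := integrableD measurableT iq iee; exact.
  move=> x _; rewrite indicE; have /andP[a b] := q01 x; have := ep x.
  case: (boolP (_ \in _)) => [|_ /=]; last by lra.
  by rewrite inE/= in_itv/= => /q1; lra.
apply: le_trans (lerD (lexx _) bb); rewrite -Rintegral_cdf -RintegralD//; last exact: integrable_cdf.
apply: le_Rintegral => //.
- by have := integrableD measurableT (integrable_cdf m (y + dl)) iee; exact.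
move=> x _; rewrite indicE; have /andP[a b] := q01 x; have := ep x.
case: (boolP (_ \in _)) => [_ /=|]; first by lra.
rewrite notin_setE/= in_itv/= => /negP; rewrite -ltNge => /ltW/q2 /=; lra.
Qed.

(** Curtiss' theorem. Good functions contain the constants and are stable under multiplication by
    exponentials, hence, by approximation, by polynomials and by sines; among them are continuous
    approximations of the indicators of half lines, between which the distribution functions are
    squeezed. *)
Theorem cdf_cvg_mgf y : {for y, continuous (fun r : R => nu `]-oo, r]%classic)} ->
  nu_ n `]-oo, y]%classic @[n --> \oo] --> nu `]-oo, y]%classic.
Proof.
move=> cy.
have ffin (m : probability (measurableTypeR R) R) r : (fine (m `]-oo, r]%classic))%:E = m `]-oo, r]%classic.
  by rewrite fineK// fin_num_measure.
rewrite (_ : (fun n => _) = (fun n => (fine (nu_ n `]-oo, y]%classic))%:E)); last first.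
  by apply/funext => n; rewrite ffin.
rewrite -ffin; apply: cvg_EFin; first exact: nearW.
rewrite (_ : _ \o _ = (fun n => fine (nu_ n `]-oo, y]%classic)))//.
have cy' : fine (nu `]-oo, r]%classic) @[r --> y] --> fine (nu `]-oo, y]%classic).
  by apply: fine_cvg; rewrite ffin; exact: cy.
apply/cvgrPdist_le => e e0.
pose e1 := e / 4; have e10 : 0 < e1 by rewrite divr_gt0.
have [dl0 /= dl00 Hdl] := (cvgrPdist_le _ _).1 cy' _ e10.
pose dl := Num.min 1 (dl0 / 4).
have dl1 : 0 < dl by rewrite lt_min ltr01 divr_gt0.
have dl2 : dl <= 1 by rewrite ge_min lexx.
have dl4 : dl <= dl0 / 4 by rewrite ge_min lexx orbT.
have near_y z : `|y - z| < dl0 -> `|fine (nu `]-oo, y]%classic) - fine (nu `]-oo, z]%classic)| <= e1.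
  exact: Hdl.
pose D := expR (`|y| + 1) * wt 1.
have D0 : 0 < D by rewrite mulr_gt0// ?expR_gt0// wt_gt0.
pose e2 := e1 / (2 * D); have e20 : 0 < e2 by rewrite divr_gt0// mulr_gt0.
have e2D : e2 * D = e1 / 2 by rewrite /e2; field; rewrite gt_eqF.
have tz z : `|z| <= `|y| + 1 -> tame (fun x => expR `|x - z|) (expR (`|y| + 1)) 1.
  move=> zy; split => //.
    apply: measurableT_comp => //; apply: measurableT_comp.
      by apply: continuous_measurable_fun; exact: norm_continuous.
    exact: measurable_funB.
  move=> x; rewrite ger0_norm ?expR_ge0// -expRD ler_expR mul1r.
  by apply: (le_trans (ler_normB _ _)); lra.
have bz (m : probability (measurableTypeR R) R) z : `|z| <= `|y| + 1 ->
   m.-integrable setT (EFin \o (fun x => expR `|x - z|)) ->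
   m.-integrable setT (EFin \o (fun x => expR (1 * `|x|))) ->
   \int[m]_x expR (1 * `|x|) <= wt 1 -> \int[m]_x expR `|x - z| <= D.
  move=> zy i1 i2 b; apply: (@le_trans _ _ (\int[m]_x (expR (`|y| + 1) * expR (1 * `|x|)))).
    apply: le_Rintegral => //.
      by have := integrableZl measurableT (expR (`|y| + 1)) i2; exact: eq_integrable.
    move=> x _; rewrite -expRD ler_expR mul1r; apply: (le_trans (ler_normB _ _)); lra.
  by rewrite RintegralZl// /D ler_wpM2l ?expR_ge0.
have key z : `|z| <= `|y| + 1 -> exists2 q, good q & 
   (\forall n \near \oo, fine (nu_ n `]-oo, z - dl]%classic) - e1 / 2 <= \int[nu_ n]_x q x <=
      fine (nu_ n `]-oo, z + dl]%classic) + e1 / 2) /\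
   fine (nu `]-oo, z - dl]%classic) - e1 / 2 <= \int[nu]_x q x <=
      fine (nu `]-oo, z + dl]%classic) + e1 / 2.
  move=> zy; have [q gq [q01 q1 q2]] := good_indicator z dl1 e20.
  have mq : measurable_fun setT q by case: gq => -[K [r [mq _ _]]] _.
  exists q => //; rewrite -e2D; split.
    near=> n; apply: cdf_sandwich => //; first exact: ltW.
    - by near: n; exact: (near_integrable_tame (tz z zy)).
    - apply: bz => //.
      + by near: n; exact: (near_integrable_tame (tz z zy)).
      + by near: n; exact: (near_integrable_tame (tame_exp ler01)).
      + by near: n; exact: near_wt.
  apply: cdf_sandwich => //; first exact: ltW.
  - exact: (lim_integrable_tame (tz z zy)).
  - apply: bz => //.
    + exact: (lim_integrable_tame (tz z zy)).
    + exact: (lim_integrable_tame (tame_exp ler01)).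
    + exact: lim_wt.
have cvq q : good q -> \forall n \near \oo, `|\int[nu]_x q x - \int[nu_ n]_x q x| <= e1.
  move=> [_ cq].
  have E (m : probability (measurableTypeR R) R) : \int[m]_x (q x * expR (0 * x)) = \int[m]_x q x.
    by apply: eq_Rintegral => x _; rewrite mul0r expR0 mulr1.
  near=> n; rewrite -(E nu) -(E (nu_ n)); near: n.
  exact: ((cvgrPdist_le _ _).1 (@cq 0) _ e10).
have [q gq [q1 q2]] : exists2 q, good q & 
   (\forall n \near \oo, fine (nu_ n `]-oo, (y + dl) - dl]%classic) - e1 / 2 <= \int[nu_ n]_x q x <=
      fine (nu_ n `]-oo, (y + dl) + dl]%classic) + e1 / 2) /\
   fine (nu `]-oo, (y + dl) - dl]%classic) - e1 / 2 <= \int[nu]_x q x <=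
      fine (nu `]-oo, (y + dl) + dl]%classic) + e1 / 2.
  by apply: key; apply: (le_trans (ler_normD _ _)); rewrite (gtr0_norm dl1) lerD2l.
have [p gp [p1 p2]] : exists2 q, good q & 
   (\forall n \near \oo, fine (nu_ n `]-oo, (y - dl) - dl]%classic) - e1 / 2 <= \int[nu_ n]_x q x <=
      fine (nu_ n `]-oo, (y - dl) + dl]%classic) + e1 / 2) /\
   fine (nu `]-oo, (y - dl) - dl]%classic) - e1 / 2 <= \int[nu]_x q x <=
      fine (nu `]-oo, (y - dl) + dl]%classic) + e1 / 2.
  by apply: key; apply: (le_trans (ler_normB _ _)); rewrite (gtr0_norm dl1) lerD2l.
rewrite addrK in q1 q2; rewrite subrK in p1 p2.
have n1 := near_y (y + dl + dl); have n2 := near_y (y - dl - dl).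
have {}n1 : `|fine (nu `]-oo, y]%classic) - fine (nu `]-oo, (y + dl + dl)%R]%classic)| <= e1.
  by apply: n1; rewrite -addrA opprD addNKr normrN; clear - dl1 dl4 dl00; rewrite ger0_norm; lra.
have {}n2 : `|fine (nu `]-oo, y]%classic) - fine (nu `]-oo, (y - dl - dl)%R]%classic)| <= e1.
  by apply: n2; clear - dl1 dl4 dl00; rewrite ger0_norm; lra.
have cq := cvq q gq; have cp := cvq p gp.
near=> n.
have a1 : `|\int[nu]_x q x - \int[nu_ n]_x q x| <= e1 by near: n; exact: cq.
have a2 : `|\int[nu]_x p x - \int[nu_ n]_x p x| <= e1 by near: n; exact: cp.
have a3 : fine (nu_ n `]-oo, y]%classic) - e1 / 2 <= \int[nu_ n]_x q x <=
      fine (nu_ n `]-oo, (y + dl) + dl]%classic) + e1 / 2 by near: n; exact: q1.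
have a4 : fine (nu_ n `]-oo, (y - dl) - dl]%classic) - e1 / 2 <= \int[nu_ n]_x p x <=
      fine (nu_ n `]-oo, y]%classic) + e1 / 2 by near: n; exact: p1.
move: n1 n2 a1 a2 a3 a4 p2 q2; rewrite !ler_norml /e1 => /andP[h1 h2] /andP[h3 h4] /andP[h5 h6]
  /andP[h7 h8] /andP[h9 h10] /andP[h11 h12] /andP[h13 h14] /andP[h15 h16].
by apply/andP; split; clear - h1 h2 h3 h4 h5 h6 h7 h8 h9 h10 h11 h12 h13 h14 h15 h16; lra.
Unshelve. all: by end_near. Qed.

End curtiss.

(** * Lebesgue integrals on R^n *)

Section lebesgue_affine.
Context (R : realType).
Local Notation mu := (@lebesgue_measure R).

(** The image of Lebesgue measure under the affine map, rescaled, agrees with it on intervals. *)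
Lemma ge0_integral_affine (s c : R) (f : R -> \bar R) : 0 < s ->
  measurable_fun setT f -> (forall x, (0 <= f x)%E) ->
  (\int[mu]_x f (s * x + c)%R = s^-1%:E * \int[mu]_x f x)%E.
Proof.
move=> s0 mf f0.
have mphi : measurable_fun setT (fun x : measurableTypeR R => s * x + c : measurableTypeR R).
  by apply: measurable_funD => //; exact: measurable_funM.
pose phi : {mfun measurableTypeR R >-> measurableTypeR R} :=
  HB.pack (fun x : measurableTypeR R => s * x + c : measurableTypeR R)
  (isMeasurableFun.Build _ _ (measurableTypeR R) (measurableTypeR R) _ mphi).
have s0' : 0 <= s by exact: ltW.
pose snn := NngNum s0'.
have E A : measurable A -> mu A = mscale snn (pushforward mu phi) A.
  move=> mA; apply: lebesgue_measure_unique mA => _ [[a b] _ <-] /=.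
  rewrite /mscale /=.
  change (mu `]a, b]%classic = (s%:E * mu ((fun x : R => (s * x + c)%R) @^-1` `]a, b]%classic))%E).
  have -> : (fun x : R => s * x + c) @^-1` `]a, b]%classic = `](a - c) / s, (b - c) / s]%classic.
    apply/seteqP; split => x /=; rewrite !in_itv/= ltr_pdivrMr// ler_pdivlMr// => /andP[h1 h2];
    apply/andP; split; lra.
  rewrite !lebesgue_measure_itv/= !lte_fin.
  rewrite ltr_pM2r ?invr_gt0// ltrBlDr subrK.
  case: ifPn => ab; rewrite ?mule0// -!EFinB -EFinM; congr EFin.
  by field; rewrite gt_eqF.
have -> : (\int[mu]_x f x = \int[mscale snn (pushforward mu phi)]_x f x)%E.
  by move=> m; apply: eq_measure_integral => A mA _; exact: E.
rewrite ge0_integral_mscale//= ge0_integral_pushforward//= preimage_setT muleA -EFinM mulVf ?mul1e//.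
by rewrite gt_eqF.
Qed.

Lemma ge0_integral_opp (f : R -> \bar R) :
  measurable_fun setT f -> (forall x, (0 <= f x)%E) ->
  (\int[mu]_x f (- x)%R = \int[mu]_x f x)%E.
Proof.
move=> mf f0.
have mN : measurable_fun setT (-%R : measurableTypeR R -> measurableTypeR R).
  exact: oppr_measurable.
transitivity (\int[pushforward mu (-%R : measurableTypeR R -> measurableTypeR R)]_x f x)%E.
  by rewrite ge0_integral_pushforward.
by apply: eq_measure_integral => A mA _; exact: lebesgue_measureN.
Qed.

End lebesgue_affine.

Section decay.
Context (R : realType).
Local Notation mu := (@lebesgue_measure R).

(** A singularity of order [a] at the origin and a decay of order [b] at infinity; the case of
    interest is [a < 1 < b], where the function is integrable. *)
Definition decay (a b x : R) : R := Num.min (`|x| `^ (- a)) (`|x| `^ (- b)).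

Lemma decay_ge0 a b x : 0 <= decay a b x.
Proof. by rewrite /decay le_min !powR_ge0. Qed.

Lemma measurable_decay a b : measurable_fun setT (decay a b).
Proof.
have mn : measurable_fun setT (fun x : R => `|x|).
  by apply: continuous_measurable_fun; exact: norm_continuous.
by apply: measurable_minr; apply: (measurableT_comp (measurable_powR _) mn).
Qed.

Lemma powRN_nonincr (a x y : R) : 0 <= a -> 0 < x -> x <= y -> y `^ (- a) <= x `^ (- a).
Proof.
move=> a0 x0 xy; have y0 : 0 < y by exact: lt_le_trans xy.
rewrite !powRN lef_pV2 ?posrE ?powR_gt0//.
by apply: ge0_ler_powR => //; rewrite nnegrE ltW.
Qed.

Lemma decay_nonincr (a b x y : R) : 0 <= a -> 0 <= b -> 0 < `|x| -> `|x| <= `|y| ->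
  decay a b y <= decay a b x.
Proof.
move=> a0 b0 x0 xy; rewrite /decay le_min !ge_min.
by rewrite !powRN_nonincr// orbT.
Qed.

Lemma decay_opp a b x : decay a b (- x) = decay a b x.
Proof. by rewrite /decay normrN. Qed.

Lemma integral_powR_itv (a x y : R) : a != 1 -> 0 < x -> x < y ->
  (\int[mu]_(z in `[x, y]) (z `^ (- a))%:E =
   ((y `^ (1 - a) - x `^ (1 - a)) / (1 - a))%:E)%E.
Proof.
move=> a1 x0 xy.
have a1' : 1 - a != 0 by rewrite subr_eq0 eq_sym.
have der (z : R) : 0 < z -> is_derive z 1 (fun z : R => (1 - a)^-1 * z `^ (1 - a)) (z `^ (- a)).
  move=> z0; have := is_derive1_powR (1 - a) z0 => h.
  have := is_deriveZ (1 - a)^-1 h => h2.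
  apply: is_derive_eq; rewrite /GRing.scale/= mulrA mulVf// mul1r; congr (_ `^ _); ring.
have cts (z : R) : 0 < z -> {for z, continuous (fun z : R => z `^ (- a))}.
  move=> z0; apply: differentiable_continuous; apply/derivable1_diffP.
  by have [] := is_derive1_powR (- a) z0.
rewrite (@continuous_FTC2 _ _ (fun z => (1 - a)^-1 * z `^ (1 - a)))//.
- by rewrite -EFinB; congr EFin; rewrite -mulrBr mulrC.
- apply: continuous_in_subspaceT => z; rewrite inE/= in_itv/= => /andP[xz _].
  by apply: cts; exact: lt_le_trans xz.
- have dc (z : R) : 0 < z -> {for z, continuous (fun z : R => (1 - a)^-1 * z `^ (1 - a))}.
    by move=> z0; apply: differentiable_continuous; apply/derivable1_diffP; have [] := der z z0.
  split.
  + move=> z; rewrite in_itv/= => /andP[xz _]; have z0 := lt_trans x0 xz.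
    by have [] := der z z0.
  + by apply: cvg_at_right_filter; apply: dc.
  + by apply: cvg_at_left_filter; apply: dc; exact: lt_trans xy.
- move=> z; rewrite in_itv/= => /andP[xz _]; have z0 := lt_trans x0 xz.
  by rewrite derive1E; have := der z z0 => h; rewrite derive_val.
Qed.

Lemma integral_decay_lty (a b : R) : 0 <= a -> a < 1 -> 1 < b ->
  (\int[mu]_x (decay a b x)%:E < +oo)%E.
Proof.
move=> a0 a1 b1.
have md : measurable_fun setT (EFin \o decay a b).
  by apply/measurable_EFinP; exact: measurable_decay.
have md' D : measurable_fun D (EFin \o decay a b) by exact: measurable_funS md.
have d0 x : (0 <= (decay a b x)%:E)%E by rewrite lee_fin decay_ge0.
have mpow D c : measurable_fun D (fun x : R => (x `^ c)%:E).
  by apply/measurable_EFinP; exact: measurable_funS (measurable_powR _).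
pose K := (1 - a)^-1 + (b - 1)^-1.
pose F (i : nat) := `[i.+2%:R^-1, i.+2%:R]%classic : set R.
have i21 (i : nat) : (1 : R) < i.+2%:R by rewrite ltr1n.
have i20 (i : nat) : (0 : R) < i.+2%:R by rewrite ltr0n.
have FK i : (\int[mu]_(x in F i) (decay a b x)%:E <= K%:E)%E.
  have -> : F i = `[i.+2%:R^-1, 1]%classic `|` `]1, i.+2%:R]%classic.
    rewrite /F; apply/seteqP; split => x /=; rewrite !in_itv/=.
      move=> /andP[h1 h2]; case: (leP x 1) => x1; [left|right]; rewrite ?h1 ?x1 ?(ltW x1) ?h2//.
    have hi := ltW (i21 i); have hi' : (i.+2%:R : R)^-1 <= 1 by rewrite invf_le1.
    move: (i.+2%:R : R) hi hi' => N hi hi'; case=> /andP[h1 h2]; apply/andP; split; lra.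
  pose A1 : set R := `[i.+2%:R^-1, 1]%classic; pose A2 : set R := `]1, i.+2%:R]%classic.
  rewrite -/A1 -/A2.
  have -> : (\int[mu]_(x in A1 `|` A2) (decay a b x)%:E =
      \int[mu]_(x in A1) (decay a b x)%:E + \int[mu]_(x in A2) (decay a b x)%:E)%E.
    apply: ge0_integral_setU => //; [exact: measurable_itv|exact: measurable_itv|exact: md'|].
    apply/disj_setPS => x [] /=; rewrite /A1 /A2 /= !in_itv/= => /andP[_ h1] /andP[h2 _].
    by move: (lt_le_trans h2 h1); rewrite ltxx.
  rewrite /K EFinD leeD// /A1 /A2.
    apply: (@le_trans _ _ (\int[mu]_(x in `[(i.+2%:R^-1)%R, 1%R]) (x `^ (- a))%:E)%E).
      apply: ge0_le_integral => //=; [exact: md'|exact: mpow|].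
      move=> x; rewrite /= in_itv/= => /andP[x0 _]; rewrite lee_fin /decay ge_min.
      have x00 : 0 <= x by apply: le_trans x0; rewrite invr_ge0 ler0n.
      by rewrite ger0_norm// lexx.
    rewrite integral_powR_itv ?lt_eqF ?invr_gt0 ?invf_lt1// lee_fin powR1.
    rewrite ler_pdivrMr ?subr_gt0// mulVf ?subr_eq0 ?gt_eqF//.
  apply: (@le_trans _ _ (\int[mu]_(x in `[1%R, i.+2%:R%R]) (decay a b x)%:E)%E).
    apply: ge0_subset_integral => //=; first exact: md'.
    move=> x; rewrite /= !in_itv/= => /andP[h1 ->].
    by rewrite (ltW h1).
  apply: (@le_trans _ _ (\int[mu]_(x in `[1%R, i.+2%:R%R]) (x `^ (- b))%:E)%E).
    apply: ge0_le_integral => //=; [exact: md'|exact: mpow|].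
    move=> x; rewrite /= in_itv/= => /andP[x0 _]; rewrite lee_fin /decay ge_min.
    have x00 : 0 <= x by apply: le_trans x0.
    by rewrite ger0_norm// lexx orbT.
  rewrite integral_powR_itv ?gt_eqF// lee_fin powR1.
  rewrite -[1 - b]opprB invrN mulrN -mulNr opprB ler_pdivrMr ?subr_gt0// mulVf ?subr_eq0 ?gt_eqF//.
have hpos : (\int[mu]_(x in `]0%R, +oo[) (decay a b x)%:E <= K%:E)%E.
  have := @ge0_nondecreasing_set_cvg_integral _ (measurableTypeR R) R F (EFin \o decay a b) mu.
  have -> : \bigcup_i F i = `]0, +oo[%classic.
    apply/seteqP; split => x /=; rewrite ?in_itv/= ?andbT.
      by case=> i _; rewrite /F /= in_itv/= => /andP[h _]; apply: lt_le_trans h; rewrite invr_gt0.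
    move=> x0; exists (Num.trunc (x + x^-1)) => //; rewrite /F /= in_itv/=.
    have hh : x + x^-1 < (Num.trunc (x + x^-1)).+2%:R.
      have := truncnS_gt (x + x^-1) => h; apply: lt_trans h _; by rewrite ltr_nat.
    have xi : 0 < x^-1 by rewrite invr_gt0.
    apply/andP; split; last by apply: ltW; lra.
    by rewrite -[leRHS]invrK lef_pV2 ?posrE//; apply: ltW; lra.
  move=> h; apply: (cvge_to_le (h _ _ _ _)).
  - move=> n m nm; apply/subsetPset => x /=; rewrite /F /= !in_itv/= => /andP[h1 h2].
    have nm' : (n.+2%:R : R) <= m.+2%:R by rewrite ler_nat.
    apply/andP; split; last by lra.
    by apply: le_trans h1; rewrite lef_pV2 ?posrE.
  - by move=> i; exact: measurable_itv.
  - by move=> i; exact: md'.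
  - by move=> i x _; exact: d0.
  - by near=> n; exact: FK.
pose f (x : R) : \bar R := if 0 < x then (decay a b x)%:E else 0%E.
have fE : f = (EFin \o decay a b) \_ `]0, +oo[%classic.
  apply/funext => x; rewrite /f patchE; case: ifPn => x0; case: ifPn => //.
    by move=> /negP[]; rewrite inE/= in_itv/= x0.
  by rewrite inE/= in_itv/= andbT => x1; rewrite x1 in x0.
have mf : measurable_fun setT f.
  by rewrite fE; apply/(measurable_restrictT _ _).1.
have f0 x : (0 <= f x)%E by rewrite /f; case: ifPn.
have fK : (\int[mu]_x f x <= K%:E)%E by rewrite fE -integral_mkcond.
apply: (@le_lt_trans _ _ (\int[mu]_x (f x + f (- x)%R))%E).
  apply: ge0_le_integral => //=.
  - by apply: emeasurable_funD => //; exact: measurableT_comp.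
  - move=> x _; rewrite /f decay_opp oppr_gt0; case: (ltgtP x 0) => x0; rewrite ?adde0 ?add0e//.
    have b0 : - b != 0 by rewrite oppr_eq0 gt_eqF// (lt_trans _ b1).
    by rewrite x0 /decay normr0 (powR0 b0) min_r ?powR_ge0 ?adde0.
rewrite ge0_integralD//; last exact: measurableT_comp.
rewrite ge0_integral_opp//.
by apply: (@le_lt_trans _ _ (K%:E + K%:E)%E); [exact: leeD|rewrite -EFinD ltry].
Unshelve. all: by end_near.
Qed.
End decay.

Section lebesgue_rV_integral.
Context (R : realType).
Local Notation mu := (@lebesgue_measure R).
Local Notation leb := (lebesgue_rV R).

Lemma ge0_integral_lebesgue_rVS n (f : 'rV[R]_n.+1 -> \bar R) :
  measurable_fun setT f -> (forall x, (0 <= f x)%E) ->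
  (\int[leb n.+1]_z f z = \int[mu]_x \int[leb n]_y f (cons_rV (x, y)))%E.
Proof.
move=> mf f0.
transitivity (\int[pushforward (mu \x leb n)%E (@cons_rV R n)]_z f z)%E; first by [].
rewrite ge0_integral_pushforward//=; last exact: measurable_cons_rV.
rewrite preimage_setT fubini_tonelli1//.
by apply: measurableT_comp => //; exact: measurable_cons_rV.
Qed.

Lemma ge0_integral_lebesgue_rVS_swap n (f : 'rV[R]_n.+1 -> \bar R) :
  measurable_fun setT f -> (forall x, (0 <= f x)%E) ->
  (\int[leb n.+1]_z f z = \int[leb n]_y \int[mu]_x f (cons_rV (x, y)))%E.
Proof.
move=> mf f0; rewrite ge0_integral_lebesgue_rVS//.
rewrite (@fubini_tonelli _ _ _ _ _ mu (leb n) (f \o (@cons_rV R n)))//; last first.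
  by move=> x; exact: f0.
by apply: measurableT_comp => //; exact: measurable_cons_rV.
Qed.

Lemma measurable_integral_cons_l n (f : 'rV[R]_n.+1 -> \bar R) :
  measurable_fun setT f -> (forall x, (0 <= f x)%E) ->
  measurable_fun setT (fun x : measurableTypeR R => (\int[leb n]_y f (cons_rV (x, y)))%E).
Proof.
move=> mf f0.
apply: (@measurable_fun_fubini_tonelli_F _ _ (measurableTypeR R) _ R (leb n) (f \o (@cons_rV R n))).
  by apply: measurableT_comp => //; exact: measurable_cons_rV.
by move=> x; exact: f0.
Qed.

Lemma measurable_integral_cons_r n (f : 'rV[R]_n.+1 -> \bar R) :
  measurable_fun setT f -> (forall x, (0 <= f x)%E) ->
  measurable_fun setT (fun y : 'rV[R]_n => (\int[mu]_x f (cons_rV (x, y)))%E).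
Proof.
move=> mf f0.
apply: (@measurable_fun_fubini_tonelli_G _ _ (measurableTypeR R) _ R mu (f \o (@cons_rV R n))).
  by apply: measurableT_comp => //; exact: measurable_cons_rV.
by move=> x; exact: f0.
Qed.

Lemma integral_lebesgue_rV0 (f : 'rV[R]_0 -> \bar R) :
  (\int[leb 0]_z f z = f 0%R)%E.
Proof.
rewrite (_ : f = cst (f 0)); last by apply/funext => x; rewrite /= thinmx0.
transitivity (\int[\d_(0%R : 'rV[R]_0)]_z (cst (f 0%R)) z)%E; first by [].
by rewrite integral_dirac// diracT mul1e.
Qed.

Lemma measurable_prod_coord n (f : 'I_n -> R -> R) :
  (forall j, measurable_fun setT (f j)) ->
  measurable_fun setT (fun w : 'rV[R]_n => \prod_j f j (w 0 j)).
Proof.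
move=> mf; apply: measurable_prod => j _.
by apply: measurableT_comp; [exact: mf|exact: measurable_coord_rV].
Qed.

Lemma measurable_dot n (rho : 'rV[R]_n) : measurable_fun setT (dot rho).
Proof.
apply: measurable_sum => j; apply: measurable_funM => //.
exact: measurable_coord_rV.
Qed.

Lemma dot_cons n (rho : 'rV[R]_n.+1) x y :
  dot rho (cons_rV (x, y)) = rho 0 0 * x + dot (uncons_rV rho).2 y.
Proof.
rewrite /dot big_ord_recl cons_rV0/=; congr (_ + _); apply: eq_bigr => i _.
by rewrite cons_rVS mxE.
Qed.

Lemma integral_prod_rV n (f : 'I_n -> R -> R) :
  (forall j, measurable_fun setT (f j)) -> (forall j x, 0 <= f j x) ->
  (\int[leb n]_w (\prod_j f j (w 0 j))%:E = \prod_j \int[mu]_x (f j x)%:E)%E.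
Proof.
elim: n f => [|n IH] f mf f0; first by rewrite integral_lebesgue_rV0 !big_ord0.
rewrite ge0_integral_lebesgue_rVS//; last 2 first.
- by apply/measurable_EFinP; exact: measurable_prod_coord.
- by move=> x; rewrite lee_fin prodr_ge0.
have ge0I j : (0 <= \int[mu]_x (f j x)%:E)%E.
  by apply: integral_ge0 => x _; rewrite lee_fin.
rewrite big_ord_recl -(IH (fun j => f (lift ord0 j)))//.
rewrite muleC -ge0_integralZl//=; last first.
- by apply: integral_ge0 => x _; rewrite lee_fin prodr_ge0.
- by move=> x _; rewrite lee_fin.
- by apply/measurable_EFinP; exact: mf.
apply: eq_integral => x _; rewrite muleC -ge0_integralZl//=; last 3 first.
- by apply/measurable_EFinP; exact: (measurable_prod_coord (fun j => mf (lift ord0 j))).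
- by move=> y _; rewrite lee_fin prodr_ge0.
- by rewrite lee_fin.
apply: eq_integral => y _; rewrite big_ord_recl cons_rV0/= EFinM; congr (_ * (_)%:E)%E.
by apply: eq_bigr => j _; rewrite cons_rVS.
Qed.

(** The coordinate [i] is integrated first. The contribution of the other coordinates to [dot rho w]
    is then a constant, which is why the bound on the slices has to be uniform in [c]. *)
Lemma integral_slice_le n (i : 'I_n) (rho : 'rV[R]_n) (f : 'I_n -> R -> R)
    (h : R -> R) (B : \bar R) :
  (forall j, measurable_fun setT (f j)) -> (forall j x, 0 <= f j x) ->
  measurable_fun setT h -> (forall x, 0 <= h x) -> (0 <= B)%E ->
  (forall c, \int[mu]_x (h (c + rho 0 i * x) * f i x)%:E <= B)%E ->
  forall c, (\int[leb n]_w (h (c + dot rho w) * \prod_j f j (w 0 j))%:E <=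
   B * \prod_(j | j != i) \int[mu]_x (f j x)%:E)%E.
Proof.
move=> mf f0 mh h0 B0.
elim: n i rho f mf f0 => [[]//|n IH] i rho f mf f0 hB c.
have mhd m (r : 'rV[R]_m) c' : measurable_fun setT (fun w => h (c' + dot r w)).
  by apply: measurableT_comp => //; apply: measurable_funD => //; exact: measurable_dot.
have mF : measurable_fun setT (fun w : 'rV[R]_n.+1 => (h (c + dot rho w) * \prod_j f j (w 0 j))%:E).
  apply/measurable_EFinP; apply: measurable_funM; first exact: mhd.
  exact: measurable_prod_coord.
have F0 (w : 'rV[R]_n.+1) : (0 <= (h (c + dot rho w) * \prod_j f j (w 0 j))%:E)%E.
  by rewrite lee_fin mulr_ge0// prodr_ge0.
have ge0I j : (0 <= \int[mu]_x (f j x)%:E)%E.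
  by apply: integral_ge0 => x _; rewrite lee_fin.
have FE x y : h (c + dot rho (cons_rV (x, y))) * \prod_j f j (cons_rV (x, y) 0 j) =
    f ord0 x * (h ((c + rho 0 0 * x) + dot (uncons_rV rho).2 y) * \prod_j f (lift ord0 j) (y 0 j)).
  rewrite dot_cons addrA big_ord_recl cons_rV0/= mulrCA; congr (_ * (_ * _)).
  by apply: eq_bigr => j _; rewrite cons_rVS.
pose f' (j : 'I_n) := f (lift ord0 j).
have mf' j : measurable_fun setT (f' j) by exact: mf.
have mp : measurable_fun setT (fun w : 'rV[R]_n => \prod_j f' j (w 0 j)).
  exact: measurable_prod_coord.
have [j ij|i0] := unliftP ord0 i.
  rewrite ge0_integral_lebesgue_rVS//.
  rewrite big_mkcond big_ord_recl ij /= -big_mkcond/=.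
  have -> : (\prod_(k < n | lift ord0 k != lift ord0 j) \int[mu]_x (f (lift ord0 k) x)%:E =
      \prod_(k < n | k != j) \int[mu]_x (f' k x)%:E)%E.
    by apply: eq_bigl => k; rewrite (inj_eq lift_inj).
  have prod0 : (0 <= \prod_(k < n | k != j) \int[mu]_x (f' k x)%:E)%E.
    by apply: prode_ge0 => k _; exact: ge0I.
  rewrite muleCA muleC -ge0_integralZl//=; last 3 first.
  - by apply/measurable_EFinP; exact: mf.
  - by move=> x _; rewrite lee_fin.
  - by rewrite mule_ge0.
  apply: ge0_le_integral => //=.
  - by move=> x _; apply: integral_ge0 => y _; exact: F0.
  - exact: (measurable_integral_cons_l mF).
  - by apply: emeasurable_funM => //; apply/measurable_EFinP; exact: mf.
  - move=> x _; under eq_integral do rewrite FE EFinM.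
    rewrite ge0_integralZl//=; last 3 first.
    + by apply/measurable_EFinP; apply: measurable_funM; [exact: mhd|exact: mp].
    + by move=> y _; rewrite lee_fin mulr_ge0// prodr_ge0.
    + by rewrite lee_fin.
    rewrite [leRHS]muleC; apply: lee_wpmul2l; first by rewrite lee_fin.
    apply: (IH j (uncons_rV rho).2 f' mf') => [k y|c']; first exact: f0.
    by rewrite mxE /f' -ij; exact: hB.
rewrite ge0_integral_lebesgue_rVS_swap//.
rewrite i0 big_mkcond big_ord_recl /= mul1e -(integral_prod_rV mf')//; last by move=> k x; exact: f0.
rewrite -ge0_integralZl//=; last 2 first.
- by apply/measurable_EFinP.
- by move=> y _; rewrite lee_fin prodr_ge0// => k _; exact: f0.
apply: ge0_le_integral => //=.
- by move=> x _; apply: integral_ge0 => y _; exact: F0.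
- exact: (measurable_integral_cons_r mF).
- by apply: emeasurable_funM => //; apply/measurable_EFinP.
move=> y _.
rewrite (_ : (fun x => _) = fun x : R => ((\prod_j f' j (y 0 j))%:E *
  (h ((c + dot (uncons_rV rho).2 y) + rho 0 0 * x) * f ord0 x)%:E)%E); last first.
  by apply/funext => x; rewrite FE -EFinM; congr EFin; rewrite /f' [c + _ + _]addrAC; ring.
rewrite ge0_integralZl//=; last 3 first.
- apply/measurable_EFinP; apply: measurable_funM; last exact: mf.
  by apply: measurableT_comp => //; apply: measurable_funD => //; exact: measurable_funM.
- by move=> x _; rewrite lee_fin mulr_ge0.
- by rewrite lee_fin prodr_ge0// => k _; exact: f0.
rewrite [leRHS]muleC; apply: lee_wpmul2l; last first.
  by have := hB (c + dot (uncons_rV rho).2 y); rewrite i0.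
by rewrite lee_fin prodr_ge0// => k _; exact: f0.
Qed.

End lebesgue_rV_integral.

Section lebesgue_rV_scaling.
Context (R : realType).
Local Notation mu := (@lebesgue_measure R).
Local Notation leb := (lebesgue_rV R).

Lemma measurable_scale_rV n (s : R) : measurable_fun setT (fun w : 'rV[R]_n => s *: w).
Proof.
apply: measurable_fun_rV => i.
rewrite (_ : (fun _ => _) = fun w : 'rV[R]_n => s * w 0 i).
  by apply: measurable_funM => //; exact: measurable_coord_rV.
by apply/funext => w; rewrite mxE.
Qed.

Lemma measurable_cons_r n (x : R) : measurable_fun setT (fun y : 'rV[R]_n => cons_rV (x, y)).
Proof.
apply: measurable_fun_rV => i; have [j ->|->] := unliftP ord0 i.
  rewrite (_ : (fun _ => _) = fun y : 'rV[R]_n => y 0 j).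
    exact: measurable_coord_rV.
  by apply/funext => w; rewrite cons_rVS.
by rewrite (_ : (fun _ => _) = cst x)//; apply/funext => w; rewrite cons_rV0.
Qed.

Lemma ge0_integral_rV_scale n (s : R) (f : 'rV[R]_n -> \bar R) : 0 < s ->
  measurable_fun setT f -> (forall x, (0 <= f x)%E) ->
  (\int[leb n]_w f (s *: w)%R = (s ^- n)%:E * \int[leb n]_w f w)%E.
Proof.
move=> s0; elim: n f => [|n IH] f mf f0.
  by rewrite !integral_lebesgue_rV0 scaler0 expr0 invr1 mul1e.
rewrite !ge0_integral_lebesgue_rVS//; last first.
  by apply: measurableT_comp => //; exact: measurable_scale_rV.
have consZ x y : s *: cons_rV (x, y) = cons_rV (s * x, s *: y) :> 'rV[R]_n.+1.
  apply/rowP => i; rewrite !mxE; case: unliftP => [j _|_] /=; by rewrite ?mxE.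
under eq_integral => x _.
  under eq_integral do rewrite consZ.
  rewrite (IH (fun y => f (cons_rV (s * x, y))))//; last first.
    by apply: measurableT_comp => //; exact: measurable_cons_r.
  over.
rewrite ge0_integralZl//=; last 3 first.
- apply: (@measurableT_comp _ _ _ _ (measurableTypeR R) _ (fun x : measurableTypeR R => \int[leb n]_x0 f (cons_rV (x, x0)))%E _ (fun x : measurableTypeR R => s * x : measurableTypeR R)).
    exact: measurable_integral_cons_l.
  exact: measurable_funM.
- by move=> x _; apply: integral_ge0.
- by rewrite lee_fin invr_ge0 exprn_ge0// ltW.
under [in LHS]eq_integral do rewrite -[s * _]addr0.
rewrite (@ge0_integral_affine _ s 0 (fun x => \int[leb n]_y f (cons_rV (x, y)))%E)//.
- by rewrite muleA -EFinM -invfM -exprSr.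
- exact: measurable_integral_cons_l.
- by move=> x; apply: integral_ge0.
Qed.

Lemma ae_coord_neq0 n : \forall w \ae leb n, forall j, (w : 'rV[R]_n) 0 j != 0.
Proof.
apply: filter_forall => j.
exists [set w : 'rV[R]_n | forall k, (if k == j then [set 0] else setT) (w 0 k)]; split.
- rewrite (_ : [set _ | _] = (fun w : 'rV[R]_n => w 0 j) @^-1` [set 0]).
    by rewrite -[X in measurable X]setTI; exact: measurable_coord_rV.
  apply/seteqP; split => w /=; first by move=> /(_ j); rewrite eqxx.
  by move=> w0 k; case: eqP => // ->.
- rewrite (@lebesgue_rV_box R n (fun k => if k == j then [set 0] else setT)).
    rewrite (bigD1 j)//= eqxx lebesgue_measure_set1 mul0e//.
  by move=> i; case: ifP.
- by move=> w /= /negP; rewrite negbK => /eqP w0 k; case: eqP => // ->.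
Qed.

Lemma measurable_enorm n : measurable_fun setT (@enorm R n).
Proof.
apply: (@measurableT_comp _ _ _ _ _ _ (@Num.sqrt R)).
  by apply: continuous_measurable_fun; exact: sqrt_continuous.
by apply: measurable_sum => j; apply: measurable_funM; exact: measurable_coord_rV.
Qed.

(** A product of one-dimensional weights stands in for polar coordinates. *)
Lemma integrable_decay_prod n (f : 'rV[R]_n -> R) (a : 'I_n -> R) (b C : R) :
  measurable_fun setT f -> (forall j, 0 <= a j < 1) -> 1 < b -> 0 <= C ->
  (forall w : 'rV[R]_n, (forall j, w 0 j != 0) -> `|f w| <= C * \prod_j decay (a j) b (w 0 j)) ->
  (leb n).-integrable setT (EFin \o f).
Proof.
move=> mf a01 b1 C0 fb.
have md j : measurable_fun setT (decay (a j) b) by exact: measurable_decay.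
apply/integrableP; split; first exact/measurable_EFinP.
apply: (@le_lt_trans _ _ (\int[leb n]_w (C * \prod_j decay (a j) b (w 0 j))%:E)%E).
  apply: ae_ge0_le_integral => //.
  - by apply/measurable_EFinP; apply: measurableT_comp.
  - by move=> w _; rewrite lee_fin mulr_ge0// prodr_ge0// => j _; exact: decay_ge0.
  - apply/measurable_EFinP; apply: measurable_funM => //.
    exact: (measurable_prod_coord md).
  - have := @ae_coord_neq0 n; apply: filterS => w w0 _.
    by rewrite /= lee_fin; exact: fb.
under eq_integral do rewrite EFinM.
rewrite ge0_integralZl//=; last 2 first.
- by apply/measurable_EFinP; exact: (measurable_prod_coord md).
- by move=> w _; rewrite lee_fin prodr_ge0// => j _; exact: decay_ge0.
rewrite (integral_prod_rV md (fun j => decay_ge0 (a j) b)).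
have fin j : (\int[mu]_x (decay (a j) b x)%:E)%E \is a fin_num.
  rewrite ge0_fin_numE; first by have /andP[a0 a1] := a01 j; exact: integral_decay_lty.
  by apply: integral_ge0 => x _; rewrite lee_fin decay_ge0.
by rewrite ltey_eq fin_numM// prode_fin_num.
Qed.

Lemma prod_decay_enorm_le n (a : 'I_n -> R) b (w : 'rV[R]_n) :
  (forall j, 0 <= a j) -> 0 <= b -> (forall j, w 0 j != 0) ->
  \prod_j decay (a j) b (enorm w) <= \prod_j decay (a j) b (w 0 j).
Proof.
move=> a0 b0 w0; apply: ler_prod => j _; rewrite decay_ge0/=.
apply: decay_nonincr => //; first by rewrite normr_gt0.
by rewrite [leRHS]ger0_norm ?enorm_ge0//; exact: normr_coord_le_enorm.
Qed.

End lebesgue_rV_scaling.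

(** * Trigonometric polynomials against decaying weights *)

Section periodic_bound.
Context (R : realType).
Local Notation mu := (@lebesgue_measure R).

(** The squared modulus of the trigonometric polynomial with coefficients [v]. *)
Definition trig_sq n (v : 'I_n -> R) (y : R) : R :=
  (\sum_k v k * cos (k%:R * y)) ^+ 2 + (\sum_k v k * sin (k%:R * y)) ^+ 2.

Lemma trig_sq_ge0 n (v : 'I_n -> R) y : 0 <= trig_sq v y.
Proof. by rewrite addr_ge0// sqr_ge0. Qed.

Lemma measurable_trig_sq n (v : 'I_n -> R) : measurable_fun setT (trig_sq v).
Proof.
apply: measurable_funD; apply: measurable_funX; apply: measurable_sum => k;
  apply: measurable_funM => //; [exact: measurable_cosM|exact: measurable_sinM].
Qed.

Lemma trig_sqE n (v : 'I_n -> R) y :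
  trig_sq v y = \sum_j \sum_k v j * v k * cos ((j%:R - k%:R) * y).
Proof.
rewrite /trig_sq !expr2 !big_distrlr/= -big_split/=; apply: eq_bigr => j _.
rewrite -big_split/=; apply: eq_bigr => k _.
rewrite mulrBl cosB; ring.
Qed.

Lemma trig_sq_opp n (v : 'I_n -> R) y : trig_sq v (- y) = trig_sq v y.
Proof.
by rewrite !trig_sqE; apply: eq_bigr => j _; apply: eq_bigr => k _; rewrite mulrN cosN.
Qed.

Lemma integral_cos_period (m : R) (c k : R) : 0 < k -> m != 0 ->
  sin (m * (c + k * (2 * pi / k))) = sin (m * c) ->
  (\int[mu]_(y in `[0%R, (2 * pi / k)%R]) (cos (m * (c + k * y)))%:E = 0)%E.
Proof.
move=> k0 m0 per.
have P0 : 0 < 2 * pi / k by rewrite divr_gt0// mulr_gt0// pi_gt0.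
have der (y : R) : is_derive y 1 (fun y : R => (m * k)^-1 * sin (m * (c + k * y))) (cos (m * (c + k * y))).
  apply: is_derive_eq; rewrite /GRing.scale/=; field.
  by rewrite m0 gt_eqF.
have cf : continuous (fun y : R => (m * k)^-1 * sin (m * (c + k * y))).
  by move=> y; apply: differentiable_continuous; apply/derivable1_diffP; have [] := der y.
have cc : continuous (fun y : R => cos (m * (c + k * y))).
  move=> y; apply: continuous_comp; last exact: continuous_cos.
  by apply: cvgM; [exact: cvg_cst|apply: cvgD; [exact: cvg_cst|apply: cvgM; [exact: cvg_cst|exact: cvg_id]]].
rewrite (@continuous_FTC2 _ _ (fun y => (m * k)^-1 * sin (m * (c + k * y))))//.
- by rewrite per mulr0 addr0 subee.
- by apply: continuous_subspaceT.
- split; first by move=> y _; have [] := der y.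
  + by apply: cvg_at_right_filter; exact: cf.
  + by apply: cvg_at_left_filter; exact: cf.
- by move=> y _; rewrite derive1E; have := der y => h; rewrite derive_val.
Qed.

Lemma sin_natB_period (j k : nat) (x : R) :
  sin ((j%:R - k%:R) * (x + 2 * pi)) = sin ((j%:R - k%:R) * x).
Proof.
have hp (n : nat) a : sin (n%:R * (2 * pi) + a) = sin a :> R.
  have -> : n%:R * (2 * pi) = pi *+ 2 *+ n :> R.
    by rewrite -[in RHS]mulr_natr -[pi *+ 2]mulr_natl; ring.
  by rewrite addrC (periodicn (@sinD2pi R)).
case: (leqP k j) => jk.
  by rewrite -natrB// mulrDr addrC hp.
rewrite -opprB -natrB ?(ltnW jk)// !mulNr !sinN mulrDr; congr (- _).
by rewrite addrC hp.
Qed.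

Lemma integral_trig_sq_period n (v : 'I_n -> R) (c k : R) : 0 < k ->
  (\int[mu]_(y in `[0%R, (2 * pi / k)%R]) (trig_sq v (c + k * y))%:E =
   (2 * pi / k * \sum_j v j ^+ 2)%:E)%E.
Proof.
move=> k0.
have P0 : 0 < 2 * pi / k by rewrite divr_gt0// mulr_gt0// pi_gt0.
pose I := `[0%R, (2 * pi / k)%R]%classic : set R.
have icos m : mu.-integrable I (EFin \o (fun y => cos (m * (c + k * y)))).
  apply: continuous_compact_integrable; first exact: segment_compact.
  apply: continuous_subspaceT => y; apply: continuous_comp; last exact: continuous_cos.
  by apply: cvgM; [exact: cvg_cst|apply: cvgD; [exact: cvg_cst|apply: cvgM; [exact: cvg_cst|exact: cvg_id]]].
have mI : measurable (I : set (measurableTypeR R)) by exact: measurable_itv.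
have icos' j l : mu.-integrable I (EFin \o (fun y => v j * v l * cos ((j%:R - l%:R) * (c + k * y)))).
  by have := integrableZl mI (v j * v l) (icos (j%:R - l%:R)); exact: eq_integrable.
have E0 j l : \int[mu]_(y in I) (v j * v l * cos ((j%:R - l%:R) * (c + k * y))) =
    if j == l then v j ^+ 2 * (2 * pi / k) else 0.
  rewrite (@RintegralZl _ (measurableTypeR R) _ mu I _ _ mI (icos (j%:R - l%:R))).
  case: eqP => [->|/eqP jl].
    rewrite -expr2; congr (_ * _); rewrite subrr; under eq_Rintegral do rewrite mul0r cos0.
    have muI : mu I = (2 * pi / k)%:E by rewrite /I lebesgue_measure_itv/= lte_fin P0 oppr0 adde0.
    by rewrite Rintegral_cst// mul1r -[RHS]/(fine (2 * pi / k)%:E) -muI.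
  rewrite /Rintegral integral_cos_period ?mulr0//; first by rewrite subr_eq0 eqr_nat.
  rewrite (_ : c + _ = c + 2 * pi) ?sin_natB_period//.
  by field; rewrite gt_eqF.
have ij j : mu.-integrable I (EFin \o (fun y => \sum_l v j * v l * cos ((j%:R - l%:R) * (c + k * y)))).
  exact: (integrable_Rsum mI).
rewrite -/I; under eq_integral do rewrite trig_sqE.
rewrite integral_EFinE//; last exact: (integrable_Rsum mI).
congr EFin; rewrite (Rintegral_sum mI)//.
rewrite mulr_sumr; apply: eq_bigr => j _; rewrite (Rintegral_sum mI)//.
under eq_bigr do rewrite E0.
rewrite (bigD1 j)//= eqxx big1 ?addr0 1?mulrC// => l; by rewrite eq_sym => /negbTE ->.
Qed.

(** A positive weight of the same decay as [decay 0 b] that changes by at most a constant factor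
    when translated by a bounded amount. *)
Definition hat_decay (b x : R) : R := (1 + `|x|) `^ (- b).

Lemma measurable_hat_decay b : measurable_fun setT (hat_decay b).
Proof.
by apply: (measurableT_comp (measurable_powR _)); apply: measurable_funD.
Qed.

Lemma hat_decay_ge0 b x : 0 <= hat_decay b x. Proof. exact: powR_ge0. Qed.

Lemma ler_powR2l (b x y : R) : 0 <= b -> 0 <= x -> x <= y -> x `^ b <= y `^ b.
Proof.
by move=> b0 x0 xy; apply: ge0_ler_powR => //; rewrite nnegrE// (le_trans x0).
Qed.

Lemma hat_decay_shift (b P x y : R) : 0 <= b -> 0 <= y <= P ->
  hat_decay b (x + y) <= (1 + P) `^ b * hat_decay b x.
Proof.
move=> b0 /andP[y0 yP].
have x1 : 0 < 1 + `|x| by rewrite ltr_pwDl.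
have xy1 : 0 < 1 + `|x + y| by rewrite ltr_pwDl.
have P1 : 0 < 1 + P by rewrite ltr_pwDl// (le_trans y0).
rewrite /hat_decay !powRN ler_pdivlMr ?powR_gt0// mulrC ler_pdivrMr ?powR_gt0//.
rewrite -powRM; [|exact: ltW|exact: ltW]; apply: ler_powR2l => //.
have h1 : `|x| <= `|x + y| + y.
  by rewrite -[X in _ <= _ + X]ger0_norm// -[X in `|X| <= _](addrK y); apply: le_trans (ler_normB _ _) _.
have := normr_ge0 (x + y); nra.
Qed.

Lemma decay0_le_hat (b x : R) : 0 <= b -> decay 0 b x <= 2 `^ b * hat_decay b x.
Proof.
move=> b0; have x1 : 0 < 1 + `|x| by rewrite ltr_pwDl.
rewrite /hat_decay powRN ler_pdivlMr ?powR_gt0// /decay oppr0 powRr0.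
case: (leP `|x| 1) => hx.
  apply: (@le_trans _ _ (1 * (1 + `|x|) `^ b)).
    by apply: ler_wpM2r; [exact: powR_ge0|rewrite ge_min lexx].
  by rewrite mul1r; apply: ler_powR2l => //; lra.
have x0 : 0 < `|x| by exact: lt_trans hx.
apply: (@le_trans _ _ (`|x| `^ (- b) * (1 + `|x|) `^ b)).
  by apply: ler_wpM2r; [exact: powR_ge0|rewrite ge_min lexx orbT].
rewrite powRN mulrC ler_pdivrMr ?powR_gt0// -powRM; [|lra|lra].
by apply: ler_powR2l => //; lra.
Qed.

Lemma integral_hat_decay_lty (b : R) : 1 < b -> (\int[mu]_x (hat_decay b x)%:E < +oo)%E.
Proof.
move=> b1; apply: (@le_lt_trans _ _ (\int[mu]_x (decay 0 b x)%:E)%E); last exact: integral_decay_lty.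
have b0 : 0 <= b by lra.
apply: ae_ge0_le_integral => //.
- by move=> x _; rewrite lee_fin hat_decay_ge0.
- by apply/measurable_EFinP; exact: measurable_hat_decay.
- by move=> x _; rewrite lee_fin decay_ge0.
- by apply/measurable_EFinP; exact: measurable_decay.
exists [set 0]; split => //; first exact: lebesgue_measure_set1.
move=> x /= /not_implyP[_ h]; apply/eqP; apply: contra_notT h => x0.
have x0' : 0 < `|x| by rewrite normr_gt0.
have x1 : 0 < 1 + `|x| by rewrite ltr_pwDl.
rewrite lee_fin /decay oppr0 powRr0 le_min /hat_decay; apply/andP; split.
  rewrite powRN invf_le1 ?powR_gt0//; apply: (@le_trans _ _ (1 `^ b)); first by rewrite powR1.
  by apply: ler_powR2l => //; lra.
by apply: powRN_nonincr => //; lra.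
Qed.

(** Averaging over the translations by less than a period replaces the periodic factor by its mean,
    which Parseval's identity computes. *)
Lemma integral_trig_sq_decay_le (k b : R) : 0 < k -> 1 < b ->
  exists2 B : R, 0 <= B & forall n (v : 'I_n -> R) c,
   (\int[mu]_x (trig_sq v (c + k * x) * decay 0 b x)%:E <= (B * \sum_j v j ^+ 2)%:E)%E.
Proof.
move=> k0 b1; have b0 : 0 <= b by lra.
set P := 2 * pi / k.
have P0 : 0 < P by rewrite /P divr_gt0// mulr_gt0// pi_gt0.
have hfin : (\int[mu]_x (hat_decay b x)%:E)%E \is a fin_num.
  by rewrite ge0_fin_numE ?integral_hat_decay_lty//; apply: integral_ge0 => x _; rewrite lee_fin hat_decay_ge0.
pose q := fine (\int[mu]_x (hat_decay b x)%:E)%E.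
have q0 : 0 <= q by apply/fine_ge0/integral_ge0 => x _; rewrite lee_fin hat_decay_ge0.
have mh := @measurable_hat_decay b.
exists (2 `^ b * ((1 + P) `^ b * q)); first by rewrite !mulr_ge0 ?powR_ge0.
move=> n v c; set S := \sum_j _.
have S0 : 0 <= S by apply: sumr_ge0 => j _; exact: sqr_ge0.
have maff e : measurable_fun setT (fun x : R => trig_sq v (e + k * x)).
  by apply: (measurableT_comp (measurable_trig_sq v)); apply: measurable_funD => //; apply: measurable_funM.
pose I (x : R) : \bar R := (trig_sq v (c + k * x) * hat_decay b x)%:E.
have mI : measurable_fun setT I by apply/measurable_EFinP; exact: (measurable_funM (maff c) mh).
have I0 x : (0 <= I x)%E by rewrite lee_fin mulr_ge0 ?trig_sq_ge0 ?hat_decay_ge0.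
suff key : (\int[mu]_x I x <= ((1 + P) `^ b * q * S)%:E)%E.
  apply: (@le_trans _ _ (\int[mu]_x ((2 `^ b)%:E * I x))%E).
    apply: ge0_le_integral => //=.
    - by move=> x _; rewrite lee_fin mulr_ge0 ?trig_sq_ge0 ?decay_ge0.
    - by apply/measurable_EFinP; apply: measurable_funM; [exact: maff|exact: measurable_decay].
    - exact: emeasurable_funM.
    - move=> x _; rewrite /I -EFinM lee_fin mulrCA ler_wpM2l ?trig_sq_ge0//.
      exact: decay0_le_hat.
  rewrite ge0_integralZl//= ?lee_fin ?powR_ge0// -mulrA EFinM lee_wpmul2l// lee_fin powR_ge0.
pose D := `[0%R, P]%classic : set (measurableTypeR R).
have mD : measurable D by exact: measurable_itv.
have muD : mu D = P%:E by rewrite /D lebesgue_measure_itv/= lte_fin P0 oppr0 adde0.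
pose c0 := (\int[mu]_x I x)%E.
have c00 : (0 <= c0)%E by apply: integral_ge0 => x _; exact: I0.
pose K := (1 + P) `^ b.
have K0 : 0 <= K by exact: powR_ge0.
pose J (z : measurableTypeR R * measurableTypeR R) : \bar R :=
  (\1_D z.1 * (trig_sq v ((c + k * z.2) + k * z.1) * (K * hat_decay b z.2)))%:E.
have J0 z : (0 <= J z)%E by rewrite lee_fin !mulr_ge0 ?trig_sq_ge0 ?hat_decay_ge0.
have mJ : measurable_fun setT J.
  apply/measurable_EFinP; apply: measurable_funM.
    by apply: (@measurableT_comp _ _ _ _ _ _ (\1_D : _ -> R)) => //; exact: measurable_indic.
  apply: measurable_funM; last first.
    by apply: measurable_funM => //; apply: (measurableT_comp mh).
  apply: (measurableT_comp (measurable_trig_sq v)).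
  by apply: measurable_funD; [apply: measurable_funD => //|]; apply: measurable_funM.
have shift y : D y -> (c0 <= \int[mu]_x J (y, x))%E.
  move=> Dy; have := Dy; rewrite /D/= in_itv/= => yP.
  have -> : (c0 = \int[mu]_x I (1 * x + y)%R)%E.
    by rewrite ge0_integral_affine// invr1 mul1e.
  apply: ge0_le_integral => //.
  - apply: (measurableT_comp mI); apply: measurable_funD => //; exact: measurable_funM.
  - by apply: (measurableT_comp mJ); exact: measurable_pair1.
  move=> x _; rewrite /I /J lee_fin indicE mem_set// !mul1r.
  rewrite (_ : c + k * (x + y) = c + k * x + k * y); last by ring.
  by rewrite ler_wpM2l ?trig_sq_ge0// hat_decay_shift.
rewrite -(@lee_pmul2l _ P%:E)//.
have -> : (P%:E * c0 = \int[mu]_y ((cst c0) \_ D) y)%E.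
  by rewrite -integral_mkcond integral_cst// muleC; congr (_ * _)%E; exact/esym/muD.
apply: (@le_trans _ _ (\int[mu]_y \int[mu]_x J (y, x))%E).
  apply: ge0_le_integral => //.
  - by move=> y _; rewrite patchE; case: ifP.
  - by apply/(measurable_restrictT _ _).1.
  - exact: (@measurable_fun_fubini_tonelli_F _ _ (measurableTypeR R) (measurableTypeR R) R mu J mJ).
  - move=> y _; rewrite patchE; case: ifPn => [/set_mem|_]; first exact: shift.
    by apply: integral_ge0.
rewrite (@fubini_tonelli _ _ (measurableTypeR R) (measurableTypeR R) R mu mu J mJ J0).
have -> : (\int[mu]_x \int[mu]_y J (y, x) = \int[mu]_x ((K * P * S)%:E * (hat_decay b x)%:E))%E.
  apply: eq_integral => x _.
  transitivity (\int[mu]_(y in D) ((K * hat_decay b x)%:E * (trig_sq v ((c + k * x) + k * y))%:E))%E.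
    rewrite [RHS]integral_mkcond; apply: eq_integral => y _.
    rewrite /J patchE indicE /=; case: ifP => yD; rewrite ?mul0r// mul1r -EFinM; congr EFin; ring.
  rewrite ge0_integralZl//; last 3 first.
  - by apply/measurable_EFinP; apply: measurable_funTS; exact: maff.
  - by move=> y _; rewrite lee_fin trig_sq_ge0.
  - by rewrite lee_fin mulr_ge0// hat_decay_ge0.
  by rewrite /D integral_trig_sq_period// -!EFinM; congr EFin; rewrite -/P -/S; ring.
rewrite ge0_integralZl//=; last 3 first.
- exact/measurable_EFinP.
- by move=> x _; rewrite lee_fin hat_decay_ge0.
- by rewrite lee_fin (mulr_ge0 (mulr_ge0 K0 (ltW P0)) S0).
by rewrite -[X in (_ * X)%E]fineK// -!EFinM lee_fin -/q -/K; lra.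
Qed.

End periodic_bound.

(** * The spectral weight of the second differences *)

Section elementary.
Context (R : realType).

Lemma normr_sin_le (x : R) : `|sin x| <= `|x|.
Proof.
wlog x0 : x / 0 < x.
  move=> H; have [x0|x0|->] := ltgtP x 0; last by rewrite sin0.
    by rewrite -normrN -sinN -[leRHS]normrN; apply: H; rewrite oppr_gt0.
  exact: H.
have [c _] := @MVT R sin cos 0 x x0 (fun z _ => is_derive_sin z) (continuous_subspaceT (@continuous_sin R)).
rewrite sin0 !subr0 => ->; rewrite normrM -[leRHS]mul1r ler_wpM2r//.
exact: cos_max.
Qed.

Lemma sin4_le1 (x : R) : 0 <= sin x ^+ 4 <= 1.
Proof.
rewrite exprn_even_ge0//= (le_trans (ler_norm _))// normrX exprn_ile1// sin_max.
Qed.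

Lemma powR_split (x a b : R) : 0 < x -> x `^ (a + b) = x `^ a * x `^ b.
Proof. by move=> x0; rewrite powRD//; apply/implyP => _; rewrite gt_eqF. Qed.

Lemma powR_le1_nonincr (x a b : R) : 0 < x -> x <= 1 -> a <= b -> x `^ b <= x `^ a.
Proof. move=> x0 x1 ab; rewrite -(subrKC a b) powR_split// ler_piMr ?powR_ge0//.
apply: (@le_trans _ _ (1 `^ (b - a))); last by rewrite powR1.
by apply: ler_powR2l => //; lra. Qed.

End elementary.

Section decay_rV.
Context (R : realType) (dim : nat).
Local Notation vec := 'rV[R]_dim.
Local Notation leb := (lebesgue_rV R dim).

Lemma decayE_le1 (a b r : R) : 0 < r -> r <= 1 -> a <= b -> decay a b r = r `^ (- a).
Proof.
move=> r0 r1 ab; rewrite /decay gtr0_norm// min_l//.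
by apply: powR_le1_nonincr => //; rewrite lerN2.
Qed.

Lemma decayE_ge1 (a b r : R) : 1 <= r -> a <= b -> decay a b r = r `^ (- b).
Proof.
move=> r1 ab; have r0 : 0 < r by exact: lt_le_trans r1.
rewrite /decay gtr0_norm// min_r//.
by apply: ler_powR => //; rewrite lerN2.
Qed.

Lemma enorm_gt0_coord (w : vec) : (0 < dim)%N -> (forall j, w 0 j != 0) -> 0 < enorm w.
Proof.
move=> d0 w0; apply: lt_le_trans (normr_coord_le_enorm w (Ordinal d0)).
by rewrite normr_gt0.
Qed.

(** Each coordinate receives an equal share of the two exponents. *)
Lemma integrable_enorm_powR (f : vec -> R) (k0 k1 C : R) : (0 < dim)%N ->
  measurable_fun setT f -> 0 <= k0 < dim%:R -> dim%:R < k1 -> 0 <= C ->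
  (forall w, 0 < enorm w -> `|f w| <= C * enorm w `^ (- k0)) ->
  (forall w, 0 < enorm w -> `|f w| <= C * enorm w `^ (- k1)) ->
  leb.-integrable setT (EFin \o f).
Proof.
move=> d0 mf /andP[k00 k0d] k1d C0 f0 f1.
have d0' : (0 : R) < dim%:R by rewrite ltr0n.
have kk : k0 <= k1 by apply: ltW; exact: lt_trans k1d.
apply: (@integrable_decay_prod _ _ f (fun=> k0 / dim%:R) (k1 / dim%:R) C mf) => //.
- by move=> _; rewrite divr_ge0 ?(ltW d0')//= ltr_pdivrMr// mul1r.
- by rewrite ltr_pdivlMr// mul1r.
move=> w w0; have r0 := enorm_gt0_coord d0 w0.
apply: (@le_trans _ _ (C * \prod_(j < dim) decay (k0 / dim%:R) (k1 / dim%:R) (enorm w))); last first.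
  rewrite ler_wpM2l//; apply: (@prod_decay_enorm_le _ _ (fun=> k0 / dim%:R)) => //.
    by move=> _; rewrite divr_ge0// ltW.
  by rewrite divr_ge0 ?ltW// (le_lt_trans k00)// (lt_trans k0d).
have powd k : (enorm w `^ (- (k / dim%:R))) ^+ dim = enorm w `^ (- k).
  by rewrite -powR_mulrn ?powR_ge0// -powRrM mulNr divfK// gt_eqF.
have kkd : k0 / dim%:R <= k1 / dim%:R by rewrite ler_pM2r// invr_gt0.
rewrite prodr_const card_ord; have [r1|r1] := leP (enorm w) 1.
  by rewrite decayE_le1// powd; exact: f0.
by rewrite decayE_ge1 ?(ltW r1)// powd; exact: f1.
Qed.

End decay_rV.

Section gsp.
Context (R : realType) (dim : nat) (beta : R) (rho : 'rV[R]_dim).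
Hypothesis hbeta : 0 < beta < Num.min 2 dim%:R.
Hypothesis hrho : enorm rho = 1.
Local Notation vec := 'rV[R]_dim.
Local Notation leb := (lebesgue_rV R dim).
Local Notation g := (g_sp beta rho).

Lemma beta_gt0 : 0 < beta. Proof. by case/andP: hbeta. Qed.
Lemma beta_lt2 : beta < 2.
Proof. by case/andP: hbeta => _; rewrite lt_min => /andP[]. Qed.
Lemma beta_ltd : beta < dim%:R.
Proof. by case/andP: hbeta => _; rewrite lt_min => /andP[]. Qed.
Lemma dim_gt0 : (0 < dim)%N.
Proof. by rewrite -(ltr0n R); exact: lt_trans beta_gt0 beta_ltd. Qed.
Lemma dimr_ge1 : 1 <= dim%:R :> R.
Proof. by rewrite ler1n dim_gt0. Qed.

Lemma sin4_rho_le (w : vec) : sin (dot rho w / 2) ^+ 4 <= enorm w ^+ 4.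
Proof.
have h : `|sin (dot rho w / 2)| <= enorm w.
  apply: le_trans (normr_sin_le _) _; rewrite normrM.
  have := dot_le_enorm rho w; rewrite hrho mul1r => h.
  by apply: le_trans h; rewrite ler_piMr// ger0_norm//; lra.
rewrite -[leLHS]ger0_norm; last by rewrite exprn_even_ge0.
by rewrite normrX lerXn2r// nnegrE enorm_ge0.
Qed.

Lemma measurable_sin_rho : measurable_fun setT (fun w : vec => sin (dot rho w / 2)).
Proof.
rewrite (_ : (fun w => _) = (fun y : R => sin (2^-1 * y)) \o dot rho).
  by apply: measurableT_comp; [exact: measurable_sinM|exact: measurable_dot].
by apply/funext => w /=; rewrite mulrC.
Qed.

Lemma measurable_g_sp : measurable_fun setT g.
Proof.
apply: measurable_funM; first by apply: measurable_funX; exact: measurable_sin_rho.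
by apply: (measurableT_comp (measurable_powR _)); exact: measurable_enorm.
Qed.

Lemma g_sp_ge0 w : 0 <= g w.
Proof. by rewrite mulr_ge0 ?powR_ge0// exprn_even_ge0. Qed.

Lemma g_sp_le_origin w : 0 < enorm w -> g w <= enorm w `^ (beta - dim%:R + 2).
Proof.
move=> r0; rewrite /g_sp.
have -> : beta - dim%:R + 2 = 4 + (beta - dim%:R - 2) by ring.
rewrite [leRHS]powR_split//; apply: ler_wpM2r; first exact: powR_ge0.
rewrite powR_mulrn ?enorm_ge0//.
exact: sin4_rho_le.
Qed.

Lemma g_sp_le_infinity w : g w <= enorm w `^ (beta - dim%:R - 2).
Proof. by rewrite /g_sp ler_piMl ?powR_ge0//; case/andP: (sin4_le1 (dot rho w / 2)). Qed.

(** The weight along the coordinate [i] has to be bounded, so the other coordinates share the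
    singularity at the origin: the order 1 - 1/dim of each is below 1, and their total (dim - 1)^2 /
    dim is at least dim - 2 - beta. *)
Lemma g_sp_le_prod (i : 'I_dim) (w : vec) : (forall j, w 0 j != 0) ->
  g w <= \prod_j decay (if j == i then 0 else 1 - dim%:R^-1) ((dim%:R + 2 - beta) / dim%:R) (w 0 j).
Proof.
move=> w0; have r0 := enorm_gt0_coord dim_gt0 w0.
have d1 := dimr_ge1; have b0 := beta_gt0; have b2 := beta_lt2.
have d0 : (0 : R) < dim%:R by exact: lt_le_trans d1.
set b := (_ / _); pose a (j : 'I_dim) : R := if j == i then 0 else 1 - dim%:R^-1.
have b1 : 1 < b by rewrite /b ltr_pdivlMr// mul1r; lra.
have id1 : dim%:R^-1 <= 1 :> R by rewrite invf_le1.
have id0 : 0 < dim%:R^-1 :> R by rewrite invr_gt0.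
have a01 j : 0 <= a j <= 1 by rewrite /a; case: ifP => _; apply/andP; split; lra.
apply: (@le_trans _ _ (\prod_j decay (a j) b (enorm w))); last first.
  apply: prod_decay_enorm_le => //; last by lra.
  by move=> j; case/andP: (a01 j).
have [r1|r1] := leP (enorm w) 1; last first.
  rewrite (eq_bigr (fun=> enorm w `^ (- b))); last first.
    by move=> j _; rewrite decayE_ge1 ?(ltW r1)//; case/andP: (a01 j) => _ h; lra.
  rewrite prodr_const card_ord -powR_mulrn ?powR_ge0// -powRrM.
  apply: le_trans (g_sp_le_infinity w) _; rewrite /b mulNr divfK ?gt_eqF//.
  by rewrite (_ : - (dim%:R + 2 - beta) = beta - dim%:R - 2)//; ring.
rewrite (eq_bigr (fun j => enorm w `^ (- a j))); last first.
  by move=> j _; rewrite decayE_le1//; case/andP: (a01 j) => _ h; lra.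
rewrite (bigD1 i)//= {1}/a eqxx oppr0 powRr0 mul1r.
rewrite (eq_bigr (fun=> enorm w `^ (- (1 - dim%:R^-1)))); last first.
  by move=> j /negbTE ji; rewrite /a ji.
rewrite prodr_const -powR_mulrn ?powR_ge0// -powRrM.
rewrite (_ : #|_| = dim.-1); last first.
  by rewrite -[dim in RHS]card_ord -(cardC1 i); apply: eq_card.
apply: le_trans (g_sp_le_origin r0) _; apply: powR_le1_nonincr => //.
have -> : (dim.-1)%:R = dim%:R - 1 :> R by rewrite -subn1 natrB ?dim_gt0.
have : dim%:R * dim%:R^-1 = 1 :> R by rewrite divff// gt_eqF.
nra.
Qed.

Lemma rho_neq0 : exists i, rho 0 i != 0.
Proof.
apply/existsP; rewrite -negb_forall; apply/negP => /forallP h.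
have : enorm rho = 0.
  rewrite /enorm /dot big1 ?sqrtr0// => j _; by move/eqP: (h j) => ->; rewrite mul0r.
by rewrite hrho => /eqP; rewrite oner_eq0.
Qed.

(** The coordinate [i] is one along which the phase [dot rho w] moves, so that the slices are
    integrals of a periodic function against a decaying weight. *)
Lemma integral_trig_sq_gsp : exists2 B : R, 0 < B & forall n (v : 'I_n -> R),
  (\int[leb]_w (trig_sq v (dot rho w) * g w)%:E <= (B * \sum_j v j ^+ 2)%:E)%E.
Proof.
have [i ri] := rho_neq0.
have d1 := dimr_ge1; have b0 := beta_gt0; have b2 := beta_lt2.
have d0 : (0 : R) < dim%:R by exact: lt_le_trans d1.
pose b : R := (dim%:R + 2 - beta) / dim%:R.
pose a (j : 'I_dim) : R := if j == i then 0 else 1 - dim%:R^-1.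
have b1 : 1 < b by rewrite /b ltr_pdivlMr// mul1r; lra.
have id1 : dim%:R^-1 <= 1 :> R by rewrite invf_le1.
have id0 : 0 < dim%:R^-1 :> R by rewrite invr_gt0.
have a01 j : 0 <= a j < 1 by rewrite /a; case: ifP => _; apply/andP; split; lra.
have ri0 : 0 < `|rho 0 i| by rewrite normr_gt0.
have [B B0 HB] := integral_trig_sq_decay_le ri0 b1.
have fin j : (\int[lebesgue_measure]_x (decay (a j) b x)%:E)%E \is a fin_num.
  rewrite ge0_fin_numE; first by have /andP[? ?] := a01 j; exact: integral_decay_lty.
  by apply: integral_ge0 => x _; rewrite lee_fin decay_ge0.
pose M := fine (\prod_(j | j != i) \int[lebesgue_measure]_x (decay (a j) b x)%:E)%E.
have Mfin : (\prod_(j | j != i) \int[lebesgue_measure]_x (decay (a j) b x)%:E)%E \is a fin_num.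
  by apply: prode_fin_num.
have M0 : 0 <= M.
  by apply/fine_ge0/prode_ge0 => j _; apply: integral_ge0 => x _; rewrite lee_fin decay_ge0.
exists (B * M + 1); first by rewrite ltr_wpDl// mulr_ge0.
move=> n v; have S0 : 0 <= \sum_j v j ^+ 2 by apply: sumr_ge0 => j _; exact: sqr_ge0.
have md j : measurable_fun setT (decay (a j) b) by exact: measurable_decay.
have mt : measurable_fun setT (fun w : vec => trig_sq v (dot rho w)).
  by apply: (measurableT_comp (measurable_trig_sq v)); exact: measurable_dot.
apply: (@le_trans _ _ (\int[leb]_w (trig_sq v (0 + dot rho w) * \prod_j decay (a j) b (w 0 j))%:E)%E).
  apply: ae_ge0_le_integral => //.
  - by move=> w _; rewrite lee_fin mulr_ge0 ?trig_sq_ge0 ?g_sp_ge0.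
  - by apply/measurable_EFinP; apply: measurable_funM => //; exact: measurable_g_sp.
  - by move=> w _; rewrite lee_fin mulr_ge0 ?trig_sq_ge0// prodr_ge0// => j _; exact: decay_ge0.
  - apply/measurable_EFinP; apply: measurable_funM; last exact: (measurable_prod_coord md).
    apply: (measurableT_comp (measurable_trig_sq v)); apply: measurable_funD => //; exact: measurable_dot.
  - have := @ae_coord_neq0 R dim; apply: filterS => w w0 _.
    by rewrite lee_fin add0r ler_wpM2l ?trig_sq_ge0//; exact: g_sp_le_prod.
apply: le_trans.
  apply: (@integral_slice_le _ _ i rho _ (trig_sq v) (B * \sum_j v j ^+ 2)%:E md (fun j => decay_ge0 (a j) b)
    (measurable_trig_sq v) (trig_sq_ge0 v)); first by rewrite lee_fin mulr_ge0.
  move=> c; rewrite /a eqxx; have [r0|r0] := ltP (rho 0 i) 0; last first.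
    by rewrite -(ger0_norm r0); exact: HB.
  under eq_integral => x _.
    rewrite -trig_sq_opp opprD -mulNr -(ltr0_norm r0); over.
  exact: HB.
rewrite -[X in (_ * X)%E]fineK// -/M -EFinM lee_fin mulrAC ler_wpM2r// lerDl//.
Qed.

Lemma integrable_g_sp : leb.-integrable setT (EFin \o g).
Proof.
have d1 := dimr_ge1; have b0 := beta_gt0; have b2 := beta_lt2.
apply: (@integrable_enorm_powR _ _ g (dim%:R - 1) (dim%:R + 2 - beta) 1 dim_gt0 measurable_g_sp) => //.
- by apply/andP; split; lra.
- lra.
- move=> w r0; rewrite mul1r ger0_norm ?g_sp_ge0//.
  have [r1|r1] := leP (enorm w) 1.
    by apply: le_trans (g_sp_le_origin r0) _; apply: powR_le1_nonincr => //; lra.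
  apply: le_trans (g_sp_le_infinity w) _; apply: ler_powR; [exact: ltW|lra].
- move=> w r0; rewrite mul1r ger0_norm ?g_sp_ge0//.
  by apply: le_trans (g_sp_le_infinity w) _; rewrite le_eqVlt; apply/orP; left; apply/eqP; congr (_ `^ _); ring.
Qed.

End gsp.

Section gsp_bessel.
Context (R : realType) (dim : nat) (beta : R) (rho : 'rV[R]_dim).
Hypothesis hbeta : 0 < beta < Num.min 2 dim%:R.
Hypothesis hrho : enorm rho = 1.
Local Notation vec := 'rV[R]_dim.
Local Notation leb := (lebesgue_rV R dim).
Local Notation g := (g_sp beta rho).

Lemma measurable_cos_rho (k : R) : measurable_fun setT (fun w : vec => cos (k * dot rho w)).
Proof.
by apply: (measurableT_comp (measurable_cosM k)); exact: measurable_dot.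
Qed.

Lemma integrable_gspM (phi : vec -> R) (M : R) : measurable_fun setT phi ->
  (forall w, `|phi w| <= M) -> leb.-integrable setT (EFin \o (fun w => phi w * g w)).
Proof.
move=> mphi phiM.
apply: (@integrable_bound _ _ _ _ _ _ (fun w => M * g w)) => //.
- by apply: measurable_funM => //; exact: measurable_g_sp.
- by move=> w _; rewrite normrM [X in _ * X]ger0_norm ?g_sp_ge0// ler_wpM2r// g_sp_ge0.
- by have := integrableZl measurableT M (integrable_g_sp hbeta hrho); exact: eq_integrable.
Qed.

Definition cos_moment (phi : vec -> R) (k : R) : R :=
  \int[leb]_w (cos (k * dot rho w) * (phi w * g w)).

Section weight.
Variables (phi : vec -> R) (M : R).
Hypothesis mphi : measurable_fun setT phi.
Hypothesis phiM : forall w, `|phi w| <= M.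

Lemma integrable_cos_moment k :
  leb.-integrable setT (EFin \o (fun w => cos (k * dot rho w) * (phi w * g w))).
Proof.
have M0 : 0 <= M by exact: le_trans (phiM 0).
have h : leb.-integrable setT (EFin \o (fun w => (cos (k * dot rho w) * phi w) * g w)).
  apply: (@integrable_gspM _ M).
    by apply: measurable_funM => //; exact: measurable_cos_rho.
  by move=> w; rewrite normrM -[M]mul1r ler_pM// cos_max.
by move: h; apply: eq_integrable => // w _ /=; congr EFin; rewrite -mulrA.
Qed.

Lemma integral_trig_sq_weight n (v : 'I_n -> R) :
  leb.-integrable setT (EFin \o (fun w => trig_sq v (dot rho w) * (phi w * g w))) /\
  \int[leb]_w (trig_sq v (dot rho w) * (phi w * g w)) =
  \sum_j \sum_k v j * v k * cos_moment phi (j%:R - k%:R).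
Proof.
have E w : trig_sq v (dot rho w) * (phi w * g w) =
    \sum_j \sum_k (v j * v k) * (cos ((j%:R - k%:R) * dot rho w) * (phi w * g w)).
  rewrite trig_sqE; move: (phi w * g w) => G; rewrite mulr_suml; apply: eq_bigr => j _.
  by rewrite mulr_suml; apply: eq_bigr => k _; rewrite mulrA.
have i1 j k : leb.-integrable setT (EFin \o
    (fun w => (v j * v k) * (cos ((j%:R - k%:R) * dot rho w) * (phi w * g w)))).
  by have := integrableZl measurableT (v j * v k) (integrable_cos_moment (j%:R - k%:R)); exact: eq_integrable.
have i2 j : leb.-integrable setT (EFin \o
    (fun w => \sum_k (v j * v k) * (cos ((j%:R - k%:R) * dot rho w) * (phi w * g w)))).
  exact: (integrable_Rsum measurableT).
split.
  have := @integrable_Rsum _ _ _ leb _ measurableT _ (index_enum 'I_n) _ i2.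
  by apply: eq_integrable => // w _ /=; rewrite E.
under eq_Rintegral do rewrite E.
rewrite (Rintegral_sum measurableT)//; apply: eq_bigr => j _.
rewrite (Rintegral_sum measurableT)//; apply: eq_bigr => k _.
by rewrite RintegralZl//; exact: integrable_cos_moment.
Qed.

End weight.

Lemma trig_sq_gsp_bound : exists2 B : R, 0 < B & forall n (v : 'I_n -> R),
  \int[leb]_w (trig_sq v (dot rho w) * g w) <= B * \sum_j v j ^+ 2.
Proof.
have [B B0 HB] := integral_trig_sq_gsp hbeta hrho.
exists B => // n v; rewrite -lee_fin -integral_EFinE//.
have [] := @integral_trig_sq_weight (fun=> 1) 1 (measurable_cst _) _ n v; first by rewrite normr1.
by move=> h _; move: h; apply: eq_integrable => // w _ /=; rewrite mul1r.
Qed.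

(** Dual to the hypothesis on [B]: the sum of the squared moments is the integral of [T * phi * g],
    where [T] is the trigonometric polynomial with the moments as coefficients, and [T * phi <= (B *
    phi ^+ 2 + T ^+ 2 / B) / 2]. *)
Lemma bessel_gsp (B : R) : 0 < B ->
  (forall n (v : 'I_n -> R), \int[leb]_w (trig_sq v (dot rho w) * g w) <= B * \sum_j v j ^+ 2) ->
  forall (phi : vec -> R) (M : R), measurable_fun setT phi -> (forall w, `|phi w| <= M) ->
  forall N, \sum_(k < N) cos_moment phi k%:R ^+ 2 <= B * \int[leb]_w (phi w ^+ 2 * g w).
Proof.
move=> B0 HB phi M mphi phiM N.
have M0 : 0 <= M by exact: le_trans (phiM 0).
pose a (k : 'I_N) := cos_moment phi k%:R.
set S := \sum_(k < N) _.
pose T w := \sum_(k < N) a k * cos (k%:R * dot rho w).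
have ia k : leb.-integrable setT (EFin \o (fun w => a k * (cos (k%:R * dot rho w) * (phi w * g w)))).
  by have := integrableZl measurableT (a k) (integrable_cos_moment mphi phiM k%:R); exact: eq_integrable.
have ST : S = \int[leb]_w (\sum_(k < N) a k * (cos (k%:R * dot rho w) * (phi w * g w))).
  rewrite (Rintegral_sum measurableT)//; apply: eq_bigr => k _.
  by rewrite RintegralZl//; exact: integrable_cos_moment mphi phiM _.
have [it _] := @integral_trig_sq_weight (fun=> 1) 1 (measurable_cst _) (fun=> ltac:(by rewrite normr1)) N a.
have it' : leb.-integrable setT (EFin \o (fun w => trig_sq a (dot rho w) * g w)).
  by move: it; apply: eq_integrable => // w _ /=; rewrite mul1r.
have i2 : leb.-integrable setT (EFin \o (fun w => phi w ^+ 2 * g w)).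
  apply: (@integrable_gspM _ (M ^+ 2)); first exact: measurable_funX.
  by move=> w; rewrite normrX lerXn2r// nnegrE.
have le : S <= \int[leb]_w (B / 2 * (phi w ^+ 2 * g w) + (B * 2)^-1 * (trig_sq a (dot rho w) * g w)).
  rewrite ST; apply: le_Rintegral => //.
  - exact: (integrable_Rsum measurableT).
  - have := integrableD measurableT (integrableZl measurableT (B / 2) i2) (integrableZl measurableT (B * 2)^-1 it').
    exact: eq_integrable.
  move=> w _.
  have -> : \sum_(k < N) a k * (cos (k%:R * dot rho w) * (phi w * g w)) = T w * phi w * g w.
    by rewrite /T !mulr_suml; apply: eq_bigr => k _; ring.
  have := g_sp_ge0 beta rho w; move: (g w) => G G0.
  rewrite [B / 2 * _]mulrA [(B * 2)^-1 * _]mulrA -mulrDl ler_wpM2r//.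
  have h1 : T w ^+ 2 <= trig_sq a (dot rho w) by rewrite /trig_sq lerDl sqr_ge0.
  have h2 : T w * phi w <= B / 2 * phi w ^+ 2 + (B * 2)^-1 * T w ^+ 2.
    rewrite -subr_ge0 (_ : _ - _ = (B * 2)^-1 * (B * phi w - T w) ^+ 2); last by field; rewrite gt_eqF.
    by rewrite mulr_ge0 ?sqr_ge0// invr_ge0 mulr_ge0 ?ltW.
  apply: le_trans h2 _; rewrite lerD2l ler_wpM2l// invr_ge0 mulr_ge0 ?ltW//.
have : S <= B / 2 * \int[leb]_w (phi w ^+ 2 * g w) + (B * 2)^-1 * (B * S).
  apply: le_trans le _; rewrite RintegralD//; last 2 first.
  - by have := integrableZl measurableT (B / 2) i2; exact: eq_integrable.
  - by have := integrableZl measurableT (B * 2)^-1 it'; exact: eq_integrable.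
  rewrite !RintegralZl// lerD2l ler_wpM2l//.
  by rewrite invr_ge0 mulr_ge0 ?ltW.
rewrite (_ : (B * 2)^-1 * (B * S) = S / 2); last by field; rewrite gt_eqF.
lra.
Qed.

End gsp_bessel.

(** * Oscillatory integrals against the spectral weight *)

Section Rintegral_rV_scaling.
Context (R : realType) (dim : nat).
Local Notation vec := 'rV[R]_dim.
Local Notation leb := (lebesgue_rV R dim).

Lemma Rintegral_rV_scale (s : R) (f : vec -> R) : 0 < s ->
  leb.-integrable setT (EFin \o f) ->
  \int[leb]_w f (s *: w) = s ^- dim * \int[leb]_w f w.
Proof.
move=> s0 fi; have mf : measurable_fun setT (EFin \o f) by case/integrableP: fi.
have pos (h : vec -> \bar R) : measurable_fun setT h -> (forall w, (0 <= h w)%E) ->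
   (\int[leb]_w h (s *: w)%R = (s ^- dim)%:E * \int[leb]_w h w)%E.
  by move=> mh h0; exact: ge0_integral_rV_scale.
have h1 := integrable_pos_fin_num measurableT fi.
have h2 := integrable_neg_fin_num measurableT fi.
have -> : \int[leb]_w f (s *: w) = fine ((s ^- dim)%:E * \int[leb]_w ((EFin \o f)^\+ w)
    - (s ^- dim)%:E * \int[leb]_w ((EFin \o f)^\- w))%E.
  rewrite /Rintegral integralE; congr (fine (_ - _)%E).
    rewrite -(pos _ (measurable_funepos mf) (fun w => funepos_ge0 _ w)).
    by apply: eq_integral => w _; rewrite !funeposE.
  rewrite -(pos _ (measurable_funeneg mf) (fun w => funeneg_ge0 _ w)).
  by apply: eq_integral => w _; rewrite !funenegE.
rewrite [in RHS]/Rintegral [in RHS]integralE.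
by rewrite -(fineK h1) -(fineK h2) -!EFinM -!EFinB /= -mulrBr.
Qed.

End Rintegral_rV_scaling.

Section oscillation.
Context (R : realType).
Local Notation mu := (@lebesgue_measure R).

Lemma normr_sin_min (p q s : R) : `|p| <= q -> 0 <= s <= 2 ->
  `|sin (s * (p / 2))| <= Num.min 1 q.
Proof.
move=> pq /andP[s0 s2]; rewrite le_min sin_max/=.
apply: le_trans (normr_sin_le _) _; apply: le_trans pq.
rewrite normrM (ger0_norm s0) normrM [`|2^-1|]ger0_norm//.
have := normr_ge0 p; nra.
Qed.

(** One integration by parts in [s] gains the factor [L^-1]. *)
Lemma integral_osc_le (p q L : R) : `|p| <= q -> 0 < q -> 0 < L ->
  `|\int[mu]_(s in `[1, 2]) (sin (s * (p / 2)) ^+ 4 * sin (L * s * q))| <= 4 / L * Num.min 1 q ^+ 3.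
Proof.
move=> pq q0 L0.
set m := Num.min 1 q.
have m0 : 0 < m by rewrite lt_min ltr01.
have mq : m <= q by rewrite ge_min lexx orbT.
pose K (s : R) := - (L * q)^-1 * (sin (s * (p / 2)) ^+ 4 * cos (L * s * q)).
pose rem (s : R) := 2 * p / (L * q) * (sin (s * (p / 2)) ^+ 3 * cos (s * (p / 2)) * cos (L * s * q)).
pose f (s : R) := sin (s * (p / 2)) ^+ 4 * sin (L * s * q).
have Lq0 : L * q != 0 by rewrite mulf_neq0 ?gt_eqF.
have Lqi0 : 0 <= (L * q)^-1 by rewrite invr_ge0 ltW// mulr_gt0.
have der (s : R) : is_derive s 1 K (f s - rem s).
  apply: is_derive_eq; rewrite /f /rem /GRing.scale/=; field.
  by rewrite !gt_eqF.
have clin (c : R) : continuous (fun s : R => s * c).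
  by move=> s; apply: cvgM; [exact: cvg_id|exact: cvg_cst].
have clin' : continuous (fun s : R => L * s * q).
  by move=> s; apply: cvgM; [apply: cvgM; [exact: cvg_cst|exact: cvg_id]|exact: cvg_cst].
have cs : continuous (fun s : R => sin (s * (p / 2))).
  by move=> s; apply: continuous_comp; [exact: clin|exact: continuous_sin].
have cc : continuous (fun s : R => cos (s * (p / 2))).
  by move=> s; apply: continuous_comp; [exact: clin|exact: continuous_cos].
have cs' : continuous (fun s : R => sin (L * s * q)).
  by move=> s; apply: continuous_comp; [exact: clin'|exact: continuous_sin].
have cc' : continuous (fun s : R => cos (L * s * q)).
  by move=> s; apply: continuous_comp; [exact: clin'|exact: continuous_cos].
have cX k : continuous (fun s : R => sin (s * (p / 2)) ^+ k).
  elim: k => [|k IH] s; first exact: cvg_cst.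
  rewrite (_ : (fun s => _) = fun s : R => sin (s * (p / 2)) * sin (s * (p / 2)) ^+ k).
    by apply: cvgM; [exact: cs|exact: IH].
  by apply/funext => s'; rewrite exprS.
have cf : continuous f by move=> s; apply: cvgM; [exact: cX|exact: cs'].
have cr : continuous rem.
  by move=> s; apply: cvgM; [exact: cvg_cst|apply: cvgM; [apply: cvgM; [exact: cX|exact: cc]|exact: cc']].
have cK : continuous K.
  by move=> s; apply: differentiable_continuous; apply/derivable1_diffP; have [] := der s.
pose I := `[1, 2]%classic : set (measurableTypeR R).
have mI : measurable I by exact: measurable_itv.
have int h : continuous h -> mu.-integrable I (EFin \o h).
  by move=> ch; apply: continuous_compact_integrable; [exact: segment_compact|exact: continuous_subspaceT].
have FTC : \int[mu]_(s in I) (f s - rem s) = K 2 - K 1.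
  rewrite /Rintegral (@continuous_FTC2 _ _ K)//; first by rewrite ltr1n.
  - by apply: continuous_subspaceT => s; apply: cvgB; [exact: cf|exact: cr].
  - split; first by move=> s _; have [] := der s.
    + by apply: cvg_at_right_filter; exact: cK.
    + by apply: cvg_at_left_filter; exact: cK.
  - by move=> s _; rewrite derive1E; have := der s => h; rewrite derive_val.
have -> : \int[mu]_(s in I) f s = (K 2 - K 1) + \int[mu]_(s in I) rem s.
  by rewrite -FTC RintegralB//; [ring|exact: int|exact: int].
have msin s : 0 <= s <= 2 -> `|sin (s * (p / 2))| <= m by exact: normr_sin_min.
have Kb s : 0 <= s <= 2 -> `|K s| <= (L * q)^-1 * (m ^+ 3 * q).
  move=> s02; rewrite normrM normrN (ger0_norm Lqi0).
  apply: (ler_wpM2l Lqi0); rewrite normrM -[leRHS]mulr1.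
  rewrite ler_pM ?normr_ge0 ?cos_max// normrX exprSr.
  rewrite ler_pM ?exprn_ge0//; last exact: le_trans (msin _ s02) mq.
  by rewrite lerXn2r ?nnegrE ?(ltW m0)//; exact: msin.
have rb s : I s -> `|rem s| <= 2 / L * m ^+ 3.
  rewrite /I/= in_itv/= => /andP[s1 s2].
  have s02 : 0 <= s <= 2 by rewrite s2 (le_trans ler01 s1).
  rewrite /rem normrM; apply: ler_pM => //.
    rewrite normrM normrM (ger0_norm Lqi0) ger0_norm// (_ : 2 / L = 2 * q * (L * q)^-1); last by field; rewrite !gt_eqF.
    by apply: (ler_wpM2r Lqi0); rewrite ler_pM2l.
  rewrite normrM -[leRHS]mulr1 ler_pM ?cos_max//.
  rewrite normrM -[leRHS]mulr1 ler_pM ?cos_max// normrX.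
  by rewrite lerXn2r ?nnegrE ?(ltW m0)//; exact: msin.
have Rb : `|\int[mu]_(s in I) rem s| <= 2 / L * m ^+ 3.
  apply: le_trans (le_normr_Rintegral mI (int _ cr)) _.
  have cn : continuous (fun s => `|rem s|).
    by move=> s; apply: (continuous_comp (cr s)); exact: norm_continuous.
  apply: (@le_trans _ _ (\int[mu]_(s in I) (2 / L * m ^+ 3))).
    by apply: (le_Rintegral mI (int _ cn)) => //; apply: int => s; exact: cvg_cst.
  have muI : mu I = 1%:E by rewrite /I lebesgue_measure_itv/= lte_fin ltr1n -EFinB; congr EFin; ring.
  rewrite Rintegral_cst// (_ : fine _ = 1) ?mulr1//.
  by rewrite -[RHS]/(fine 1%:E) -muI.
have K1 : `|K 1| <= (L * q)^-1 * (m ^+ 3 * q) by apply: Kb; rewrite ler01 ler1n.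
have K2 : `|K 2| <= (L * q)^-1 * (m ^+ 3 * q) by apply: Kb; rewrite lexx ler0n.
have Kq : (L * q)^-1 * (m ^+ 3 * q) = L^-1 * m ^+ 3 by field; rewrite !gt_eqF.
apply: le_trans (ler_normD _ _) _.
rewrite Kq in K1 K2.
have E4 : 4 / L * m ^+ 3 = L^-1 * m ^+ 3 + L^-1 * m ^+ 3 + 2 / L * m ^+ 3 by ring.
by rewrite E4; apply: lerD Rb; apply: le_trans (ler_normB _ _) _; exact: lerD.
Qed.

End oscillation.

Section gsp_bias.
Context (R : realType) (dim : nat) (beta : R) (rho : 'rV[R]_dim).
Hypothesis hbeta : 0 < beta < Num.min 2 dim%:R.
Hypothesis hrho : enorm rho = 1.
Local Notation vec := 'rV[R]_dim.
Local Notation leb := (lebesgue_rV R dim).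
Local Notation g := (g_sp beta rho).
Local Notation mu := (@lebesgue_measure R).

Definition sinc_w (L : R) (w : vec) : R := sin (L * enorm w) / (L * enorm w).

Let a : R := dim%:R + 3 - beta.
(** An integrable majorant of [f] at all the dilations between 1 and 2. *)
Let H (w : vec) : R := Num.min 1 (enorm w) ^+ 3 * enorm w `^ (- a).

Lemma measurable_sinc_w L : measurable_fun setT (sinc_w L).
Proof.
have me : measurable_fun setT (fun w : vec => L * enorm w).
  by apply: measurable_funM => //; exact: measurable_enorm.
apply: measurable_funM; last exact: (measurableT_comp (@measurable_invr R) me).
apply: (@measurableT_comp _ _ _ _ _ _ (@sin R) _ (fun w : vec => L * enorm w)) => //.
by apply: continuous_measurable_fun; exact: continuous_sin.
Qed.

Lemma sinc_w_le1 L w : `|sinc_w L w| <= 1.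
Proof.
rewrite /sinc_w normrM normfV; have [->|n0] := eqVneq (L * enorm w) 0.
  by rewrite normr0 invr0 mulr0.
by rewrite ler_pdivrMr ?normr_gt0// mul1r normr_sin_le.
Qed.

Lemma measurable_powR_enorm c : measurable_fun setT (fun w : vec => enorm w `^ c).
Proof. by apply: (measurableT_comp (measurable_powR _)); exact: measurable_enorm. Qed.

Let mH : measurable_fun setT H.
Proof.
apply: measurable_funM; last exact: measurable_powR_enorm.
by apply: measurable_funX; apply: measurable_minr => //; exact: measurable_enorm.
Qed.

Let m_ge0 (w : vec) : 0 <= Num.min 1 (enorm w).
Proof. by rewrite le_min ler01 enorm_ge0. Qed.

Let H_ge0 w : 0 <= H w.
Proof. by rewrite mulr_ge0 ?powR_ge0// exprn_ge0. Qed.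

Let integrable_H : leb.-integrable setT (EFin \o H).
Proof.
have d1 := dimr_ge1 hbeta; have b0 := beta_gt0 hbeta; have b2 := beta_lt2 hbeta.
have bd := beta_ltd hbeta.
have hi w : 0 < enorm w -> `|H w| <= 1 * enorm w `^ (- a).
  move=> r0; rewrite mul1r ger0_norm// /H ler_piMl ?powR_ge0//.
  by rewrite exprn_ile1// ge_min lexx.
apply: (@integrable_enorm_powR _ _ H (dim%:R - beta) a 1 (dim_gt0 hbeta) mH) => //.
- by apply/andP; split; lra.
- by rewrite /a; lra.
move=> w r0; have [r1|r1] := leP (enorm w) 1; last first.
  apply: le_trans (hi w r0) _; rewrite !mul1r; apply: ler_powR; [exact: ltW|rewrite /a; lra].
rewrite mul1r ger0_norm// /H min_r// -powR_mulrn ?enorm_ge0// -powR_split//.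
by rewrite le_eqVlt; apply/orP; left; apply/eqP; congr (_ `^ _); rewrite /a; ring.
Qed.

Let c : R := \int[mu]_(s in `[1, 2]) s `^ (a - dim%:R).

Let integrable_c : mu.-integrable `[1, 2] (EFin \o (fun s : R => s `^ (a - dim%:R))).
Proof.
apply: continuous_compact_integrable; first exact: segment_compact.
apply: continuous_in_subspaceT => z; rewrite inE/= in_itv/= => /andP[z1 _].
apply: differentiable_continuous; apply/derivable1_diffP.
by have [] := is_derive1_powR (a - dim%:R) (lt_le_trans ltr01 z1).
Qed.

Let c_ge1 : 1 <= c.
Proof.
have b2 := beta_lt2 hbeta.
pose I := `[1, 2]%classic : set (measurableTypeR R).
have mI : measurable I by exact: measurable_itv.
have muI : mu I = 1%:E by rewrite /I lebesgue_measure_itv/= lte_fin ltr1n -EFinB; congr EFin; ring.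
have -> : 1 = \int[mu]_(s in I) 1 :> R.
  by rewrite Rintegral_cst// mul1r -[LHS]/(fine 1%:E) -muI.
apply: (le_Rintegral mI _ integrable_c).
  apply: continuous_compact_integrable; first exact: segment_compact.
  by apply: continuous_subspaceT => s; exact: cvg_cst.
move=> s; rewrite /I/= in_itv/= => /andP[s1 _].
apply: (@le_trans _ _ (s `^ 0)); first by rewrite powRr0.
by apply: ler_powR => //; rewrite /a; lra.
Qed.

Let f (L : R) (w : vec) : R := sin (dot rho w / 2) ^+ 4 * (enorm w `^ (- a) * sin (L * enorm w)).

Let sin4_le_min (w : vec) (s : R) : 0 <= s <= 2 -> sin (s * (dot rho w / 2)) ^+ 4 <= Num.min 1 (enorm w) ^+ 3.
Proof.
move=> s02; have h : `|sin (s * (dot rho w / 2))| <= Num.min 1 (enorm w).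
  by apply: normr_sin_min => //; have := dot_le_enorm rho w; rewrite hrho mul1r.
rewrite -[leLHS]ger0_norm; last by rewrite exprn_even_ge0.
rewrite normrX exprSr -[leRHS]mulr1 ler_pM ?exprn_ge0 ?sin_max//.
by rewrite lerXn2r ?nnegrE.
Qed.

Let f_scale_le L s w : 0 <= s <= 2 ->
  `|sin (s * (dot rho w / 2)) ^+ 4 * (enorm w `^ (- a) * sin (L * s * enorm w))| <= H w.
Proof.
move=> s02; rewrite /H normrM (ger0_norm (_ : 0 <= sin _ ^+ 4)) ?exprn_even_ge0//.
rewrite ler_pM ?exprn_even_ge0//; first exact: sin4_le_min.
by rewrite normrM (ger0_norm (powR_ge0 _ _)) ler_piMr ?powR_ge0// sin_max.
Qed.

Let I : set (measurableTypeR R) := `[1, 2]%classic.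

Let F (L : R) (z : vec * measurableTypeR R) : R := \1_I z.2 *
  (sin (z.2 * (dot rho z.1 / 2)) ^+ 4 * (enorm z.1 `^ (- a) * sin (L * z.2 * enorm z.1))).

Let mF L : measurable_fun setT (F L).
Proof.
have msin : measurable_fun setT (@sin R) by apply: continuous_measurable_fun; exact: continuous_sin.
have m1 : measurable_fun setT (fun z : vec * measurableTypeR R => z.2 : R) by exact: measurable_snd.
have md : measurable_fun setT (fun z : vec * measurableTypeR R => dot rho z.1).
  by apply: (measurableT_comp (measurable_dot rho)).
have me : measurable_fun setT (fun z : vec * measurableTypeR R => enorm z.1).
  by apply: (measurableT_comp (@measurable_enorm R dim)).
apply: measurable_funM.
  by apply: (measurableT_comp _ m1); apply: measurable_indic; exact: measurable_itv.
apply: measurable_funM.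
  apply: measurable_funX; apply: (measurableT_comp msin); apply: measurable_funM => //.
  exact: measurable_funM.
apply: measurable_funM; first by apply: (measurableT_comp (measurable_powR_enorm (- a))).
apply: (measurableT_comp msin); apply: measurable_funM => //; exact: measurable_funM.
Qed.

Let mf L : measurable_fun setT (f L).
Proof.
have msin : measurable_fun setT (@sin R) by apply: continuous_measurable_fun; exact: continuous_sin.
apply: measurable_funM; first by apply: measurable_funX; exact: measurable_sin_rho.
apply: measurable_funM; first exact: measurable_powR_enorm.
by apply: (measurableT_comp msin); apply: measurable_funM => //; exact: measurable_enorm.
Qed.

Let integrable_f L : leb.-integrable setT (EFin \o f L).
Proof.
apply: (@integrable_bound _ _ _ _ _ _ H) => // w _.
by have := @f_scale_le L 1 w; rewrite mul1r mulr1; apply; rewrite ler01 ler1n.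
Qed.

Let F_le L w s : `|F L (w, s)| <= H w * \1_I s.
Proof.
rewrite /F/= indicE; case: (boolP (s \in I)) => [/set_mem sI|_]; last by rewrite mul0r normr0 mulr0.
rewrite mul1r mulr1; apply: f_scale_le.
by move: sI; rewrite /I/= in_itv/= => /andP[s1 ->]; rewrite (le_trans ler01 s1).
Qed.

Let f_scaled L s w : 0 < s ->
  sin (s * (dot rho w / 2)) ^+ 4 * (enorm w `^ (- a) * sin (L * s * enorm w)) = s `^ a * f L (s *: w).
Proof.
move=> s0; rewrite /f enormZ (gtr0_norm s0) powRM ?enorm_ge0// ?(ltW s0)//.
have -> : dot rho (s *: w) / 2 = s * (dot rho w / 2) by rewrite dotC dotZl dotC mulrA.
rewrite (powRN s a) (mulrA L s (enorm w)).
by field; rewrite gt_eqF// powR_gt0.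
Qed.

(** The function [f] is homogeneous up to the dilation of the two phases. Averaging over the
    dilations [s] between 1 and 2 makes the phase [L * s * enorm w] oscillate in the one variable
    [s]. *)
Let f_bound L : 0 < L -> `|\int[leb]_w f L w| <= 4 / L * \int[leb]_w H w.
Proof.
move=> L0.
have i1 : mu.-integrable setT (EFin \o (\1_I : measurableTypeR R -> R)) by exact: integrable_indic_itv.
have I0 s : 0 <= \1_I s :> R by [].
have Fub := @Rintegral_Fubini _ _ _ (measurableTypeR R) R leb mu (F L) H (\1_I) (mF L) (F_le L) H_ge0 I0 integrable_H i1.
have iF := @integrable_Rfubini _ _ _ (measurableTypeR R) R leb mu (F L) H (\1_I) (mF L) (F_le L) H_ge0 I0 integrable_H i1.
have lhs : \int[mu]_s \int[leb]_w F L (w, s) = c * \int[leb]_w f L w.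
  transitivity (\int[mu]_s (\1_I s * (s `^ (a - dim%:R) * \int[leb]_w f L w))).
    apply: eq_Rintegral => s _; rewrite /F/=.
    rewrite indicE; case: (boolP (s \in I)) => [/set_mem|_]; last first.
      under eq_Rintegral do rewrite mul0r.
      by rewrite Rintegral_cst// !mul0r.
    rewrite /I/= in_itv/= => /andP[s1 s2].
    have s0 : 0 < s by exact: lt_le_trans s1.
    under eq_Rintegral do rewrite mul1r f_scaled//.
    rewrite RintegralZl//; last first.
      apply: (@integrable_bound _ _ _ _ _ _ (fun w => s `^ (- a) * H w)) => //.
      - by apply: (measurableT_comp (mf L)); exact: measurable_scale_rV.
      - move=> w _.
        have -> : f L (s *: w) = s `^ (- a) * (s `^ a * f L (s *: w)).
          by rewrite mulrA powRN mulVf ?mul1r// gt_eqF// powR_gt0.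
        rewrite -f_scaled// normrM (ger0_norm (powR_ge0 _ _)).
        by apply: ler_wpM2l; [exact: powR_ge0|apply: f_scale_le; rewrite ltW].
      - by have := integrableZl measurableT (s `^ (- a)) integrable_H; exact: eq_integrable.
    rewrite Rintegral_rV_scale// mul1r mulrA; congr (_ * _).
    by rewrite powR_split// powRN powR_mulrn// ltW.
  by rewrite Rintegral_indicM RintegralZr//; exact: measurable_itv.
have Fb w : `|\int[mu]_s F L (w, s)| <= 4 / L * H w.
  have mI : measurable I by exact: measurable_itv.
  have -> : \int[mu]_s F L (w, s) = enorm w `^ (- a) *
      \int[mu]_(s in I) (sin (s * (dot rho w / 2)) ^+ 4 * sin (L * s * enorm w)).
    rewrite -(@RintegralZl _ _ _ mu I _ _ mI)//; last first.
      apply: (@integrable_bound _ _ _ _ _ _ (fun=> 1)) => //.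
      - have msin : measurable_fun setT (@sin R).
          by apply: continuous_measurable_fun; exact: continuous_sin.
        apply: measurable_funTS; apply: measurable_funM.
          by apply: measurable_funX; apply: (measurableT_comp msin); exact: measurable_funM.
        by apply: (measurableT_comp msin); apply: measurable_funM => //; exact: measurable_funM.
      - move=> s _; rewrite normrM -[leRHS]mulr1 ler_pM ?sin_max//.
        by rewrite normrX exprn_ile1// sin_max.
      - apply: continuous_compact_integrable; first exact: segment_compact.
        by apply: continuous_subspaceT => s; exact: cvg_cst.
    rewrite -[RHS]Rintegral_indicM; apply: eq_Rintegral => s _; rewrite /F/=; congr (_ * _); ring.
  rewrite normrM (ger0_norm (powR_ge0 _ _)) /H mulrA [leRHS]mulrC.
  apply: ler_wpM2l; first exact: powR_ge0.
  have [r0|r0] := ltP 0 (enorm w).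
    by apply: integral_osc_le => //; have := dot_le_enorm rho w; rewrite hrho mul1r.
  have -> : enorm w = 0 by apply/eqP; rewrite eq_le r0 enorm_ge0.
  under eq_Rintegral do rewrite mulr0 sin0 mulr0.
  by rewrite Rintegral_cst// mul0r normr0 mulr_ge0 ?divr_ge0 ?exprn_ge0 ?(ltW L0)// le_min ler01 lexx.
have iH : leb.-integrable setT (EFin \o (fun w => 4 / L * H w)).
  by have := integrableZl measurableT (4 / L) integrable_H; exact: eq_integrable.
rewrite -RintegralZl//.
apply: (@le_trans _ _ (c * `|\int[leb]_w f L w|)); first by rewrite ler_peMl.
have c0 : 0 <= c by exact: le_trans c_ge1.
rewrite -{1}(ger0_norm c0) -normrM -lhs -Fub.
apply: le_trans (le_normr_Rintegral measurableT iF) _.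
apply: le_Rintegral => //.
by have := integrable_norm iF; exact: eq_integrable.
Qed.

Let g_sinc L w : 0 < L -> sinc_w L w * g w = L^-1 * f L w.
Proof.
move=> L0; have [r0|r0] := ltP 0 (enorm w); last first.
  have w0 : enorm w = 0 by apply/eqP; rewrite eq_le r0 enorm_ge0.
  by rewrite /sinc_w /f w0 mulr0 sin0 !mulr0 !mul0r.
rewrite /sinc_w /g_sp /f.
have -> : - a = (beta - dim%:R - 2) + (- 1) by rewrite /a; ring.
rewrite (powR_split (beta - dim%:R - 2) (- 1) r0) powR_inv1 ?enorm_ge0//.
by field; rewrite !gt_eqF.
Qed.

(** One factor [L^-1] is the denominator of [sinc_w], the other comes from the oscillation of the
    sine. *)
Lemma sinc_bias : exists2 K : R, 0 <= K & forall L, 0 < L ->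
  `|\int[leb]_w (sinc_w L w * g w)| <= K / L ^+ 2.
Proof.
exists (4 * \int[leb]_w H w).
  by rewrite mulr_ge0//; apply: Rintegral_ge0.
move=> L L0; under eq_Rintegral do rewrite g_sinc//.
rewrite RintegralZl// normrM gtr0_norm ?invr_gt0//.
have -> : 4 * \int[leb]_w H w / L ^+ 2 = L^-1 * (4 / L * \int[leb]_w H w) by field; rewrite gt_eqF.
by rewrite ler_pM2l ?invr_gt0//; exact: f_bound.
Qed.

Lemma sinc_sqr : exists2 K : R, 0 <= K & forall L, 0 < L ->
  \int[leb]_w (sinc_w L w ^+ 2 * g w) <= K / L.
Proof.
exists (\int[leb]_w H w); first exact: Rintegral_ge0.
move=> L L0; rewrite mulrC -RintegralZl//; apply: le_Rintegral => //.
- apply: (@integrable_gspM _ _ _ _ hbeta hrho _ 1); first by apply: measurable_funX; exact: measurable_sinc_w.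
  by move=> w; rewrite normrX exprn_ile1// sinc_w_le1.
- by have := integrableZl measurableT (L^-1) integrable_H; exact: eq_integrable.
move=> w _; rewrite expr2 -mulrA g_sinc// mulrCA ler_wpM2l ?invr_ge0 ?(ltW L0)//.
apply: le_trans (ler_norm _) _; rewrite normrM -[leRHS]mul1r ler_pM ?sinc_w_le1//.
by have := @f_scale_le L 1 w; rewrite mul1r mulr1; apply; rewrite ler01 ler1n.
Qed.
End gsp_bias.

(** * Covariance of the second differences *)

Section wave_time_integral.
Context (R : realType) (dim : nat) (beta theta t : R).
Hypothesis hbeta : 0 < beta < Num.min 2 dim%:R.
Hypothesis htheta : 0 < theta.
Hypothesis ht : 0 < t.
Local Notation vec := 'rV[R]_dim.
Local Notation leb := (lebesgue_rV R dim).
Local Notation mu := (@lebesgue_measure R).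

Let I : set (measurableTypeR R) := `[0, t]%classic.

Let mI : measurable I. Proof. exact: measurable_itv. Qed.

Let sq0 : 0 < Num.sqrt theta. Proof. by rewrite sqrtr_gt0. Qed.

Lemma integral_wave_kernel_sqr (xi : vec) :
  \int[mu]_(r in I) (wave_kernel theta (t - r) xi * wave_kernel theta (t - r) xi) =
  t / (2 * theta) * (enorm xi) ^- 2 * (1 - sinc_w (2 * t * Num.sqrt theta) xi).
Proof.
rewrite /wave_kernel /sinc_w; set k := Num.sqrt theta * enorm xi.
have th : theta = Num.sqrt theta ^+ 2 by rewrite sqr_sqrtr// ltW.
have [e0|e0] := eqVneq (enorm xi) 0.
  have k0 : k = 0 by rewrite /k e0 mulr0.
  under eq_Rintegral do rewrite e0 mulr0 sin0 mul0r mulr0.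
  by rewrite Rintegral_cst// mul0r e0 expr0n/= invr0 mulr0 mul0r.
have k0 : k != 0 by rewrite mulf_neq0// gt_eqF.
pose K (r : R) : R := k ^- 2 * (r / 2 + sin (2 * (t - r) * k) / (4 * k)).
have der (r : R) : is_derive r 1 K ((sin ((t - r) * k) / k) ^+ 2).
  apply: is_derive_eq; rewrite /GRing.scale/=.
  have -> : 2 * (t - r) * k = (t - r) * k + (t - r) * k by ring.
  rewrite cosD; have := cos2Dsin2 ((t - r) * k) => h.
  have -> : cos ((t - r) * k) * cos ((t - r) * k) = 1 - sin ((t - r) * k) ^+ 2.
    by rewrite -expr2 -h addrK.
  by field.
have cK : continuous K.
  by move=> s; apply: differentiable_continuous; apply/derivable1_diffP; have [] := der s.
have -> : \int[mu]_(r in I) (sin ((t - r) * Num.sqrt theta * enorm xi) / k *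
    (sin ((t - r) * Num.sqrt theta * enorm xi) / k)) = K t - K 0.
  under eq_Rintegral do rewrite -expr2 -mulrA -/k.
  rewrite /Rintegral (@continuous_FTC2 _ _ K)//.
  - apply: continuous_subspaceT => r; apply: differentiable_continuous; apply/derivable1_diffP.
    by apply: ex_derive.
  - split; first by move=> s _; have [] := der s.
    + by apply: cvg_at_right_filter; exact: cK.
    + by apply: cvg_at_left_filter; exact: cK.
  - by move=> s _; rewrite derive1E; have := der s => h; rewrite derive_val.
rewrite /K subrr mulr0 mul0r sin0 subr0 mul0r.
have -> : 2 * t * Num.sqrt theta * enorm xi = 2 * t * k by rewrite /k mulrA.
have -> : 2 * theta = 2 * Num.sqrt theta ^+ 2 by rewrite -th.
rewrite /k; field.
by rewrite e0 !gt_eqF.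
Qed.

Lemma normr_wave_kernel_le (s : R) (xi : vec) : `|wave_kernel theta s xi| <= `|s|.
Proof.
rewrite /wave_kernel -mulrA; set k := Num.sqrt theta * enorm xi.
have [->|k0] := eqVneq k 0; first by rewrite invr0 mulr0 normr0.
by rewrite normrM normfV ler_pdivrMr ?normr_gt0// -normrM normr_sin_le.
Qed.

Lemma normr_wave_kernel_le_inv (s : R) (xi : vec) :
  `|wave_kernel theta s xi| <= (Num.sqrt theta * enorm xi)^-1.
Proof.
have i0 : 0 <= (Num.sqrt theta * enorm xi)^-1.
  by rewrite invr_ge0 mulr_ge0 ?enorm_ge0// ltW.
by rewrite /wave_kernel normrM (ger0_norm i0) ler_piMl// sin_max.
Qed.

(** The spectral density of [u t], up to the constant [t / (2 * theta)]. *)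
Definition spec (xi : vec) : R :=
  enorm xi `^ (beta - dim%:R - 2) * (1 - sinc_w (2 * t * Num.sqrt theta) xi).

Let Hc (xi : vec) : R :=
  Num.min (t ^+ 2) ((Num.sqrt theta * enorm xi) ^- 2) * enorm xi `^ (beta - dim%:R).

Let Hc_ge0 xi : 0 <= Hc xi.
Proof. by rewrite mulr_ge0 ?powR_ge0// le_min sqr_ge0 invr_ge0 sqr_ge0. Qed.

Let mHc : measurable_fun setT Hc.
Proof.
apply: measurable_funM; last exact: measurable_powR_enorm.
apply: measurable_minr => //; apply: (measurableT_comp (@measurable_invr R)).
by apply: measurable_funX; apply: measurable_funM => //; exact: measurable_enorm.
Qed.

Let integrable_Hc : leb.-integrable setT (EFin \o Hc).
Proof.
have b0 := beta_gt0 hbeta; have b2 := beta_lt2 hbeta; have bd := beta_ltd hbeta.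
have th0 : 0 < theta^-1 by rewrite invr_gt0.
apply: (@integrable_enorm_powR _ _ Hc (dim%:R - beta) (dim%:R + 2 - beta) (t ^+ 2 + theta^-1) (dim_gt0 hbeta) mHc).
- by apply/andP; split; lra.
- by lra.
- by rewrite addr_ge0 ?sqr_ge0// ltW.
- move=> w r0; rewrite ger0_norm// /Hc opprB; apply: ler_wpM2r; first exact: powR_ge0.
  by rewrite ge_min lerDl (ltW th0).
- move=> w r0; rewrite ger0_norm// /Hc.
  have -> : enorm w `^ (- (dim%:R + 2 - beta)) = enorm w ^- 2 * enorm w `^ (beta - dim%:R).
    rewrite (_ : - _ = - 2%:R + (beta - dim%:R)); last by ring.
    by rewrite (powR_split (- 2%:R) (beta - dim%:R) r0) powRN powR_mulrn// enorm_ge0.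
  rewrite mulrA; apply: ler_wpM2r; first exact: powR_ge0.
  rewrite ge_min exprMn (sqr_sqrtr (ltW htheta)).
  rewrite (invfM theta); apply/orP; right.
  by apply: ler_wpM2r; [rewrite invr_ge0 sqr_ge0|rewrite lerDr sqr_ge0].
Qed.

Let kernel_sqr_le r (xi : vec) : I r -> `|wave_kernel theta (t - r) xi * wave_kernel theta (t - r) xi| <=
  Num.min (t ^+ 2) ((Num.sqrt theta * enorm xi) ^- 2).
Proof.
rewrite /I/= in_itv/= => /andP[r0 rt].
have i0 : 0 <= (Num.sqrt theta * enorm xi)^-1.
  by rewrite invr_ge0 mulr_ge0 ?enorm_ge0// ltW.
rewrite -expr2 normrX le_min -exprVn; apply/andP; split.
  rewrite lerXn2r ?nnegrE ?(ltW ht)//; apply: le_trans (normr_wave_kernel_le _ _) _.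
  by rewrite ger0_norm; lra.
by rewrite lerXn2r ?nnegrE//; exact: normr_wave_kernel_le_inv.
Qed.

Let F (c : vec -> R) (z : measurableTypeR R * vec) : R := \1_I z.1 *
  (c z.2 * (wave_kernel theta (t - z.1) z.2 * wave_kernel theta (t - z.1) z.2 * enorm z.2 `^ (beta - dim%:R))).

Let mF c : measurable_fun setT c -> measurable_fun setT (F c).
Proof.
move=> mc.
have msin : measurable_fun setT (@sin R) by apply: continuous_measurable_fun; exact: continuous_sin.
have m1 : measurable_fun setT (fun z : measurableTypeR R * vec => z.1 : R) by exact: measurable_fst.
have me : measurable_fun setT (fun z : measurableTypeR R * vec => enorm z.2).
  by apply: (measurableT_comp (@measurable_enorm R dim)).
have mk : measurable_fun setT (fun z : measurableTypeR R * vec => wave_kernel theta (t - z.1) z.2).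
  apply: measurable_funM.
    apply: (measurableT_comp msin); apply: measurable_funM => //; apply: measurable_funM => //.
    exact: measurable_funB.
  by apply: (measurableT_comp (@measurable_invr R)); exact: measurable_funM.
apply: measurable_funM; first by apply: (measurableT_comp _ m1); exact: measurable_indic.
apply: measurable_funM; first by apply: (measurableT_comp mc).
apply: measurable_funM; first exact: measurable_funM.
by apply: (measurableT_comp (measurable_powR_enorm (beta - dim%:R))).
Qed.

Lemma spec_time_average xi : (t / (2 * theta)) * spec xi =
  enorm xi `^ (beta - dim%:R) *
  \int[mu]_(r in I) (wave_kernel theta (t - r) xi * wave_kernel theta (t - r) xi).
Proof.
rewrite integral_wave_kernel_sqr /spec.
have [e0|e0] := eqVneq (enorm xi) 0.
  have bd := beta_ltd hbeta.
  have p0 c : c < 0 -> 0 `^ c = 0 :> R by move=> c0; rewrite powR0// lt_eqF.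
  by rewrite e0 !p0 ?mul0r ?mulr0//; lra.
have r0 : 0 < enorm xi by rewrite lt_neqAle eq_sym e0 enorm_ge0.
rewrite (powR_split _ _ r0) powRN powR_mulrn ?(ltW r0)//; ring.
Qed.

Let integrable_kernel_sqr (xi : vec) :
  mu.-integrable I (EFin \o (fun r => wave_kernel theta (t - r) xi * wave_kernel theta (t - r) xi)).
Proof.
have msin : measurable_fun setT (@sin R) by apply: continuous_measurable_fun; exact: continuous_sin.
apply: (@integrable_bound _ _ _ _ _ _ (fun=> Num.min (t ^+ 2) ((Num.sqrt theta * enorm xi) ^- 2))) => //.
- apply: measurable_funTS.
  have mk : measurable_fun setT (fun r : R => wave_kernel theta (t - r) xi).
    apply: measurable_funM => //; apply: (measurableT_comp msin); do 2 apply: measurable_funM => //.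
    exact: measurable_funB.
  exact: measurable_funM.
- by move=> r Ir; exact: kernel_sqr_le.
- apply: continuous_compact_integrable; first exact: segment_compact.
  by apply: continuous_subspaceT => s; exact: cvg_cst.
Qed.

Let measurable_spec : measurable_fun setT spec.
Proof.
apply: measurable_funM; first exact: measurable_powR_enorm.
by apply: measurable_funB => //; exact: measurable_sinc_w.
Qed.

Lemma spec_ge0 xi : 0 <= spec xi.
Proof.
rewrite mulr_ge0 ?powR_ge0// subr_ge0; apply: le_trans (ler_norm _) _; exact: sinc_w_le1.
Qed.

Lemma integrable_spec : leb.-integrable setT (EFin \o spec).
Proof.
apply: (@integrable_bound _ _ _ _ _ _ (fun xi => 2 * theta * Hc xi)) => //; last first.
  by have := integrableZl measurableT (2 * theta) integrable_Hc; exact: eq_integrable.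
move=> xi _; rewrite ger0_norm ?spec_ge0//.
have tt0 : 0 < t / (2 * theta) by rewrite divr_gt0// mulr_gt0.
rewrite -(ler_pM2l tt0) spec_time_average /Hc.
set m := Num.min _ _.
have -> : t / (2 * theta) * (2 * theta * (m * enorm xi `^ (beta - dim%:R))) =
    enorm xi `^ (beta - dim%:R) * (m * t) by field; rewrite gt_eqF.
apply: ler_wpM2l; first exact: powR_ge0.
have muI : fine (mu I) = t.
  have -> : mu I = t%:E by rewrite /I lebesgue_measure_itv/= lte_fin ht oppr0 adde0.
  by [].
rewrite -[X in _ <= _ * X]muI -Rintegral_cst//; apply: le_Rintegral => //.
  apply: continuous_compact_integrable; first exact: segment_compact.
  by apply: continuous_subspaceT => s; exact: cvg_cst.
by move=> r Ir; apply: le_trans (ler_norm _) (kernel_sqr_le _ Ir).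
Qed.

Lemma integrable_boundedM (c : vec -> R) M : measurable_fun setT c -> (forall w, `|c w| <= M) ->
  leb.-integrable setT (EFin \o (fun xi => c xi * spec xi)).
Proof.
move=> mc cM; apply: (@integrable_bound _ _ _ _ _ _ (fun xi => M * spec xi)) => //.
- exact: measurable_funM.
- by move=> xi _; rewrite normrM (ger0_norm (spec_ge0 _)) ler_wpM2r ?spec_ge0.
- by have := integrableZl measurableT M integrable_spec; exact: eq_integrable.
Qed.

Lemma wave_covariance_spec (x y : vec) :
  complex.Re (wave_covariance beta theta t x t y) =
  (2 * pi) ^- dim * (t / (2 * theta)) * \int[leb]_xi (cos (dot (x - y) xi) * spec xi).
Proof.
pose c xi := cos (dot (x - y) xi).
have mc : measurable_fun setT c.
  by apply: measurableT_comp; [apply: continuous_measurable_fun; exact: continuous_cos|exact: measurable_dot].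
have i1 : mu.-integrable setT (EFin \o (\1_I : measurableTypeR R -> R)) by exact: integrable_indic_itv.
have I0 s : 0 <= \1_I s :> R by [].
have Fle r xi : `|F c (r, xi)| <= \1_I r * Hc xi.
  rewrite /F/= indicE; case: (boolP (r \in I)) => [/set_mem rI|_]; last by rewrite !mul0r normr0.
  rewrite !mul1r normrM -[leRHS]mul1r ler_pM ?cos_max// normrM /Hc.
  rewrite (ger0_norm (powR_ge0 _ _)); apply: ler_wpM2r; first exact: powR_ge0.
  exact: kernel_sqr_le.
have Fub := @Rintegral_Fubini _ _ (measurableTypeR R) _ R mu leb (F c) (\1_I) Hc (mF mc) Fle I0 Hc_ge0 i1 integrable_Hc.
transitivity ((2 * pi) ^- dim * \int[mu]_r \int[leb]_xi F c (r, xi)).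
  rewrite /wave_covariance minxx /Cintegral /= mul0r subr0; congr (_ * _).
  rewrite -/I -Rintegral_indicM; apply: eq_Rintegral => r _; rewrite /F indicE.
  case: (r \in I) => /=.
    by rewrite mul1r; apply: eq_Rintegral => xi _; rewrite mul1r mulr0 subr0.
  by under [RHS]eq_Rintegral do rewrite mul0r; rewrite Rintegral_cst// !mul0r.
rewrite Fub -mulrA; congr (_ * _).
rewrite -RintegralZl//; last by apply: (@integrable_boundedM _ 1) => // w; exact: cos_max.
apply: eq_Rintegral => xi _; rewrite /F/= Rintegral_indicM mulrCA spec_time_average.
transitivity (\int[mu]_(r in I) ((c xi * enorm xi `^ (beta - dim%:R)) *
    (wave_kernel theta (t - r) xi * wave_kernel theta (t - r) xi))).
  by apply: eq_Rintegral => r _; rewrite -(mulrA (c xi)); congr (_ * _); exact: mulrC.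
by rewrite RintegralZl// -mulrA.
Qed.

End wave_time_integral.

Section integrable_scaling.
Context (R : realType) (dim : nat).
Local Notation vec := 'rV[R]_dim.
Local Notation leb := (lebesgue_rV R dim).

Lemma integrable_rV_scale (s : R) (f : vec -> R) : 0 < s ->
  leb.-integrable setT (EFin \o f) -> leb.-integrable setT (EFin \o (fun w => f (s *: w))).
Proof.
move=> s0 /integrableP[mf fi].
have mf' : measurable_fun setT f by apply/measurable_EFinP.
apply/integrableP; split.
  by apply/measurable_EFinP; apply: (measurableT_comp mf'); exact: measurable_scale_rV.
rewrite (_ : (\int[leb]_w `|(EFin \o (fun w => f (s *: w))) w| = \int[leb]_w (abse \o (EFin \o f)) (s *: w)%R)%E); last by [].
rewrite ge0_integral_rV_scale//; last 2 first.
- exact: measurableT_comp.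
- by move=> x; exact: abse_ge0.
by rewrite lte_mul_pinfty// lee_fin invr_ge0 exprn_ge0// ltW.
Qed.

End integrable_scaling.

Section second_moments.
Context d (Omega : measurableType d) (R : realType) (P : probability Omega R).

Lemma integral_sqr_of_law (Y : Omega -> R) (v : R) : measurable_fun setT Y -> 0 <= v ->
  (forall A, measurable A -> pushforward P Y A = gaussian_law 0 v A) ->
  (\int[P]_w (Y w ^+ 2)%:E = v%:E)%E.
Proof.
move=> mY v0 law.
have mY' : @measurable_fun _ _ Omega (measurableTypeR R) setT Y by [].
pose Z : {mfun Omega >-> measurableTypeR R} :=
  HB.pack Y (isMeasurableFun.Build _ _ _ (measurableTypeR R) Y mY').
rewrite -(integral_sqr_gaussian_law v0).
transitivity (\int[distribution P Z]_x (x ^+ 2)%:E)%E.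
  rewrite ge0_integral_distribution//.
    by apply/measurable_EFinP; exact: measurable_funX.
  by move=> x; rewrite lee_fin sqr_ge0.
by apply: (@eq_measure_integral _ (measurableTypeR R) R setT) => A mA _; exact: law.
Qed.

Lemma integrable_mul_sqr (X Y : Omega -> R) : measurable_fun setT X -> measurable_fun setT Y ->
  P.-integrable setT (EFin \o (fun w => X w ^+ 2)) -> P.-integrable setT (EFin \o (fun w => Y w ^+ 2)) ->
  P.-integrable setT (EFin \o (fun w => X w * Y w)).
Proof.
move=> mX mY iX iY.
apply: (@integrable_bound _ _ _ _ _ _ (fun w => X w ^+ 2 + Y w ^+ 2)) => //.
- exact: measurable_funM.
- move=> w _; rewrite ler_norml; apply/andP; split; rewrite -subr_ge0.
    have -> : X w * Y w - - (X w ^+ 2 + Y w ^+ 2) = (X w + Y w) ^+ 2 / 2 + X w ^+ 2 / 2 + Y w ^+ 2 / 2 by field.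
    by rewrite !addr_ge0 ?divr_ge0 ?sqr_ge0.
  have -> : X w ^+ 2 + Y w ^+ 2 - X w * Y w = (X w - Y w) ^+ 2 / 2 + X w ^+ 2 / 2 + Y w ^+ 2 / 2 by field.
  by rewrite !addr_ge0 ?divr_ge0 ?sqr_ge0.
- by have := integrableD measurableT iX iY; exact: eq_integrable.
Qed.

Lemma Rintegral_sqr_sum m (U : 'I_m -> Omega -> R) (b : 'I_m -> R) :
  (forall k l, P.-integrable setT (EFin \o (fun w => U k w * U l w))) ->
  \int[P]_w ((\sum_k b k * U k w) ^+ 2) =
  \sum_k \sum_l b k * b l * \int[P]_w (U k w * U l w).
Proof.
move=> iU.
have i1 k l : P.-integrable setT (EFin \o (fun w => b k * b l * (U k w * U l w))).
  by have := integrableZl measurableT (b k * b l) (iU k l); exact: eq_integrable.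
transitivity (\int[P]_w (\sum_k \sum_l b k * b l * (U k w * U l w))).
  apply: eq_Rintegral => w _; rewrite expr2 big_distrlr/=.
  by apply: eq_bigr => k _; apply: eq_bigr => l _; ring.
rewrite (Rintegral_sum measurableT)//; last first.
  by move=> k; exact: (integrable_Rsum measurableT).
apply: eq_bigr => k _; rewrite (Rintegral_sum measurableT)//.
by apply: eq_bigr => l _; rewrite RintegralZl.
Qed.

End second_moments.

Section second_difference.
Context (R : realType).

(** The coefficients, on the [n.+2] observations, of the linear combination of second differences
    with coefficients [a]. *)
Definition second_diff n (a : 'I_n -> R) (l : 'I_n.+2) : R :=
  \sum_i a i * ((l == i.+2 :> nat)%:R + (l == i :> nat)%:R - 2 * (l == i.+1 :> nat)%:R).

Lemma sum_second_diff n (a : 'I_n -> R) (f : nat -> R) :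
  \sum_l second_diff a l * f l = \sum_i a i * (f i.+2 + f i - 2 * f i.+1).
Proof.
rewrite /second_diff; under eq_bigr do rewrite mulr_suml.
rewrite exchange_big/=; apply: eq_bigr => i _.
have pick (j : nat) : (j < n.+2)%N -> \sum_(l < n.+2) (l == j :> nat)%:R * f l = f j.
  move=> jn; rewrite (bigD1 (Ordinal jn))//= eqxx mul1r big1 ?addr0// => l lj.
  by rewrite (_ : (l == j :> nat) = false) ?mul0r//; apply: contra_neqF lj => /eqP lj; exact/val_inj.
rewrite -(pick i.+2) ?ltnS// -[in RHS](pick i) ?(ltn_trans (ltn_ord i))// -(pick i.+1) ?ltnS ?(ltnW (ltn_ord i))//.
rewrite mulr_sumr -big_split -sumrB/= mulr_sumr; apply: eq_bigr => l _; ring.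
Qed.

(** A second difference multiplies the trigonometric polynomial by a factor of modulus [4 * sin (y /
    2) ^+ 2]; this is where the fourth power in [g_sp] comes from. *)
Lemma trig_sq_second_diff n (a : 'I_n -> R) y :
  trig_sq (second_diff a) y = 16 * sin (y / 2) ^+ 4 * trig_sq a y.
Proof.
have c2 : 2 * cos y - 2 = - 4 * sin (y / 2) ^+ 2.
  rewrite {1}(splitr y) cosD; have := cos2Dsin2 (y / 2) => h.
  have -> : cos (y / 2) * cos (y / 2) = 1 - sin (y / 2) ^+ 2 by apply/eqP; rewrite -expr2 -subr_eq0 opprB addrA h subrr.
  ring.
have shift (i : nat) : i.+1%:R * y = i%:R * y + y :> R by rewrite -natr1 mulrDl mul1r.
have dc (i : nat) : cos (i.+2%:R * y) + cos (i%:R * y) - 2 * cos (i.+1%:R * y) =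
    (2 * cos y - 2) * cos (i.+1%:R * y).
  have -> : i.+2%:R * y = i.+1%:R * y + y by exact: shift.
  have -> : i%:R * y = i.+1%:R * y - y by rewrite shift addrK.
  by rewrite cosD cosB; ring.
have ds (i : nat) : sin (i.+2%:R * y) + sin (i%:R * y) - 2 * sin (i.+1%:R * y) =
    (2 * cos y - 2) * sin (i.+1%:R * y).
  have -> : i.+2%:R * y = i.+1%:R * y + y by exact: shift.
  have -> : i%:R * y = i.+1%:R * y - y by rewrite shift addrK.
  by rewrite sinD sinB; ring.
rewrite /trig_sq (sum_second_diff a (fun l => cos (l%:R * y))) (sum_second_diff a (fun l => sin (l%:R * y))).
under eq_bigr do rewrite dc mulrCA.
under [X in _ + X ^+ 2]eq_bigr do rewrite ds mulrCA.
rewrite -!mulr_sumr c2.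
under eq_bigr do rewrite shift cosD.
under [X in _ + (_ * X) ^+ 2]eq_bigr do rewrite shift sinD.
set C := \sum_i a i * cos (i%:R * y); set S := \sum_i a i * sin (i%:R * y).
have -> : \sum_(i < n) a i * (cos (i%:R * y) * cos y - sin (i%:R * y) * sin y) = C * cos y - S * sin y.
  by rewrite /C /S !mulr_suml -sumrB; apply: eq_bigr => i _; ring.
have -> : \sum_(i < n) a i * (sin (i%:R * y) * cos y + cos (i%:R * y) * sin y) = S * cos y + C * sin y.
  by rewrite /C /S !mulr_suml -big_split/=; apply: eq_bigr => i _; ring.
have := cos2Dsin2 y => h.
transitivity (16 * sin (y / 2) ^+ 4 * (C ^+ 2 + S ^+ 2) * (cos y ^+ 2 + sin y ^+ 2)); first by ring.
by rewrite h mulr1.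
Qed.

End second_difference.

Section increments.
Context (R : realType) (dim : nat) (beta theta : R).
Hypothesis hbeta : 0 < beta < Num.min 2 dim%:R.
Hypothesis htheta : 0 < theta.
Context (d : measure_display) (Omega : measurableType d) (P : probability Omega R).
Variable u : R -> 'rV[R]_dim -> {RV P >-> R}.
Hypothesis hu : wave_solution beta theta u.
Variable t : R.
Hypothesis ht : 0 < t.
Variable rho : 'rV[R]_dim.
Hypothesis hrho : enorm rho = 1.
Local Notation vec := 'rV[R]_dim.
Local Notation leb := (lebesgue_rV R dim).

Definition spectral_const : R := (2 * pi) ^- dim * (t / (2 * theta)) * 16.

(** The finite time [t] enters the covariance through this factor alone; away from the origin it
    tends to 1 when [lam] tends to 0. *)
Definition sinc_weight (lam : R) (w : vec) : R :=
  1 - sinc_w (2 * t * Num.sqrt theta / lam) w.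

Definition incr_cov (lam k : R) : R :=
  spectral_const * cos_moment beta rho (sinc_weight lam) k.

(** With this power of [lam] the covariance depends on [lam] only through [sinc_weight]. *)
Definition scaled_incr (lam : R) n (k : 'I_n) (w : Omega) : R :=
  lam `^ ((beta - 2) / 2) * I_sp u t rho lam k.+1 w.

Definition incr_covmx (lam : R) n : 'M[R]_n :=
  \matrix_(j, k) incr_cov lam (j%:R - k%:R).

Lemma spectral_const_gt0 : 0 < spectral_const.
Proof.
by rewrite !mulr_gt0 ?invr_gt0 ?exprn_gt0 ?mulr_gt0 ?pi_gt0.
Qed.

Lemma measurable_sinc_weight lam : measurable_fun setT (sinc_weight lam).
Proof. by apply: measurable_funB => //; exact: measurable_sinc_w. Qed.

Lemma sinc_weight_bound lam w : 0 <= sinc_weight lam w <= 2.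
Proof.
rewrite /sinc_weight; have := sinc_w_le1 (2 * t * Num.sqrt theta / lam) w.
rewrite ler_norml => /andP[h1 h2]; apply/andP; split; lra.
Qed.

Lemma normr_sinc_weight_le lam w : `|sinc_weight lam w| <= 2.
Proof. by case/andP: (sinc_weight_bound lam w) => h0 h2; rewrite ger0_norm. Qed.

Let U (lam : R) (l : nat) : Omega -> R := u t (x_sp rho lam l).

Let integrable_sqr_U lam l : P.-integrable setT (EFin \o (fun w => U lam l w ^+ 2)).
Proof.
have [v v0 law] := hu.1 1%N (fun=> t) (fun=> x_sp rho lam l) (fun=> 1) (fun=> ltW ht).
have mU : measurable_fun setT (U lam l) by [].
apply: integrable_ge0 => //; first exact: measurable_funX.
  by move=> w _; rewrite sqr_ge0.
rewrite (integral_sqr_of_law mU v0) ?ltry// => A mA.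
by rewrite -law//; congr (pushforward P _ A); apply/funext => w; rewrite big_ord1 mul1r.
Qed.

Let integrable_UU lam k l : P.-integrable setT (EFin \o (fun w => U lam k w * U lam l w)).
Proof. by apply: integrable_mul_sqr. Qed.

Let second_moment_U lam k l : \int[P]_w (U lam k w * U lam l w) =
  (2 * pi) ^- dim * (t / (2 * theta)) *
  \int[leb]_xi (cos ((k%:R - l%:R) * (lam * dot rho xi)) * spec beta theta t xi).
Proof.
have := hu.2 t t (x_sp rho lam k) (x_sp rho lam l) (ltW ht) (ltW ht).
move=> /(congr1 (@complex.Re R)); rewrite wave_covariance_spec// [complex.Re _]/= => h.
transitivity (fine ('E_P[(u t (x_sp rho lam k) : Omega -> R) \* u t (x_sp rho lam l)])).
  by rewrite unlock.
rewrite h; congr (_ * _); apply: eq_Rintegral => xi _; congr (cos _ * _).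
by rewrite /x_sp -scalerBl dotZl; ring.
Qed.

Let b (lam : R) n (a : 'rV[R]_n) := second_diff (fun i => lam `^ ((beta - 2) / 2) * a 0 i).

Let lin_scaled_incr lam n (a : 'rV[R]_n) :
  lin (@scaled_incr lam n) a = (fun w => \sum_l b lam a l * U lam l w).
Proof.
apply/funext => w; rewrite /b (sum_second_diff _ (fun l => U lam l w)) /lin.
apply: eq_bigr => i _; rewrite /scaled_incr /I_sp /U /=; ring.
Qed.

(** The substitution of [lam *: xi] for the frequency turns the spectral density of the increments
    into [g_sp] and produces the power of [lam] that the scaling of [scaled_incr] cancels. *)
Let second_moment_lin lam n (a : 'rV[R]_n) : 0 < lam ->
  \int[P]_w ((\sum_l b lam a l * U lam l w) ^+ 2) = quad (incr_covmx lam n) a.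
Proof.
move=> lam0.
rewrite Rintegral_sqr_sum//.
set c := (2 * pi) ^- dim * (t / (2 * theta)).
have mcos k l : measurable_fun setT (fun xi : vec => cos ((k%:R - l%:R) * (lam * dot rho xi))).
  apply: measurableT_comp; first by apply: continuous_measurable_fun; exact: continuous_cos.
  by do 2 apply: measurable_funM => //; exact: measurable_dot.
have ics k l : leb.-integrable setT (EFin \o (fun xi => cos ((k%:R - l%:R) * (lam * dot rho xi)) * spec beta theta t xi)).
  by apply: (@integrable_boundedM _ _ _ _ _ hbeta htheta ht _ 1) => // w; exact: cos_max.
transitivity (c * \int[leb]_xi (trig_sq (b lam a) (lam * dot rho xi) * spec beta theta t xi)).
  have ics' k l e : leb.-integrable setT (EFin \o (fun xi => e * (cos ((k%:R - l%:R) * (lam * dot rho xi)) * spec beta theta t xi))).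
    by have := integrableZl measurableT e (ics k l); exact: eq_integrable.
  transitivity (c * \int[leb]_xi (\sum_k \sum_l b lam a k * b lam a l *
      (cos ((k%:R - l%:R) * (lam * dot rho xi)) * spec beta theta t xi))); last first.
    congr (_ * _); apply: eq_Rintegral => xi _; rewrite trig_sqE mulr_suml.
    by apply: eq_bigr => k _; rewrite mulr_suml; apply: eq_bigr => l _; rewrite mulrA.
  rewrite (Rintegral_sum measurableT); last by move=> k; exact: (integrable_Rsum measurableT).
  rewrite mulr_sumr; apply: eq_bigr => k _; rewrite (Rintegral_sum measurableT)//.
  rewrite mulr_sumr; apply: eq_bigr => l _; rewrite RintegralZl// second_moment_U -/c; ring.
pose a' (i : 'I_n) := lam `^ ((beta - 2) / 2) * a 0 i.
have [iG GE] := integral_trig_sq_weight hbeta hrho (measurable_sinc_weight lam) (normr_sinc_weight_le lam) a'.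
transitivity (c * 16 * lam `^ (2 - beta) * \int[leb]_w
   (trig_sq a' (dot rho w) * (sinc_weight lam w * g_sp beta rho w))).
  rewrite -[X in _ = X * _]mulrA -[RHS]mulrA; congr (c * _).
  have E xi : trig_sq (b lam a) (lam * dot rho xi) * spec beta theta t xi =
     16 * lam `^ (dim%:R + 2 - beta) *
     (trig_sq a' (dot rho (lam *: xi)) * (sinc_weight lam (lam *: xi) * g_sp beta rho (lam *: xi))).
    rewrite /b trig_sq_second_diff -/a' /spec /g_sp /sinc_weight enormZ (gtr0_norm lam0).
    have -> : dot rho (lam *: xi) = lam * dot rho xi by rewrite dotC dotZl dotC.
    have -> : sinc_w (2 * t * Num.sqrt theta / lam) (lam *: xi) = sinc_w (2 * t * Num.sqrt theta) xi.
      rewrite /sinc_w enormZ (gtr0_norm lam0) [_ / lam * _]mulrA divfK// gt_eqF//.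
    rewrite powRM ?enorm_ge0// ?(ltW lam0)//.
    have -> : lam `^ (beta - dim%:R - 2) = (lam `^ (dim%:R + 2 - beta))^-1.
      by rewrite -powRN; congr (_ `^ _); ring.
    by field; rewrite gt_eqF// powR_gt0.
  under eq_Rintegral do rewrite E.
  have iG' : leb.-integrable setT (EFin \o (fun xi =>
      trig_sq a' (dot rho (lam *: xi)) * (sinc_weight lam (lam *: xi) * g_sp beta rho (lam *: xi)))).
    exact: (integrable_rV_scale lam0 iG).
  pose G (w : vec) := trig_sq a' (dot rho w) * (sinc_weight lam w * g_sp beta rho w).
  have -> : \int[leb]_x (16 * lam `^ (dim%:R + 2 - beta) * G (lam *: x)) =
      16 * lam `^ (dim%:R + 2 - beta) * \int[leb]_x G (lam *: x) by rewrite RintegralZl.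
  have -> : \int[leb]_x G (lam *: x) = lam ^- dim * \int[leb]_x G x.
    exact: (Rintegral_rV_scale lam0 iG).
  rewrite -/(G _); move: (\int[leb]_x G x) => I0.
  have -> : dim%:R + 2 - beta = (2 - beta) + dim%:R by ring.
  rewrite (powR_split _ _ lam0) powR_mulrn ?(ltW lam0)//.
  by field; rewrite expf_neq0// gt_eqF.
rewrite GE /quad mxE mulr_sumr.
rewrite [RHS](_ : _ = \sum_j \sum_k a 0 j * a 0 k * incr_covmx lam n j k); last first.
  rewrite exchange_big/=; apply: eq_bigr => k _; rewrite !mxE mulr_suml; apply: eq_bigr => j _.
  by rewrite mulrAC.
apply: eq_bigr => j _; rewrite mulr_sumr; apply: eq_bigr => k _.
rewrite mxE /incr_cov /spectral_const -/c /a'.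
have l2 : lam `^ (2 - beta) * (lam `^ ((beta - 2) / 2) * lam `^ ((beta - 2) / 2)) = 1.
  by rewrite -!(powR_split _ _ lam0) -[RHS](powRr0 lam); congr (_ `^ _); field.
move: l2; set p := lam `^ (2 - beta); set q := lam `^ ((beta - 2) / 2) => l2.
transitivity (c * 16 * (p * (q * q)) * (a 0 j * a 0 k * cos_moment beta rho (sinc_weight lam) (j%:R - k%:R))).
  ring.
rewrite l2; ring.
Qed.

Lemma law_scaled_incr lam n (a : 'rV[R]_n) : 0 < lam ->
  0 <= quad (incr_covmx lam n) a /\
  forall A : set R, measurable A ->
    pushforward P (lin (@scaled_incr lam n) a) A = gaussian_law 0 (quad (incr_covmx lam n) a) A.
Proof.
move=> lam0.
have [v v0 law] := hu.1 n.+2 (fun=> t) (fun l => x_sp rho lam l) (b lam a) (fun=> ltW ht).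
have mY : measurable_fun setT (fun w => \sum_l b lam a l * U lam l w).
  by apply: measurable_sum => l; apply: measurable_funM.
have vE : v = quad (incr_covmx lam n) a.
  rewrite -second_moment_lin// /Rintegral.
  by have -> := integral_sqr_of_law mY v0 law.
by rewrite lin_scaled_incr -vE; split.
Qed.

Lemma measurable_scaled_incr lam n (k : 'I_n) : measurable_fun setT (scaled_incr lam k).
Proof.
apply: measurable_funM => //; apply: measurable_funB; first exact: measurable_funD.
exact: measurable_funM.
Qed.

Lemma incr_covmx_sym lam n : (incr_covmx lam n)^T = incr_covmx lam n.
Proof.
apply/matrixP => j k; rewrite !mxE /incr_cov; congr (_ * _).
apply: eq_Rintegral => w _; congr (_ * _).
by rewrite -cosN -mulNr opprB.
Qed.

End increments.

(** * Asymptotics of the covariance matrices *)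

Section toeplitz.
Context (R : realType).

Lemma cvg_sum_esum (g : nat -> R) (C : R) : (forall k, 0 <= g k) ->
  (forall n, \sum_(k < n) g k <= C) ->
  \sum_(k < n) g k @[n --> \oo] --> fine (\esum_(k in [set: nat]) (g k)%:E)%E /\
  (\esum_(k in [set: nat]) (g k)%:E)%E \is a fin_num.
Proof.
move=> g0 gC; rewrite -nneseries_esumT; last by move=> k; rewrite lee_fin.
have E n : (\sum_(0 <= k < n) (g k)%:E)%E = (\sum_(k < n) g k)%:E.
  by rewrite sumEFin big_mkord.
have cv : (\sum_(k < n) g k)%:E @[n --> \oo] --> (\sum_(0 <= k <oo) (g k)%:E)%E.
  have := @is_cvg_nneseries R (fun k => (g k)%:E) predT 0 (fun k _ _ => g0 k).
  by under eq_cvg do rewrite E.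
have fin : (\sum_(0 <= k <oo) (g k)%:E)%E \is a fin_num.
  rewrite ge0_fin_numE; last by apply: nneseries_ge0 => k _ _; rewrite lee_fin.
  apply: le_lt_trans (ltry C); apply: (cvge_to_le cv).
  by apply: nearW => n; rewrite lee_fin.
by split => //; have := cv; rewrite -{1}(fineK fin) => /fine_cvg.
Qed.

Variables (f : R -> R) (B : R).
Hypothesis f_ge0 : forall x, 0 <= f x.
Hypothesis f_even : forall x, f (- x) = f x.
Hypothesis f_bounded : forall N, \sum_(k < N) f k%:R <= B.

(** The partial sums of [f] over the integers from [- n] to [n]. *)
Let p (n : nat) : R := \sum_(k < n.+1) f k%:R + \sum_(k < n) f k.+1%:R.

(** By induction: the last row and the last column of the array contribute [p n]. *)
Lemma toeplitz_sumE n : \sum_(j < n) \sum_(k < n) f (j%:R - k%:R) = \sum_(m < n) p m.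
Proof.
elim: n => [|n IH]; first by rewrite !big_ord0.
rewrite big_ord_recr/= [RHS]big_ord_recr/= -IH.
under eq_bigr do rewrite big_ord_recr/=.
rewrite big_split/= -addrA; congr (_ + _).
have rev (h : nat -> R) : \sum_(k < n) h (n - k)%N = \sum_(k < n) h k.+1.
  rewrite (reindex_inj rev_ord_inj)/=; apply: eq_bigr => k _.
  by rewrite /= subKn.
have E1 : \sum_(j < n) f (j%:R - n%:R) = \sum_(k < n) f k.+1%:R.
  rewrite -(rev (fun m => f m%:R)); apply: eq_bigr => j _.
  by rewrite -f_even opprB natrB// ltnW.
have E2 : \sum_(k < n.+1) f (n%:R - k%:R) = \sum_(k < n.+1) f k%:R.
  rewrite big_ord_recr big_ord_recl/= subrr addrC; congr (_ + _).
  transitivity (\sum_(k < n) f k.+1%:R); last by [].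
  rewrite -(rev (fun m => f m%:R)); apply: eq_bigr => j _.
  by rewrite natrB// ltnW.
by rewrite E1 E2 addrC.
Qed.

Let f_bounded1 n : \sum_(k < n) f k.+1%:R <= B.
Proof. by apply: le_trans (f_bounded n.+1); rewrite [leRHS]big_ord_recl/= lerDr. Qed.

Let p_le n : p n <= 2 * B.
Proof.
by rewrite mulr2n mulrDl mul1r lerD.
Qed.

Lemma toeplitz_sum_le n : \sum_(j < n) \sum_(k < n) f (j%:R - k%:R) <= n%:R * (2 * B).
Proof.
rewrite toeplitz_sumE; apply: le_trans (_ : \sum_(m < n) 2 * B <= _).
  by apply: ler_sum => m _; exact: p_le.
by rewrite sumr_const card_ord -[leLHS]mulr_natl.
Qed.

Lemma cvg_esum_int_even :
  p n @[n --> \oo] --> fine (\esum_(k in [set: int]) (f k%:~R)%:E)%E.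
Proof.
have F0 k : (0 <= (f k)%:E)%E by rewrite lee_fin.
rewrite (esumID [set Posz n | n in [set: nat]])//.
have -> : [set: int] `&` ~` [set Posz n | n in [set: nat]] = [set Negz n | n in [set: nat]].
  apply/seteqP; split => [[n|n] /= []|_ [n _ <-]] //=.
    by move=> _ []; exists n.
    by exists n.
  by split => // -[].
rewrite setTI.
rewrite !esum_image; [|by move=> m n _ _ []|by move=> m n _ _ []].
have -> : (\esum_(i in [set: nat]) (f (Negz i)%:~R)%:E = \esum_(i in [set: nat]) (f i.+1%:R)%:E)%E.
  by apply: eq_esum => i _; rewrite NegzE mulrNz f_even.
have [c1 f1] := @cvg_sum_esum (fun k => f k%:R) B (fun k => f_ge0 _) f_bounded.
have [c2 f2] := @cvg_sum_esum (fun k => f k.+1%:R) B (fun k => f_ge0 _) f_bounded1.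
rewrite fineD//; apply: cvgD => //.
by rewrite (cvg_shiftS (fun n => \sum_(k < n) f k%:R)).
Qed.

(** Cesaro's theorem for the symmetric partial sums. *)
Lemma cvg_toeplitz_mean :
  n%:R^-1 * \sum_(j < n) \sum_(k < n) f (j%:R - k%:R) @[n --> \oo] -->
  fine (\esum_(k in [set: int]) (f k%:~R)%:E)%E.
Proof.
have := cesaro cvg_esum_int_even => /=.
rewrite -(cvg_shiftS (fun n => n%:R^-1 * \sum_(j < n) \sum_(k < n) f (j%:R - k%:R))) /=.
under [X in _ -> X]eq_cvg do rewrite toeplitz_sumE.
by rewrite /arithmetic_mean /series /=; under eq_cvg do rewrite /= big_mkord.
Qed.

End toeplitz.

Lemma sqr_sub_perturb (R : realType) (x y s : R) : 0 < s ->
  `|(x - y) ^+ 2 - x ^+ 2| <= (1 + s^-1) * y ^+ 2 + s * x ^+ 2.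
Proof.
move=> s0; rewrite ler_norml; apply/andP; split; rewrite -subr_ge0.
  have -> : (x - y) ^+ 2 - x ^+ 2 - - ((1 + s^-1) * y ^+ 2 + s * x ^+ 2) =
    y ^+ 2 + y ^+ 2 + s * (x - s^-1 * y) ^+ 2 by field; rewrite gt_eqF.
  by apply: addr_ge0; [rewrite addr_ge0 ?sqr_ge0|rewrite mulr_ge0 ?sqr_ge0// (ltW s0)].
have -> : (1 + s^-1) * y ^+ 2 + s * x ^+ 2 - ((x - y) ^+ 2 - x ^+ 2) = s * (x + s^-1 * y) ^+ 2.
  by field; rewrite gt_eqF.
by rewrite mulr_ge0 ?sqr_ge0// (ltW s0).
Qed.

Section covariance_asymptotics.
Context (R : realType) (dim : nat) (beta theta : R).
Hypothesis hbeta : 0 < beta < Num.min 2 dim%:R.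
Hypothesis htheta : 0 < theta.
Variable t : R.
Hypothesis ht : 0 < t.
Variable rho : 'rV[R]_dim.
Hypothesis hrho : enorm rho = 1.
Local Notation vec := 'rV[R]_dim.
Local Notation leb := (lebesgue_rV R dim).
Local Notation g := (g_sp beta rho).
Local Notation c0 := (spectral_const dim theta t).
Local Notation cov := (incr_cov beta theta t rho).
Local Notation covmx := (incr_covmx beta theta t rho).

(** The cosine transform of [g_sp] at the multiples of [rho]. *)
Definition gsp_ft (k : R) : R := cos_moment beta rho (fun=> 1) k.
Local Notation F := gsp_ft.

Let q : R := 2 * t * Num.sqrt theta.
Let q_gt0 : 0 < q. Proof. by rewrite !mulr_gt0// sqrtr_gt0. Qed.

Let e (lam k : R) : R := cos_moment beta rho (sinc_w (q / lam)) k.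

Let one_le (w : vec) : `|(fun=> 1 : R) w| <= 1. Proof. by rewrite normr1. Qed.

Lemma incr_covE lam k : cov lam k = c0 * (F k - e lam k).
Proof.
rewrite /incr_cov; congr (_ * _); rewrite /cos_moment /F /e.
rewrite -RintegralB//; last 2 first.
- exact: (integrable_cos_moment hbeta hrho (measurable_cst _) one_le).
- exact: (integrable_cos_moment hbeta hrho (measurable_sinc_w (q / lam)) (sinc_w_le1 (q / lam))).
by apply: eq_Rintegral => w _; rewrite /sinc_weight -/q; ring.
Qed.

Lemma cos_moment_even (phi : vec -> R) k : cos_moment beta rho phi (- k) = cos_moment beta rho phi k.
Proof. by apply: eq_Rintegral => w _; rewrite mulNr cosN. Qed.

Lemma gsp_ft0 : F 0 = \int[leb]_w g w.
Proof. by apply: eq_Rintegral => w _; rewrite mul0r cos0 !mul1r. Qed.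

Lemma quad_incr_covmx lam n (a : 'rV[R]_n) :
  quad (covmx lam n) a =
  c0 * \int[leb]_w (trig_sq (fun i => a 0 i) (dot rho w) * (sinc_weight theta t lam w * g w)).
Proof.
have [_ ->] := integral_trig_sq_weight hbeta hrho (measurable_sinc_weight theta t lam)
  (normr_sinc_weight_le theta t lam) (fun i => a 0 i).
rewrite /quad mxE mulr_sumr.
rewrite [LHS](_ : _ = \sum_j \sum_k a 0 j * a 0 k * covmx lam n j k); last first.
  rewrite exchange_big/=; apply: eq_bigr => k _; rewrite !mxE mulr_suml; apply: eq_bigr => j _.
  by rewrite mulrAC.
apply: eq_bigr => j _; rewrite mulr_sumr; apply: eq_bigr => k _.
by rewrite mxE /incr_cov; ring.
Qed.

(** The quadratic form is the integral of a squared trigonometric polynomial against [g_sp] times a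
    weight between 0 and 2, so [trig_sq_gsp_bound] applies uniformly in [lam] and [n]. *)
Lemma incr_covmx_opnorm : exists2 C : R, 0 <= C & forall lam n (v : 'rV[R]_n),
  enorm (v *m covmx lam n) <= C * enorm v.
Proof.
have [B B0 HB] := trig_sq_gsp_bound hbeta hrho.
have c00 := spectral_const_gt0 dim htheta ht.
have C0 : 0 <= c0 * (2 * B) by rewrite mulr_ge0 ?(ltW c00)// mulr_ge0// ltW.
exists (c0 * (2 * B)) => //.
move=> lam n; apply: psd_opnorm.
- exact: incr_covmx_sym.
- exact: C0.
- move=> v; rewrite quad_incr_covmx mulr_ge0 ?(ltW c00)//; apply: Rintegral_ge0 => w _.
  rewrite mulr_ge0 ?trig_sq_ge0// mulr_ge0 ?g_sp_ge0//.
  by case/andP: (sinc_weight_bound theta t lam w).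
- move=> v; rewrite quad_incr_covmx -mulrA ler_pM2l// -mulrA.
  have -> : dot v v = \sum_j v 0 j ^+ 2 by apply: eq_bigr => j _; rewrite expr2.
  apply: (@le_trans _ _ (2 * \int[leb]_w (trig_sq (fun i => v 0 i) (dot rho w) * g w))); last first.
    by rewrite ler_pM2l//; exact: HB.
  have [i1 _] := integral_trig_sq_weight hbeta hrho (measurable_sinc_weight theta t lam)
    (normr_sinc_weight_le theta t lam) (fun i => v 0 i).
  have [i2 _] := integral_trig_sq_weight hbeta hrho (measurable_cst _) one_le (fun i => v 0 i).
  have i3 : leb.-integrable setT (EFin \o (fun w => trig_sq (fun i => v 0 i) (dot rho w) * g w)).
    by move: i2; apply: eq_integrable => // w _ /=; rewrite mul1r.
  rewrite -RintegralZl//; apply: le_Rintegral => //.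
    by have := integrableZl measurableT 2 i3; exact: eq_integrable.
  move=> w _; rewrite [leRHS]mulrCA; apply: ler_wpM2l; first exact: trig_sq_ge0.
  by apply: ler_wpM2r; [exact: g_sp_ge0|case/andP: (sinc_weight_bound theta t lam w)].
Qed.

Lemma incr_covmx_trace lam n : \tr (covmx lam n) = n%:R * (c0 * (F 0 - e lam 0)).
Proof.
rewrite /mxtrace (eq_bigr (fun=> c0 * (F 0 - e lam 0))).
  by rewrite sumr_const card_ord mulr_natl.
by move=> i _; rewrite mxE subrr incr_covE.
Qed.

Lemma bias_bound : exists2 K : R, 0 <= K & forall lam, 0 < lam -> `|e lam 0| <= K * lam ^+ 2.
Proof.
have [K K0 HK] := sinc_bias hbeta hrho.
exists (K / q ^+ 2); first by rewrite divr_ge0// exprn_ge0// ltW.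
move=> lam lam0; have qlam : 0 < q / lam by rewrite divr_gt0.
have -> : K / q ^+ 2 * lam ^+ 2 = K / (q / lam) ^+ 2 by field; rewrite !gt_eqF.
apply: le_trans (HK _ qlam); rewrite le_eqVlt; apply/orP; left; apply/eqP; congr `|_|.
by apply: eq_Rintegral => w _; rewrite mul0r cos0 mul1r.
Qed.

Lemma gsp_ft_sqr_bound : exists B : R, forall N, \sum_(k < N) F k%:R ^+ 2 <= B.
Proof.
have [B B0 HB] := trig_sq_gsp_bound hbeta hrho.
exists (B * \int[leb]_w ((fun=> 1) w ^+ 2 * g w)) => N.
exact: (bessel_gsp hbeta hrho B0 HB (measurable_cst _) one_le).
Qed.

Lemma error_sqr_bound : exists2 K : R, 0 <= K & forall lam, 0 < lam ->
  forall N, \sum_(k < N) e lam k%:R ^+ 2 <= K * lam.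
Proof.
have [B B0 HB] := trig_sq_gsp_bound hbeta hrho.
have [K K0 HK] := sinc_sqr hbeta hrho.
exists (B * (K / q)); first by rewrite mulr_ge0 ?(ltW B0)// divr_ge0// ltW.
move=> lam lam0 N; have qlam : 0 < q / lam by rewrite divr_gt0.
apply: le_trans (bessel_gsp hbeta hrho B0 HB (measurable_sinc_w (q / lam)) (sinc_w_le1 (q / lam)) N) _.
rewrite -mulrA ler_pM2l//; apply: le_trans (HK _ qlam) _.
by rewrite le_eqVlt; apply/orP; left; apply/eqP; field; rewrite !gt_eqF.
Qed.

Definition ft_energy : R := fine (\esum_(k in [set: int]) (F k%:~R ^+ 2)%:E)%E.

Variable lambda : nat -> R.
Hypothesis hlambda : forall n, 0 < lambda n.
Hypothesis lambda_cvg0 : lambda n @[n --> \oo] --> 0.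

(** The squares of [F] along the array average to their sum over the integers. By the Bessel
    inequality the error terms contribute [O(lambda n)] per row. *)
Lemma incr_covmx_energy :
  n%:R^-1 * \sum_(j < n) \sum_(k < n) covmx (lambda n) n j k ^+ 2 @[n --> \oo] -->
  c0 ^+ 2 * ft_energy.
Proof.
have [A HA] := gsp_ft_sqr_bound.
have [K K0 HK] := error_sqr_bound.
pose SF n := \sum_(j < n) \sum_(k < n) F (j%:R - k%:R) ^+ 2.
have F2_ge0 x : 0 <= F x ^+ 2 by exact: sqr_ge0.
have F2_even x : F (- x) ^+ 2 = F x ^+ 2 by rewrite /F cos_moment_even.
have cF : n%:R^-1 * SF n @[n --> \oo] --> ft_energy.
  exact: (cvg_toeplitz_mean F2_ge0 F2_even HA).
pose SC n := \sum_(j < n) \sum_(k < n) (F (j%:R - k%:R) - e (lambda n) (j%:R - k%:R)) ^+ 2.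
suff cC : n%:R^-1 * SC n @[n --> \oo] --> ft_energy.
  rewrite (_ : (fun n => _) = (fun n => c0 ^+ 2 * (n%:R^-1 * SC n))).
    by apply: cvgM => //; exact: cvg_cst.
  apply/funext => n; rewrite mulrCA; congr (_ * _); rewrite /SC mulr_sumr; apply: eq_bigr => j _.
  by rewrite mulr_sumr; apply: eq_bigr => k _; rewrite mxE incr_covE exprMn.
(* The perturbation parameter of [sqr_sub_perturb] is [sqrt (lambda n)], which makes both of its
   terms vanish in the limit. *)
pose bd n := 2 * K * (lambda n + Num.sqrt (lambda n)) + Num.sqrt (lambda n) * (2 * A).
have diff n : `|n%:R^-1 * SC n - n%:R^-1 * SF n| <= bd n.
  have l0 := hlambda n; set s := Num.sqrt (lambda n).
  have s0 : 0 < s by rewrite sqrtr_gt0.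
  have e2_ge0 x : 0 <= e (lambda n) x ^+ 2 by exact: sqr_ge0.
  have e2_even x : e (lambda n) (- x) ^+ 2 = e (lambda n) x ^+ 2 by rewrite /e cos_moment_even.
  have he := toeplitz_sum_le e2_ge0 e2_even (HK _ l0) n.
  have hF := toeplitz_sum_le F2_ge0 F2_even HA n.
  have : `|SC n - SF n| <= (1 + s^-1) * (\sum_(j < n) \sum_(k < n) e (lambda n) (j%:R - k%:R) ^+ 2) + s * SF n.
    rewrite /SC /SF -sumrB !mulr_sumr -big_split/=.
    apply: le_trans (ler_norm_sum _ _ _) _; apply: ler_sum => j _.
    rewrite -sumrB !mulr_sumr -big_split/=.
    apply: le_trans (ler_norm_sum _ _ _) _; apply: ler_sum => k _.
    exact: sqr_sub_perturb.
  move=> h; rewrite -mulrBr normrM ger0_norm ?invr_ge0//.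
  have [->|n0] := posnP n.
    rewrite invr0 mul0r /bd -/s; have A0 : 0 <= A by apply: le_trans (HA 0%N); rewrite big_ord0.
    apply: addr_ge0; first by apply: mulr_ge0; [exact: mulr_ge0|rewrite addr_ge0// ltW].
    by apply: mulr_ge0 => //; exact: mulr_ge0.
  have nr : 0 < n%:R :> R by rewrite ltr0n.
  rewrite ler_pdivrMl//; apply: le_trans h _; rewrite /bd -/s mulrDr; apply: lerD.
    have -> : 2 * K * (lambda n + s) = (1 + s^-1) * (2 * (K * lambda n)).
      have -> : lambda n = s ^+ 2 by rewrite sqr_sqrtr// ltW.
      by field; rewrite gt_eqF.
    by rewrite mulrCA ler_wpM2l// addr_ge0// invr_ge0 ltW.
  by rewrite mulrCA ler_wpM2l// ltW.
have cs : Num.sqrt (lambda n) @[n --> \oo] --> 0.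
  rewrite -[X in _ --> X](@sqrtr0 R).
  by apply: (@cvg_comp _ _ _ lambda (@Num.sqrt R) _ _ _ lambda_cvg0); exact: sqrt_continuous.
have cbd : bd n @[n --> \oo] --> 0.
  rewrite [X in _ --> X](_ : 0 = 2 * K * (0 + 0) + 0 * (2 * A)); last by ring.
  apply: cvgD; last by apply: cvgM => //; exact: cvg_cst.
  by apply: cvgM; [exact: cvg_cst|exact: cvgD].
apply: (cvg_sub0 _ cF); apply: norm_cvg0.
apply: (@squeeze_cvgr _ _ _ _ (fun=> 0) bd) => //; last exact: cvg_cst.
by apply: nearW => n; rewrite normr_ge0/=; exact: diff.
Qed.

End covariance_asymptotics.

(** * Central limit theorem for the mean square *)

Section mesh.
Context (R : realType) (lambda : nat -> R).
Hypothesis hlambda : forall n, 0 < lambda n.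
Hypothesis hlambda_o : lambda =o_\oo (fun n : nat => n%:R `^ (- 4^-1)).

Lemma mesh_le (eps : R) : 0 < eps -> \forall n \near \oo, lambda n <= eps * n%:R `^ (- 4^-1).
Proof.
move=> e0; have /eqoP/(_ _ e0) := hlambda_o; apply: filterS => n.
by rewrite (gtr0_norm (hlambda n)) (ger0_norm (powR_ge0 _ _)).
Qed.

Lemma mesh_cvg0 : lambda n @[n --> \oo] --> 0.
Proof.
apply/cvgr0Pnorm_le => eps e0; near=> n.
have n1 : (0 < n)%N by near: n; exact: nbhs_infty_gt.
rewrite (gtr0_norm (hlambda n)).
have : lambda n <= eps * n%:R `^ (- 4^-1) by near: n; exact: mesh_le.
move=> h; apply: le_trans h _; rewrite ler_piMr ?(ltW e0)//.
apply: le_trans (powRN_nonincr _ ltr01 _) _; rewrite ?powR1 ?ler1n//.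
Unshelve. all: by end_near. Qed.

(** The bias of the mean square is of order [lambda n ^+ 2]; the rate of the mesh is what makes it
    negligible after multiplication by [sqrt n]. *)
Lemma mesh_sqr_cvg0 : Num.sqrt n%:R * lambda n ^+ 2 @[n --> \oo] --> 0.
Proof.
apply/cvgr0Pnorm_le => eps e0.
have se : 0 < Num.sqrt eps by rewrite sqrtr_gt0.
near=> n.
have n1 : (0 < n)%N by near: n; exact: nbhs_infty_gt.
have n0 : 0 < n%:R :> R by rewrite ltr0n.
have : lambda n <= Num.sqrt eps * n%:R `^ (- 4^-1) by near: n; exact: mesh_le.
move=> h; rewrite ger0_norm; last by rewrite mulr_ge0 ?sqr_ge0.
have h2 : lambda n ^+ 2 <= eps * (Num.sqrt n%:R)^-1.
  have -> : eps * (Num.sqrt n%:R)^-1 = (Num.sqrt eps * n%:R `^ (- 4^-1)) ^+ 2.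
    rewrite exprMn sqr_sqrtr ?(ltW e0)// -powR_mulrn ?powR_ge0// -powRrM.
    by rewrite -powR12_sqrt ?(ltW n0)// -powRN; congr (_ * _ `^ _); field.
  by rewrite lerXn2r ?nnegrE ?(ltW (hlambda n))// mulr_ge0 ?powR_ge0// ltW.
have s0 : 0 < Num.sqrt n%:R :> R by rewrite sqrtr_gt0.
by rewrite mulrC -ler_pdivlMr.
Unshelve. all: by end_near. Qed.

End mesh.

Section clt.
Context (R : realType) (dim : nat) (beta theta : R).
Hypothesis hbeta : 0 < beta < Num.min 2 dim%:R.
Hypothesis htheta : 0 < theta.
Context (d : measure_display) (Omega : measurableType d) (P : probability Omega R).
Variable u : R -> 'rV[R]_dim -> {RV P >-> R}.
Hypothesis hu : wave_solution beta theta u.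
Variable t : R.
Hypothesis ht : 0 < t.
Variable rho : 'rV[R]_dim.
Hypothesis hrho : enorm rho = 1.
Variable lambda : nat -> R.
Hypothesis hlambda : forall n, 0 < lambda n.
Hypothesis hlambda_o : lambda =o_\oo (fun n : nat => n%:R `^ (- 4^-1)).
Local Notation c0 := (spectral_const dim theta t).
Local Notation covmx := (incr_covmx beta theta t rho).
Local Notation F0 := (gsp_ft beta rho 0).
Local Notation S := (ft_energy beta rho).

Definition mean_sq (n : nat) (w : Omega) : R :=
  n%:R^-1 * lambda n `^ (beta - 2) * V_sp u t rho n (lambda n) w.

Definition centred_mean_sq (n : nat) (w : Omega) : R :=
  Num.sqrt n%:R * (mean_sq n w - c0 * F0).

Lemma mean_sqE n w : mean_sq n w = n%:R^-1 * \sum_(k < n) scaled_incr beta u t rho (lambda n) k w ^+ 2.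
Proof.
rewrite /mean_sq -mulrA; congr (_ * _); rewrite /V_sp big_add1/= big_mkord mulr_sumr.
apply: eq_bigr => k _; rewrite /scaled_incr exprMn; congr (_ * _).
by rewrite expr2 -(powR_split _ _ (hlambda n)); congr (_ `^ _); field.
Qed.

(** At [s = a / sqrt n], [tilt_prod_log] gives the logarithm up to [O(n^(-1/2))]. Its linear term is
    the centring up to the bias, and its quadratic term converges by [incr_covmx_energy]. *)
Lemma mgf_centred_mean_sq (a : R) :
  (\int[P]_w (expR (a * centred_mean_sq n w))%:E)%E @[n --> \oo] --> (expR (a ^+ 2 * (c0 ^+ 2 * S)))%:E.
Proof.
have [C C0 HC] := incr_covmx_opnorm hbeta htheta ht hrho.
have [K K0 HK] := bias_bound hbeta htheta ht hrho.
have c00 := spectral_const_gt0 dim htheta ht.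
pose e0 n := cos_moment beta rho (sinc_w (2 * t * Num.sqrt theta / lambda n)) 0.
pose q n := n%:R^-1 * \sum_(j < n) \sum_(k < n) covmx (lambda n) n j k ^+ 2.
have cq : q n @[n --> \oo] --> c0 ^+ 2 * S.
  exact: (incr_covmx_energy hbeta htheta ht hrho hlambda (mesh_cvg0 hlambda hlambda_o)).
pose T := a ^+ 2 * (c0 ^+ 2 * S).
pose bd n := 100 * (`|a| * C) ^+ 3 * (Num.sqrt n%:R)^-1 +
  `|a| * c0 * K * (Num.sqrt n%:R * lambda n ^+ 2) + a ^+ 2 * `|q n - c0 ^+ 2 * S|.
have csq : (Num.sqrt n%:R)^-1 @[n --> \oo] --> (0 : R).
  rewrite (_ : (fun n => _) = (fun n => Num.sqrt (n%:R^-1))); last first.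
    by apply/funext => n; rewrite sqrtrV.
  rewrite -[X in _ --> X](@sqrtr0 R).
  by apply: (cvg_comp _ _ (@cvg_invn R)); exact: sqrt_continuous.
have cbd : bd n @[n --> \oo] --> 0.
  rewrite [X in _ --> X](_ : 0 = 100 * (`|a| * C) ^+ 3 * 0 + `|a| * c0 * K * 0 + a ^+ 2 * `|c0 ^+ 2 * S - c0 ^+ 2 * S|); last first.
    by rewrite subrr normr0 !mulr0 !addr0.
  apply: cvgD; first apply: cvgD.
  - by apply: cvgM => //; exact: cvg_cst.
  - by apply: cvgM; [exact: cvg_cst|exact: mesh_sqr_cvg0].
  - apply: cvgM; first exact: cvg_cst.
    by apply: cvg_norm; apply: cvgB => //; exact: cvg_cst.
have nearC : \forall n \near \oo, `|a| * (Num.sqrt n%:R)^-1 * C <= 8^-1.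
  have h : `|a| * (Num.sqrt n%:R)^-1 * C @[n --> \oo] --> `|a| * 0 * C.
    by apply: cvgM; [apply: cvgM => //; exact: cvg_cst|exact: cvg_cst].
  rewrite mulr0 mul0r in h; have e8 : 0 < 8^-1 :> R by [].
  have /cvgr0Pnorm_le/(_ _ e8) := h; apply: filterS => n; exact: le_trans (ler_norm _).
have main : \forall n \near \oo, exists2 L,
    (\int[P]_w (expR (a * centred_mean_sq n w))%:E = (expR L)%:E)%E & `|L - T| <= bd n.
  near=> n.
  have n1 : (0 < n)%N by near: n; exact: nbhs_infty_gt.
  have n0 : 0 < n%:R :> R by rewrite ltr0n.
  have s0 : 0 < Num.sqrt n%:R :> R by rewrite sqrtr_gt0.
  pose r := Num.sqrt n%:R : R.
  have r0 : 0 < r by [].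
  have nE : n%:R = r ^+ 2 :> R by rewrite sqr_sqrtr// ltW.
  pose s := a / Num.sqrt n%:R.
  have ns : `|s| = `|a| / Num.sqrt n%:R by rewrite normrM normfV (gtr0_norm s0).
  have sC : `|s| * C <= 8^-1.
    by rewrite ns; near: n; exact: nearC.
  have l0 := hlambda n.
  have [L LE Lb] := tilt_prod_log (incr_covmx_sym beta theta t rho (lambda n) n) C0 (HC (lambda n) n) sC.
  exists (L - a * Num.sqrt n%:R * (c0 * F0)).
    have E w : expR (a * centred_mean_sq n w) =
        expR (- (a * Num.sqrt n%:R * (c0 * F0))) *
        expR (s * \sum_(k < n) scaled_incr beta u t rho (lambda n) k w ^+ 2).
      rewrite -expRD; congr expR; rewrite /centred_mean_sq mean_sqE.
      move: (\sum_(k < n) _) => X; rewrite /s -/r nE; field.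
      by rewrite gt_eqF.
    under eq_integral do rewrite E EFinM.
    rewrite ge0_integralZl//=; last first.
      apply/measurable_EFinP; apply: (measurableT_comp (measurable_expRM s)).
      by apply: measurable_sum => k; apply: measurable_funX; exact: measurable_scaled_incr.
    rewrite (mgf_sumsq (fun k : 'I_n => measurable_scaled_incr beta u t rho (lambda n) k)
      (fun v => law_scaled_incr hbeta htheta hu ht hrho v l0) (incr_covmx_sym beta theta t rho (lambda n) n)
      C0 (HC (lambda n) n) sC).
    by rewrite LE -EFinM -expRD addrC.
  have trE : \tr (covmx (lambda n) n) = n%:R * (c0 * (F0 - e0 n)) by exact: incr_covmx_trace.
  have hb := HK _ l0; rewrite -/(e0 n) in hb.
  have -> : L - a * Num.sqrt n%:R * (c0 * F0) - T =
     (L - (s * \tr (covmx (lambda n) n) + s ^+ 2 * \sum_i \sum_j covmx (lambda n) n i j ^+ 2)) +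
     (- (a * Num.sqrt n%:R * c0 * e0 n)) + a ^+ 2 * (q n - c0 ^+ 2 * S).
    rewrite trE /T /q; move: (\sum_i _) => X; rewrite /s -/r nE; field.
    by rewrite gt_eqF.
  apply: le_trans (ler_normD _ _) _; apply: lerD; last by rewrite normrM ger0_norm ?sqr_ge0.
  apply: le_trans (ler_normD _ _) _; apply: lerD.
    apply: le_trans Lb _; rewrite ns -/r nE le_eqVlt; apply/orP; left; apply/eqP; field.
    by rewrite gt_eqF.
  rewrite normrN (normrM _ (e0 n)) (normrM _ c0) (normrM a) (gtr0_norm s0) (gtr0_norm c00).
  have -> : `|a| * c0 * K * (Num.sqrt n%:R * lambda n ^+ 2) =
    `|a| * Num.sqrt n%:R * c0 * (K * lambda n ^+ 2) by ring.
  by apply: ler_wpM2l hb; rewrite mulr_ge0 ?(ltW c00)// mulr_ge0// ltW.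
pose E n := ln (fine (\int[P]_w (expR (a * centred_mean_sq n w))%:E)%E).
have cE : E n @[n --> \oo] --> T.
  apply: (@cvg_sub0 _ _ _ _ _ E (fun=> T)); last exact: cvg_cst.
  apply: norm_cvg0; apply: (@squeeze_cvgr _ _ _ _ (fun=> 0) bd) => //; last exact: cvg_cst.
  apply: filterS main => n [L LE Lb]; rewrite normr_ge0/=.
  have EL : E n = L by rewrite /E LE /= expRK.
  by rewrite -EL in Lb.
have cX : (expR (E n))%:E @[n --> \oo] --> (expR T)%:E.
  by apply: cvg_EFin; [exact: nearW|apply: (cvg_comp _ _ cE); exact: continuous_expR].
apply: cvg_trans cX; apply: near_eq_cvg.
by apply: filterS main => n [L LE Lb]; rewrite /E LE /= expRK.
Unshelve. all: by end_near. Qed.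

End clt.

(** * From the mean square to the estimator *)

Section cdf_transfer.
Context (R : realType).

(** The events of probability [e n] and [p n (xn n)] differ by an event that lies beyond every level
    [K]. Monotonicity squeezes [p n (xn n)] between the values at two fixed points near [x]. *)
Lemma cdf_transfer (p : nat -> R -> R) (e : nat -> R) (G : R -> R) (x : R) (xn : nat -> R) :
  (forall n r r', r <= r' -> p n r <= p n r') ->
  (forall r, p n r @[n --> \oo] --> G r) ->
  {for x, continuous G} -> (forall eps, 0 < eps -> exists K, 1 - eps <= G K) ->
  xn n @[n --> \oo] --> x ->
  (\forall n \near \oo, p n (xn n) <= e n) ->
  (forall K, \forall n \near \oo, e n <= p n (xn n) + (1 - p n K)) ->
  e n @[n --> \oo] --> G x.
Proof.
move=> pmono pG Gx G1 xnx lo hi.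
apply/cvgrPdist_le => eps e0; have e4 : 0 < eps / 4 by rewrite divr_gt0.
have /cvgrPdist_le/(_ _ e4)/nbhs_ballP[dl /= dl0 Hd] := Gx.
have [K GK] := G1 _ e4.
have d2 : 0 < dl / 2 by rewrite divr_gt0.
have /cvgrPdist_le/(_ _ d2) near_x := xnx.
have /cvgrPdist_le/(_ _ e4) near_m := pG (x - dl / 2).
have /cvgrPdist_le/(_ _ e4) near_p := pG (x + dl / 2).
have /cvgrPdist_le/(_ _ e4) near_K := pG K.
have Gm : `|G x - G (x - dl / 2)| <= eps / 4.
  by apply: Hd; rewrite /ball/= opprB addrC subrK gtr0_norm// ltr_pdivrMr// ltr_pMr// ltr1n.
have Gp : `|G x - G (x + dl / 2)| <= eps / 4.
  by apply: Hd; rewrite /ball/= opprD addNKr normrN gtr0_norm// ltr_pdivrMr// ltr_pMr// ltr1n.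
near=> n.
have h1 : `|x - xn n| <= dl / 2 by near: n.
have h2 : `|G (x - dl / 2) - p n (x - dl / 2)| <= eps / 4 by near: n.
have h3 : `|G (x + dl / 2) - p n (x + dl / 2)| <= eps / 4 by near: n.
have h4 : `|G K - p n K| <= eps / 4 by near: n.
have h5 : p n (xn n) <= e n by near: n.
have h6 : e n <= p n (xn n) + (1 - p n K) by near: n; exact: hi.
move: h1; rewrite ler_norml => /andP[h1a h1b].
have m1 : p n (x - dl / 2) <= p n (xn n) by apply: pmono; lra.
have m2 : p n (xn n) <= p n (x + dl / 2) by apply: pmono; lra.
move: Gm Gp h2 h3 h4; rewrite !ler_norml => /andP[? ?] /andP[? ?] /andP[? ?] /andP[? ?] /andP[? ?].
apply/andP; split; lra.
Unshelve. all: by end_near. Qed.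

End cdf_transfer.

Section gaussian_cdf.
Context (R : realType) (v : R).
Hypothesis v0 : 0 < v.

Lemma gaussian_cdf_lipschitz (a b : R) : a <= b ->
  fine (gaussian_law 0 v `]-oo, b]%classic) - fine (gaussian_law 0 v `]-oo, a]%classic) <=
  normal_peak (Num.sqrt v) * (b - a).
Proof.
move=> ab.
have mab : measurable (`]a, b]%classic : set (measurableTypeR R)) by exact: measurable_itv.
have -> : `]-oo, b]%classic = `]-oo, a]%classic `|` `]a, b]%classic :> set R.
  apply/seteqP; split => z /=; rewrite !in_itv/=.
    by move=> zb; have [za|za] := leP z a; [left|right; rewrite zb].
  by case=> [za|/andP[]//]; exact: le_trans ab.
rewrite measureU//; last first.
  apply/seteqP; split => z //=; rewrite !in_itv/= => -[za /andP[az _]].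
  by move: (le_lt_trans za az); rewrite ltxx.
have f1 A : measurable A -> (gaussian_law 0 v A) \is a fin_num by move=> mA; exact: fin_num_measure.
rewrite fineD ?f1//.
rewrite addrAC subrr add0r -lee_fin fineK ?f1//.
rewrite /gaussian_law gt_eqF//=.
have sv : Num.sqrt v != 0 by rewrite gt_eqF// sqrtr_gt0.
apply: (@le_trans _ _ (\int[lebesgue_measure]_(z in `]a, b]) (normal_peak (Num.sqrt v))%:E)%E).
  apply: ge0_le_integral => //=.
  - by move=> z _; rewrite lee_fin normal_pdf_ge0.
  - by apply/measurable_EFinP; apply: measurable_funTS; exact: measurable_normal_pdf.
  - by move=> z _; rewrite lee_fin normal_pdf_ub.
rewrite integral_cst//= lebesgue_measure_itv/= lte_fin.
case: ifPn => [_|_]; first by rewrite -EFinB -EFinM.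
by rewrite mule0 lee_fin mulr_ge0 ?subr_ge0// normal_peak_ge0.
Qed.

Lemma gaussian_cdf_continuous : continuous (fun r => fine (gaussian_law 0 v `]-oo, r]%classic)).
Proof.
have sv : 0 < Num.sqrt v by rewrite sqrtr_gt0.
have pk : 0 < normal_peak (Num.sqrt v) by exact: normal_peak_gt0 (lt0r_neq0 sv).
have mono (r r' : R) : r <= r' ->
    fine (gaussian_law 0 v `]-oo, r]%classic) <= fine (gaussian_law 0 v `]-oo, r']%classic).
  move=> rr; apply: fine_le; rewrite ?fin_num_measure//.
  apply: le_measure; rewrite ?inE// => z /=; rewrite !in_itv/= => zr.
  exact: le_trans rr.
move=> x; apply/cvgrPdist_le => eps e0.
have d0 : 0 < eps / normal_peak (Num.sqrt v) by rewrite divr_gt0.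
near=> z.
have : `|x - z| <= eps / normal_peak (Num.sqrt v).
  by near: z; exact: (nbhs_ball_norm x d0) || apply: cvgr_dist_le.
rewrite ler_pdivlMr// mulrC => h; apply: le_trans h.
have [xz|zx] := leP x z.
  rewrite distrC [X in _ <= _ * X]distrC !ger0_norm ?subr_ge0//; last exact: mono.
  exact: gaussian_cdf_lipschitz.
rewrite !ger0_norm ?subr_ge0 ?(ltW zx)//; last by apply: mono; exact: ltW.
by apply: gaussian_cdf_lipschitz; exact: ltW.
Unshelve. all: by end_near. Qed.

Lemma gaussian_cdf_cvg1 eps : 0 < eps -> exists K, 1 - eps <= fine (gaussian_law 0 v `]-oo, K]%classic).
Proof.
move=> e0.
have mid : @measurable_fun _ _ (measurableTypeR R) R setT (fun x : measurableTypeR R => x : R) by exact: measurable_id.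
pose X : {RV (gaussian_law 0 v) >-> R} :=
  HB.pack (fun x : measurableTypeR R => x : R) (isMeasurableFun.Build _ _ _ _ _ mid).
have := cvg_cdfy1 X => /fine_cvg /= /cvgrPdist_le/(_ _ e0).
move=> /filter_ex[K]; rewrite ler_norml => /andP[_ h]; exists K.
by move: h; rewrite /cdf /distribution /= /pushforward; lra.
Qed.

End gaussian_cdf.

Section constants.
Context (R : realType) (dim : nat) (beta theta : R).
Hypothesis hbeta : 0 < beta < Num.min 2 dim%:R.
Hypothesis htheta : 0 < theta.
Variable t : R.
Hypothesis ht : 0 < t.
Variable rho : 'rV[R]_dim.
Hypothesis hrho : enorm rho = 1.
Local Notation vec := 'rV[R]_dim.
Local Notation leb := (lebesgue_rV R dim).
Local Notation g := (g_sp beta rho).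
Local Notation F0 := (gsp_ft beta rho 0).
Local Notation S := (ft_energy beta rho).
Local Notation c0 := (spectral_const dim theta t).

(** The function [g_sp] is positive on a small cube around [rho]. *)
Lemma gsp_ft0_gt0 : 0 < F0.
Proof.
rewrite gsp_ft0 lt_neqAle eq_sym; apply/andP; split; last first.
  by apply: Rintegral_ge0 => w _; exact: g_sp_ge0.
apply/negP => /eqP int0.
have d0 : 0 < dim%:R :> R by rewrite ltr0n (dim_gt0 hbeta).
pose eta : R := (2 * dim%:R)^-1.
have eta0 : 0 < eta by rewrite invr_gt0 mulr_gt0.
pose A (i : 'I_dim) : set R := `](rho 0 i - eta), (rho 0 i + eta)[%classic.
pose Q : set vec := [set x | forall i, A i (x ord0 i)].
have muA i : lebesgue_measure (A i) = (2 * eta)%:E.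
  rewrite lebesgue_measure_itv/= lte_fin ifT; last by lra.
  by rewrite -EFinB; congr EFin; ring.
have muQ : leb Q = ((2 * eta) ^+ dim)%:E.
  rewrite /Q lebesgue_rV_box; last by move=> i; exact: measurable_itv.
  by rewrite (eq_bigr (fun=> (2 * eta)%:E))// prodEFin big_const card_ord iter_mulr mulr1.
have gQ x : Q x -> 0 < g x.
  move=> Qx.
  have hd : `|dot rho x - 1| <= 2^-1.
    have -> : dot rho x - 1 = \sum_i rho 0 i * (x 0 i - rho 0 i).
      have -> : 1 = dot rho rho by rewrite -sqr_enorm hrho expr1n.
      by rewrite /dot -sumrB; apply: eq_bigr => i _; ring.
    apply: le_trans (ler_norm_sum _ _ _) _.
    apply: (@le_trans _ _ (\sum_(i < dim) eta)).
      apply: ler_sum => i _; rewrite normrM -[leRHS]mul1r ler_pM//.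
        by rewrite -hrho; exact: normr_coord_le_enorm.
      have := Qx i; rewrite /A/= in_itv/= => /andP[h1 h2].
      rewrite ler_norml; apply/andP; split; lra.
    rewrite sumr_const card_ord -mulr_natr /eta le_eqVlt; apply/orP; left; apply/eqP.
    by field; rewrite gt_eqF.
  move: hd; rewrite ler_norml => /andP[h1 h2].
  have s0 : 0 < sin (dot rho x / 2).
    apply: sin_gt0_pihalf; have := @pi_ge2 R; move=> hpi; apply/andP; split; lra.
  rewrite mulr_gt0 ?exprn_gt0// powR_gt0// lt_neqAle enorm_ge0 andbT eq_sym.
  apply/eqP => e0; have := dot_le_enorm rho x; rewrite e0 mulr0 ler_norml => /andP[_ h3].
  lra.
have mQ : measurable Q.
  rewrite (_ : Q = \bigcap_(i in [set: 'I_dim]) ((fun x : vec => x ord0 i) @^-1` A i)); last first.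
    by apply/seteqP; split => [x Qx i _|x Qx i]; exact: Qx.
  apply: fin_bigcap_measurable => // i _; rewrite -[X in measurable X]setTI.
  by apply: measurable_coord_rV => //; exact: measurable_itv.
have E0 : (\int[leb]_w `|(g w)%:E| = 0)%E.
  transitivity (\int[leb]_w (g w)%:E)%E.
    by apply: eq_integral => w _; rewrite /= ger0_norm// g_sp_ge0.
  by rewrite integral_EFinE ?int0//; exact: integrable_g_sp.
have mg : measurable_fun setT (fun w => (g w)%:E) by apply/measurable_EFinP; exact: measurable_g_sp.
have [N [mN N0 sub]] := (ae_eq_integral_abs leb measurableT mg).1 E0.
have QN : Q `<=` N.
  move=> x /gQ gx; apply: sub => /= /(_ I) /eqP; rewrite eqe => /eqP gx0.
  by rewrite gx0 ltxx in gx.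
have : (leb Q <= leb N)%E by apply: le_measure => //; rewrite inE.
rewrite N0 muQ lee_fin; apply/negP; rewrite -ltNge exprn_gt0// mulr_gt0//.
Qed.

Lemma C_sp_EE : C_sp_E beta rho = 8 / (2 * pi) ^+ dim * F0.
Proof.
rewrite /C_sp_E gsp_ft0 Lnorm1; congr (_ * _); rewrite /Rintegral; congr fine.
by apply: eq_integral => w _ /=; rewrite ger0_norm// g_sp_ge0.
Qed.

Lemma C_sp_VE : C_sp_V beta rho = 128 / (2 * pi) ^+ (2 * dim) * S.
Proof.
rewrite /C_sp_V /ft_energy; congr (_ * fine _); apply: eq_esum => k _; congr (_ ^+ 2)%:E.
apply: eq_Rintegral => w _; by rewrite dotZl mul1r.
Qed.

Lemma ft_energy_gt0 : 0 < S.
Proof.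
have [A HA] := gsp_ft_sqr_bound hbeta hrho.
apply: lt_le_trans (_ : F0 ^+ 2 <= _); first by rewrite exprn_gt0// gsp_ft0_gt0.
have F2_ge0 x : 0 <= gsp_ft beta rho x ^+ 2 by exact: sqr_ge0.
have F2_even x : gsp_ft beta rho (- x) ^+ 2 = gsp_ft beta rho x ^+ 2 by rewrite /gsp_ft cos_moment_even.
have h := cvg_esum_int_even F2_ge0 F2_even HA.
apply: (cvgr_to_ge h); apply: nearW => n.
rewrite big_ord_recl/=.
by rewrite -addrA lerDl addr_ge0// sumr_ge0.
Qed.

Lemma tC_sp_E : t * C_sp_E beta rho = theta * (c0 * F0).
Proof.
rewrite C_sp_EE /spectral_const; field.
by rewrite gt_eqF// expf_neq0// mulf_neq0// gt_eqF// pi_gt0.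
Qed.

Lemma limit_variance :
  (theta / (c0 * F0)) ^+ 2 * (2 * (c0 ^+ 2 * S)) = theta ^+ 2 * C_sp_V beta rho / C_sp_E beta rho ^+ 2.
Proof.
have F00 := gsp_ft0_gt0; have c00 := spectral_const_gt0 dim htheta ht.
rewrite C_sp_EE C_sp_VE mulnC exprM.
have p0 : (2 * pi) ^+ dim != 0 :> R by rewrite expf_neq0// mulf_neq0// gt_eqF// pi_gt0.
field.
by rewrite p0 !gt_eqF.
Qed.

End constants.

Section ratio.
Context (R : realType).

(** The ratio decreases in [A], so both errors cross their thresholds at [A = theta * m / (theta + x
    / r)]. The second disjunct is the case [A = 0], where the ratio is [0] by convention. *)
Lemma ratio_error_le (m theta r x A : R) : 0 < m -> 0 < theta -> 0 < r -> 0 <= A ->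
  0 < theta + x / r ->
  (- (theta / m) * (r * (A - m)) <= theta * x / (theta + x / r) -> r * (theta * m / A - theta) <= x) /\
  (r * (theta * m / A - theta) <= x ->
    - (theta / m) * (r * (A - m)) <= theta * x / (theta + x / r) \/
    theta * r <= - (theta / m) * (r * (A - m))).
Proof.
move=> m0 th0 r0 A0; set z := theta + x / r => z0.
have xE : x = r * (z - theta) by rewrite /z; field; rewrite gt_eqF.
have lin : (- (theta / m) * (r * (A - m)) <= theta * x / z) = (theta * m <= z * A).
  rewrite -[LHS]subr_ge0 -[RHS]subr_ge0.
  have -> : theta * x / z - - (theta / m) * (r * (A - m)) = theta * r / (m * z) * (z * A - theta * m).
    by rewrite xE; field; rewrite !gt_eqF.
  by rewrite pmulr_rge0// divr_gt0// mulr_gt0.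
rewrite lin {1 2}xE !ler_pM2l// !lerBlDr subrK.
have [Ap|] := ltP 0 A; first by rewrite ler_pdivrMr//; split => // h; left.
move=> A0'; have -> : A = 0 by apply/eqP; rewrite eq_le A0 A0'.
split; first by rewrite mulr0 leNgt mulr_gt0.
move=> _; right; rewrite le_eqVlt; apply/orP; left; apply/eqP; field.
by rewrite gt_eqF.
Qed.

End ratio.

Section delta_method.
Context (R : realType) (dim : nat) (beta theta : R).
Hypothesis hbeta : 0 < beta < Num.min 2 dim%:R.
Hypothesis htheta : 0 < theta.
Context (d : measure_display) (Omega : measurableType d) (P : probability Omega R).
Variable u : R -> 'rV[R]_dim -> {RV P >-> R}.
Hypothesis hu : wave_solution beta theta u.
Variable t : R.
Hypothesis ht : 0 < t.
Variable rho : 'rV[R]_dim.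
Hypothesis hrho : enorm rho = 1.
Variable lambda : nat -> R.
Hypothesis hlambda : forall n, 0 < lambda n.
Hypothesis hlambda_o : lambda =o_\oo (fun n : nat => n%:R `^ (- 4^-1)).
Local Notation c0 := (spectral_const dim theta t).
Local Notation F0 := (gsp_ft beta rho 0).
Local Notation S := (ft_energy beta rho).

Let m0 : R := c0 * F0.
Let m0_gt0 : 0 < m0.
Proof. by rewrite mulr_gt0 ?(gsp_ft0_gt0 hbeta hrho)// (spectral_const_gt0 dim htheta ht). Qed.

Let v : R := (theta / m0) ^+ 2 * (2 * (c0 ^+ 2 * S)).
Let v_gt0 : 0 < v.
Proof.
have c00 := spectral_const_gt0 dim htheta ht; have S0 := ft_energy_gt0 hbeta hrho.
by rewrite mulr_gt0 ?exprn_gt0 ?divr_gt0// mulr_gt0// mulr_gt0// exprn_gt0.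
Qed.

(** The tangent, at the limit of the mean square, of the error as a function of the mean square. *)
Definition linear_error (n : nat) (w : Omega) : R :=
  - (theta / (c0 * F0)) * centred_mean_sq beta theta u t rho lambda n w.

Let mZ n : measurable_fun setT (linear_error n).
Proof.
apply: measurable_funM => //; apply: measurable_funM => //; apply: measurable_funB => //.
by apply: measurable_funM => //; exact: measurable_V_sp.
Qed.

Let Z n : {mfun Omega >-> measurableTypeR R} :=
  HB.pack (linear_error n) (isMeasurableFun.Build _ _ _ (measurableTypeR R) (linear_error n) (mZ n)).

Lemma linear_error_cdf y :
  P [set w | linear_error n w <= y] @[n --> \oo] --> gaussian_law 0 v `]-oo, y]%classic.
Proof.
have cdfE n : P [set w | linear_error n w <= y] = distribution P (Z n) `]-oo, y]%classic.
  by rewrite /distribution /= /pushforward; congr (P _); apply/seteqP; split => w /=; rewrite in_itv.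
under eq_cvg do rewrite cdfE.
have v0 := ltW v_gt0.
apply: (@cdf_cvg_mgf R (fun n => distribution P (Z n)) (gaussian_law 0 v) (fun s => expR (s ^+ 2 * v / 2))).
- move=> s; pose a := s * (- (theta / m0)).
  have := @mgf_centred_mean_sq _ _ _ _ hbeta htheta _ _ _ _ hu _ ht _ hrho _ hlambda hlambda_o a.
  have -> : a ^+ 2 * (c0 ^+ 2 * S) = s ^+ 2 * v / 2 by rewrite /a /v; field; rewrite gt_eqF.
  apply: cvg_trans; apply: near_eq_cvg; apply: nearW => n /=.
  rewrite ge0_integral_distribution//; last by apply/measurable_EFinP; exact: measurable_expRM.
  rewrite (_ : (fun w => _) = (fun x : measurableTypeR R => (expR (s * x))%:E) \o Z n)//.
  by apply/funext => w /=; rewrite /linear_error (mulrA s).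
- by move=> s; rewrite integral_expR_gaussian_law.
- apply: cvg_trans (_ : (fine (gaussian_law 0 v `]-oo, r]%classic))%:E @[r --> y] --> _).
    by apply: near_eq_cvg; apply: nearW => r; rewrite fineK// fin_num_measure.
  rewrite -[X in _ --> X]fineK ?fin_num_measure//; apply: cvg_EFin; first exact: nearW.
  exact: gaussian_cdf_continuous.
Qed.

(** The linear error is asymptotically normal by [mgf_centred_mean_sq] and [cdf_cvg_mgf]. For the
    error itself the threshold [x] becomes [xn n], which tends to [x], and the event that the mean
    square vanishes is negligible because there the linear error is [theta * sqrt n]. *)
Theorem asymptotic_normality :
  cvg_in_law P (fun n => error_sp beta u t rho theta n (lambda n))
    (gaussian_law 0 (theta ^+ 2 * C_sp_V beta rho / C_sp_E beta rho ^+ 2)).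
Proof.
rewrite -(limit_variance hbeta htheta ht hrho) -/m0 -/v => x _.
pose p n r := fine (P [set w | linear_error n w <= r]).
pose e n := fine (P [set w | error_sp beta u t rho theta n (lambda n) w <= x]).
pose G r := fine (gaussian_law 0 v `]-oo, r]%classic).
pose tn n := theta + x / Num.sqrt n%:R.
pose xn n := theta * x / tn n.
have mset (f : Omega -> R) r : measurable_fun setT f -> measurable [set w | f w <= r].
  move=> mf; rewrite (_ : [set _ | _] = f @^-1` `]-oo, r]%classic); last first.
    by apply/seteqP; split => w /=; rewrite in_itv.
  by rewrite -[X in measurable X]setTI; apply: mf => //; exact: measurable_itv.
have me n : measurable [set w | error_sp beta u t rho theta n (lambda n) w <= x].
  by apply: mset; exact: measurable_error_sp.
have csq : (Num.sqrt n%:R)^-1 @[n --> \oo] --> (0 : R).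
  rewrite (_ : (fun n => _) = (fun n => Num.sqrt (n%:R^-1))); last first.
    by apply/funext => n; rewrite sqrtrV.
  rewrite -[X in _ --> X](@sqrtr0 R).
  by apply: (cvg_comp _ _ (@cvg_invn R)); exact: sqrt_continuous.
have ctn : tn n @[n --> \oo] --> theta.
  rewrite -[X in _ --> X]addr0 -(mulr0 x).
  by apply: cvgD; [exact: cvg_cst|apply: cvgM => //; exact: cvg_cst].
have cxn : xn n @[n --> \oo] --> x.
  rewrite [X in _ --> X](_ : x = theta * x / theta); last by field; rewrite gt_eqF.
  by apply: cvgM; [exact: cvg_cst|apply: cvgV => //; rewrite gt_eqF].
have tn0 : \forall n \near \oo, 0 < tn n by apply: (cvgr_gt theta).
have compare n w : (0 < n)%N -> 0 < tn n ->
   (linear_error n w <= xn n -> error_sp beta u t rho theta n (lambda n) w <= x) /\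
   (error_sp beta u t rho theta n (lambda n) w <= x ->
     linear_error n w <= xn n \/ theta * Num.sqrt n%:R <= linear_error n w).
  move=> n0 tn0'.
  have s0 : 0 < Num.sqrt n%:R :> R by rewrite sqrtr_gt0 ltr0n.
  have A0 : 0 <= mean_sq beta u t rho lambda n w.
    by rewrite (mean_sqE beta u t rho hlambda) mulr_ge0// sumr_ge0// => k _; exact: sqr_ge0.
  rewrite /linear_error /centred_mean_sq /error_sp /theta_hat_sp.
  have tC : t * C_sp_E beta rho = theta * m0 by exact: tC_sp_E.
  rewrite -/(mean_sq beta u t rho lambda n w) -/m0 tC.
  exact: ratio_error_le.
have ce : e n @[n --> \oo] --> G x.
  apply: (@cdf_transfer R p e G x xn) => //.
  - move=> n r r' rr; apply: fine_le; rewrite ?fin_num_measure//; try exact: mset.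
    by apply: le_measure; rewrite ?inE; [exact: mset|exact: mset|move=> w /= h; exact: le_trans rr].
  - move=> r; apply: fine_cvg; rewrite fineK ?fin_num_measure//.
    exact: linear_error_cdf.
  - exact: gaussian_cdf_continuous.
  - by move=> eps e0; exact: gaussian_cdf_cvg1.
  - near=> n; apply: fine_le; rewrite ?fin_num_measure//; try exact: mset.
    apply: le_measure; rewrite ?inE; [exact: mset|exact: me|move=> w /=].
    by apply: (compare n w _ _).1; near: n; [exact: nbhs_infty_gt|exact: tn0].
  - move=> K; have K0 : 0 < theta / (`|K| + 1) by rewrite divr_gt0// ltr_wpDl.
    have sK : \forall n \near \oo, (Num.sqrt n%:R)^-1 < theta / (`|K| + 1) by apply: (cvgr_lt 0).
    near=> n.
    have n0 : (0 < n)%N by near: n; exact: nbhs_infty_gt.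
    have s0 : 0 < Num.sqrt n%:R :> R by rewrite sqrtr_gt0 ltr0n.
    have KL : K < theta * Num.sqrt n%:R.
      have : (Num.sqrt n%:R)^-1 < theta / (`|K| + 1) by near: n.
      rewrite ltr_pdivlMr ?ltr_wpDl// mulrC ltr_pdivrMr//; apply: lt_trans.
      by rewrite (le_lt_trans (ler_norm K))// ltrDl.
    rewrite -lee_fin EFinD EFinB !fineK ?fin_num_measure//; try exact: mset.
    rewrite -probability_setC; last exact: mset.
    apply: le_trans (measureU2 _ _ _); [|exact: mset|by apply: measurableC; exact: mset].
    apply: le_measure; rewrite ?inE; [exact: me| |move=> w /= h].
      by apply: measurableU; [exact: mset|by apply: measurableC; exact: mset].
    have tn0n : 0 < tn n by near: n; exact: tn0.
    have [|h'] := (compare n w n0 tn0n).2 h; [by left|right => /= h2].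
    by move: (lt_le_trans KL h'); rewrite ltNge h2.
have cE n : cdf (error_sp beta u t rho theta n (lambda n) : {RV P >-> R}) x = (e n)%:E.
  rewrite /e fineK; last by apply: fin_num_measure; exact: me.
  transitivity (P (error_sp beta u t rho theta n (lambda n) @^-1` `]-oo, x]%classic)); first by [].
  by congr (P _); apply/seteqP; split => w /=; rewrite in_itv.
have ceE : (e n)%:E @[n --> \oo] --> gaussian_law 0 v `]-oo, x]%classic.
  rewrite -(@fineK _ (gaussian_law 0 v _)) ?fin_num_measure//.
  by apply: cvg_EFin => //; exact: nearW.
by apply: cvg_trans ceE; apply: near_eq_cvg; apply: nearW => n; rewrite cE.
Unshelve. all: by end_near. Qed.
End delta_method.

Theorem corollary3p12 (R : realType) (dim : nat) (beta theta : R)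
    (hbeta : 0 < beta < Num.min 2 dim%:R) (htheta : 0 < theta)
    (d : measure_display) (Omega : measurableType d) (P : probability Omega R)
    (u : R -> 'rV[R]_dim -> {RV P >-> R})
    (hu : wave_solution beta theta u)
    (t : R) (ht : 0 < t) (rho : 'rV[R]_dim) (hrho : enorm rho = 1)
    (lambda : nat -> R) (hlambda : forall n, 0 < lambda n)
    (hlambda_o : lambda =o_\oo (fun n : nat => n%:R `^ (- 4^-1))) :
  cvg_in_law P
    (fun n => error_sp beta u t rho theta n (lambda n))
    (gaussian_law 0 (theta ^+ 2 * C_sp_V beta rho / C_sp_E beta rho ^+ 2)).
Proof. exact: asymptotic_normality. Qed.
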